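(* Assume $d\ge 3$. Let $\mathcal{Z}$ be a standard Poisson point process in $\mathbb{R}^d$. Almost surely, the series $$F(x)=\sum_{z\in\mathcal{Z},\ |z-x|\uparrow}\frac{z-x}{|z-x|^d}$$ (summands arranged in order of increasing distance from $x$) converges simultaneously for all $x$ for which it is defined (namely, all $x\in\mathbb{R}^d\setminus\mathcal{Z}$) and defines a translation-invariant (in distribution) vector-valued random function. The random function $F$ is almost surely continuously differentiable where it is defined.
   Context: $|\cdot|$ denotes the Euclidean norm in $\mathbb{R}^d$. A standard Poisson point process is a homogeneous Poisson point process of unit intensity (with respect to Lebesgue measure); it is identified with its random discrete set of points. The notation $|z-x|\uparrow$ under a sum over $z$ means that the terms are summed in order of increasing distance $|z-x|$ from $x$. *)

(* Defs.v *)
From HB Require Import structures.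
From mathcomp Require Export all_boot all_order all_algebra.
From mathcomp Require Export all_classical all_reals all_analysis measurable_realfun.

Set Implicit Arguments.
Unset Strict Implicit.
Unset Printing Implicit Defensive.

Export Order.TTheory GRing.Theory Num.Theory.
Export numFieldNormedType.Exports.

Local Open Scope classical_set_scope.
Local Open Scope ring_scope.

(* The library norm on ['rV[R]_d] is the sup norm. *)
Definition enorm (R : realType) (d : nat) (v : 'rV[R]_d) : R :=
  Num.sqrt (\sum_(i < d) v ord0 i ^+ 2).

Definition borel (R : realType) (d : nat) (A : set 'rV[R]_d) : Prop :=
  <<s [set U : set 'rV[R]_d | open U] >> A.

(* Lebesgue measure of the Borel sets of R^d, as the d-fold product of the
   one-dimensional Lebesgue measure: the measure of [A] is the integral over
   the first coordinate [t] of the (d-1)-dimensional measure of the section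
   of [A] at [t]; R^0 is a single point of mass 1. *)
Fixpoint volume (R : realType) (d : nat) : set 'rV[R]_d -> \bar R :=
  match d return set 'rV[R]_d -> \bar R with
  | 0%N => fun A => (\1_A 0)%:E
  | d'.+1 => fun A =>
      (\int[lebesgue_measure]_t
         volume [set v : 'rV[R]_d' | A (row_mx (t%:M : 'rV[R]_1) v)])%E
  end.

(* Taking some of the [B i] to be the full set gives the product rule for
   every subfamily. *)
Definition independent_rvs (disp disp' : measure_display)
    (T : measurableType disp) (T' : measurableType disp')
    (R : realType) (P : probability T R) (n : nat) (X : 'I_n -> T -> T')
    : Prop :=
  forall B : 'I_n -> set T', (forall i, measurable (B i)) ->
    P (\bigcap_i (X i @^-1` B i)) = (\prod_(i < n) P (X i @^-1` B i))%E.

Definition npoints (R : realType) (d : nat) (S A : set 'rV[R]_d) : \bar R :=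
  counting (S `&` A).

(* The second argument of [poisson_prob] is unused by the library definition;
   unlike [poisson_pmf], [poisson_prob] is the Dirac mass at 0 when the rate
   is 0, as it has to be for the sets of measure 0. *)
Record standard_poisson_process (disp : measure_display)
    (T : measurableType disp) (R : realType) (P : probability T R) (d : nat)
    (Z : T -> set 'rV[R]_d) : Prop := StandardPoissonProcess {
  spp_locally_finite : forall (w : T) (A : set 'rV[R]_d),
    bounded_set A -> finite_set (Z w `&` A) ;
  spp_measurable : forall A : set 'rV[R]_d, borel A ->
    measurable_fun [set: T] (fun w => npoints (Z w) A) ;
  spp_poisson : forall (A : set 'rV[R]_d) (n : nat), borel A ->
    (volume A < +oo)%E ->
    P [set w | npoints (Z w) A = n%:R%:E] =
    poisson_prob (fine (volume A)) 0 [set n] ;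
  spp_independent : forall (n : nat) (A : 'I_n -> set 'rV[R]_d),
    (forall i, borel (A i)) -> trivIset [set: 'I_n] A ->
    independent_rvs P (fun i w => npoints (Z w) (A i))
}.

Definition distance_enumeration (R : realType) (d : nat) (S : set 'rV[R]_d)
    (x : 'rV[R]_d) (e : nat -> 'rV[R]_d) : Prop :=
  set_bij [set: nat] S e /\
  forall m n : nat, (m <= n)%N -> enorm (e m - x) <= enorm (e n - x).

(* Several points of [S] may lie at the same distance from [x], in which case
   they may be summed in any order: all the resulting series have to converge,
   and to the same limit. *)
Definition sum_by_distance (R : realType) (d : nat) (S : set 'rV[R]_d)
    (x : 'rV[R]_d) (f : 'rV[R]_d -> 'rV[R]_d) (l : 'rV[R]_d) : Prop :=
  (exists e, distance_enumeration S x e) /\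
  (forall e, distance_enumeration S x e ->
     series (fun n => f (e n)) @ \oo --> l).

Definition attraction (R : realType) (d : nat) (x z : 'rV[R]_d) : 'rV[R]_d :=
  (enorm (z - x) ^+ d)^-1 *: (z - x).

(* Only meaningful at the points [x] outside [S] where the series converges. *)
Definition force (R : realType) (d : nat) (S : set 'rV[R]_d) (x : 'rV[R]_d)
    : 'rV[R]_d :=
  xget 0 [set l | sum_by_distance S x (attraction x) l].

(* The product sigma-algebra on functions R^d -> R^d. *)
Definition cylindrical (R : realType) (d : nat)
    (E : set ('rV[R]_d -> 'rV[R]_d)) : Prop :=
  <<s [set C : set ('rV[R]_d -> 'rV[R]_d) |
        exists (x : 'rV[R]_d) (B : set 'rV[R]_d),
          borel B /\ C = [set f | B (f x)]] >> E.

Definition random_function (disp : measure_display)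
    (T : measurableType disp) (R : realType) (d : nat)
    (G : T -> 'rV[R]_d -> 'rV[R]_d) : Prop :=
  forall E, cylindrical E -> measurable [set w | E (G w)].

Definition translation_invariant (disp : measure_display)
    (T : measurableType disp) (R : realType) (P : probability T R) (d : nat)
    (G : T -> 'rV[R]_d -> 'rV[R]_d) : Prop :=
  forall (a : 'rV[R]_d) E, cylindrical E ->
    P [set w | E (fun x => G w (x + a))] = P [set w | E (G w)].

(* [F w] is a partial function with domain [D w]. For each fixed [x], it is
   almost surely defined at [x] and equal to [G w x] there; the law of [F] is
   then that of [G], whichever [G] is chosen. *)
Definition version_of (disp : measure_display) (T : measurableType disp)
    (R : realType) (P : probability T R) (d : nat)
    (D : T -> set 'rV[R]_d) (F G : T -> 'rV[R]_d -> 'rV[R]_d) : Prop :=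
  forall x : 'rV[R]_d, {ae P, forall w, D w x /\ F w x = G w x}.

Definition continuously_differentiable_on (R : realType) (d : nat)
    (D : set 'rV[R]_d) (f : 'rV[R]_d -> 'rV[R]_d) : Prop :=
  (forall x, D x -> differentiable f x) /\
  {within D, continuous (jacobian f)}.

(* Main.v *)
(* Fix a centre.  A Poisson count of mean at most C r^d deviates from its mean by
   more than r^(d-1) / 2^k, where r = 16^k, with probability at most
   C' exp(-2^k), because d >= 3 gives r^(d-1) / 2^k >= 2^k r^(d/2).  By
   Borel-Cantelli this bounds the discrepancies of all the balls and of all the
   level sets of the coordinates of z / |z|^d in the shells between the radii
   16^k and 16^(k+1), after rounding squared radii and levels to integers.  The
   positive and the negative level sets are mirror images, so their means cancel
   and the k-th shell contributes O(2^-k): almost surely the sums over balls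
   around every rational point are Cauchy.

   This passes to all points by interpolation: the kernel at x minus a
   suitable affine combination of the kernels at d + 1 rational points near x
   decays like |z|^-(d+1).  Truncating the series smoothly instead of sharply
   does not change its limit, and gives locally uniform second order Taylor
   bounds, hence differentiability with a Lipschitz derivative off the points.

   Finally, the force is an almost sure limit of sums depending only on the
   numbers of points in the cells of finer and finer grids.  Shifting the grid
   does not change the joint law of these counts, so the finite-dimensional laws
   of the force and of its translates agree, and pi-lambda concludes. *)
From HB Require Import structures. From mathcomp Require Import ring lra zify finmap.
Require Import Defs.
Set Implicit Arguments.
Unset Strict Implicit.
Unset Printing Implicit Defensive.
Local Open Scope classical_set_scope.
Local Open Scope ring_scope.

(** Two borderline effects shape the proof. First, Borel-Cantelli handles one centre at a time, and
    uncountably many [x] must be reached from countably many centres. Moving to a single nearby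
    rational point does not suffice: the gradient of the kernel decays like |z|^-d, whose sum over
    the points diverges logarithmically. Matching the kernel to first order by d + 1 centres gains
    the one power that makes the error absolutely summable. Second, sums over sharp balls jump as
    the ball moves with [x], whereas the cutoff (1 - |y|^2/r^2)_+^2 has Taylor constants independent
    of [r]. The gradients of the truncated sums are not bounded by summation: only the quadratic
    remainders are, and the limit gradient is recovered from difference quotients. The base 16 = 2^4
    makes every scale an integer power of q = 2^k: volumes are of order q^(4d) and discrepancies
    q^(4d-5), so the Chernoff parameter q^(-2d) gives an exponent q^(2d-5), at least q exactly when
    d >= 3. The process is known through its counts only, so measurability and law of the force are
    reached through finite sums of counts. *)

Section real_distances.
Context {R : realType}.
Implicit Types a b c e : R.

Lemma ler_dist2 a b c e : `|a - c| <= e -> `|b - c| <= e -> `|a - b| <= 2 * e.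
Proof.
by rewrite !ler_norml => /andP[? ?] /andP[? ?]; apply/andP; split; lra.
Qed.

Lemma ler_dist_chain a a' b b' e e' : `|a - a'| <= e -> `|b - b'| <= e ->
  `|a' - b'| <= e' -> `|a - b| <= e *+ 2 + e'.
Proof.
rewrite !ler_norml => /andP[? ?] /andP[? ?] /andP[? ?].
by apply/andP; split; lra.
Qed.

Lemma ler_distB a a' b b' e : `|a - a'| <= e -> `|b - b'| <= e ->
  `|(a - b) - (a' - b')| <= e *+ 2.
Proof.
by rewrite !ler_norml => /andP[? ?] /andP[? ?]; apply/andP; split; lra.
Qed.

(** [max 0 u ^+ 2] is convex with the 2-Lipschitz derivative [2 * max 0 u], so its first order
    remainder for the step [- v] lies between 0 and [v ^+ 2]. This is the one-variable core of
    [tame_cutoff]. *)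
Lemma sqr_max_expansion (u v : R) :
  0 <= Num.max 0 (u - v) ^+ 2 - Num.max 0 u ^+ 2 + 2 * Num.max 0 u * v <= v ^+ 2.
Proof.
have v2 := sqr_ge0 v; have uv2 := sqr_ge0 (u - v).
have [u0|u0] := leP 0 u; have [uv|uv] := leP 0 (u - v).
- by apply/andP; split; lra.
- have : 0 <= u * (v - u) by rewrite mulr_ge0//; lra.
  have : 0 <= u * v by rewrite mulr_ge0//; lra.
  by move=> ? ?; apply/andP; split; lra.
- have : 0 <= u * (v + (v - u)) by rewrite mulr_le0//; lra.
  by move=> ?; apply/andP; split; lra.
- by rewrite !expr0n/= subrr mulr0 mul0r addr0 lexx.
Qed.

End real_distances.

(** * Euclidean norm and kernels *)

Section euclidean_norm.
Context {R : realType} {d : nat}.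
Implicit Types u v w : 'rV[R]_d.

Definition dotr u v : R := \sum_(i < d) u ord0 i * v ord0 i.

Lemma dotrC u v : dotr u v = dotr v u.
Proof. by apply: eq_bigr => i _; rewrite mulrC. Qed.

Lemma dotrDl u v w : dotr (u + v) w = dotr u w + dotr v w.
Proof. by rewrite -big_split; apply: eq_bigr => i _; rewrite mxE mulrDl. Qed.

Lemma dotrDr u v w : dotr u (v + w) = dotr u v + dotr u w.
Proof. by rewrite !(dotrC u) dotrDl. Qed.

Lemma dotrZl a u v : dotr (a *: u) v = a * dotr u v.
Proof. by rewrite mulr_sumr; apply: eq_bigr => i _; rewrite mxE mulrA. Qed.

Lemma dotrZr a u v : dotr u (a *: v) = a * dotr u v.
Proof. by rewrite dotrC dotrZl dotrC. Qed.

Lemma dotr0l u : dotr 0 u = 0.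
Proof. by rewrite -(scale0r 0) dotrZl mul0r. Qed.

Lemma dotr_delta u i : dotr u (delta_mx ord0 i) = u ord0 i.
Proof.
rewrite /dotr (bigD1 i)//= big1 ?addr0 => [|j ji].
  by rewrite mxE !eqxx mulr1.
by rewrite mxE (negbTE ji) andbF mulr0.
Qed.

Lemma dotr_ge0 u : 0 <= dotr u u.
Proof. by apply: sumr_ge0 => i _; rewrite -expr2 sqr_ge0. Qed.

Lemma enorm_ge0 u : 0 <= enorm u.
Proof. exact: sqrtr_ge0. Qed.

Lemma enorm_sqr u : enorm u ^+ 2 = dotr u u.
Proof.
rewrite /enorm sqr_sqrtr; first by apply: eq_bigr => i _; rewrite expr2.
by apply: sumr_ge0 => i _; rewrite sqr_ge0.
Qed.

Lemma coord_le_enorm u i : `|u ord0 i| <= enorm u.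
Proof.
rewrite -(@ler_pXn2r _ 2)// ?nnegrE ?enorm_ge0// enorm_sqr real_normK ?num_real//.
by rewrite /dotr (bigD1 i)//= -expr2 lerDl sumr_ge0// => j _; rewrite -expr2 sqr_ge0.
Qed.

Lemma enorm0 : enorm (0 : 'rV[R]_d) = 0.
Proof. by apply/eqP; rewrite -sqrf_eq0 enorm_sqr dotr0l. Qed.

Lemma enorm_eq0 u : (enorm u == 0) = (u == 0).
Proof.
apply/eqP/eqP => [u0|->]; last exact: enorm0.
apply/rowP => i; apply/eqP; rewrite mxE -normr_le0.
by rewrite (le_trans (coord_le_enorm u i))// u0.
Qed.

Lemma enorm_gt0 u : (0 < enorm u) = (u != 0).
Proof. by rewrite lt0r enorm_ge0 enorm_eq0 andbT. Qed.

Lemma enormZ a u : enorm (a *: u) = `|a| * enorm u.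
Proof.
apply/eqP; rewrite -(@eqrXn2 _ 2)// ?mulr_ge0 ?enorm_ge0//.
by rewrite exprMn !enorm_sqr dotrZl dotrZr real_normK ?num_real// expr2 mulrA.
Qed.

Lemma enormN u : enorm (- u) = enorm u.
Proof. by rewrite -scaleN1r enormZ normrN1 mul1r. Qed.

Lemma enormBC u v : enorm (u - v) = enorm (v - u).
Proof. by rewrite -opprB enormN. Qed.

Lemma ler_dotr u v : `|dotr u v| <= enorm u * enorm v.
Proof.
wlog uv0 : u / 0 <= dotr u v.
  move=> H; have [/H//|/ltW uv0] := leP 0 (dotr u v).
  rewrite -normrN -(enormN u) -mulN1r -dotrZl scaleN1r; apply: H.
  by rewrite -scaleN1r dotrZl mulN1r oppr_ge0.
rewrite ger0_norm//.
have [->|u0] := eqVneq u 0; first by rewrite dotr0l enorm0 mul0r.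
have [->|v0] := eqVneq v 0; first by rewrite dotrC dotr0l enorm0 mulr0.
rewrite -!enorm_gt0 in u0 v0.
have := dotr_ge0 (enorm v *: u - enorm u *: v).
rewrite -scaleNr !dotrDl !dotrDr !dotrZl !dotrZr (dotrC v u) -!enorm_sqr => H.
have {}H : 0 <= (enorm u * enorm v) * (enorm u * enorm v - dotr u v).
  by move: H; set a := enorm u; set b := enorm v; set c := dotr _ _; nra.
by rewrite -subr_ge0; move: H; rewrite pmulr_rge0// mulr_gt0.
Qed.

Lemma enormD_sqr u v :
  enorm (u + v) ^+ 2 = enorm u ^+ 2 + dotr u v *+ 2 + enorm v ^+ 2.
Proof. by rewrite !enorm_sqr dotrDl !dotrDr (dotrC v u); ring. Qed.

Lemma ler_enormD u v : enorm (u + v) <= enorm u + enorm v.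
Proof.
rewrite -(@ler_pXn2r _ 2)// ?nnegrE ?addr_ge0 ?enorm_ge0// enormD_sqr sqrrD.
by rewrite lerD2r lerD2l lerMn2r/= (le_trans (ler_norm _))// ler_dotr.
Qed.

Lemma ler_enormB w u v : enorm (u - v) <= enorm (u - w) + enorm (w - v).
Proof. by rewrite -{1}(subrK w u) -addrA ler_enormD. Qed.

Lemma lerB_enorm u v : enorm u - enorm v <= enorm (u - v).
Proof. by rewrite lerBlDr -{1}(subrK v u) ler_enormD. Qed.

Lemma ler_dist_enorm u v : `|enorm (u + v) - enorm u| <= enorm v.
Proof.
rewrite ler_norml lerBlDr [enorm v + _]addrC ler_enormD andbT.
rewrite lerNl opprB (le_trans (lerB_enorm _ _))//.
by rewrite opprD addNKr enormN.
Qed.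

Lemma norm_le_enorm u : `|u| <= enorm u.
Proof.
rewrite /Num.Def.normr/= mx_normrE.
apply/bigmax_leP; split; first exact: enorm_ge0.
by move=> [i j] _; rewrite /= ord1 coord_le_enorm.
Qed.

Lemma coord_le_norm u i : `|u ord0 i| <= `|u|.
Proof.
rewrite [leRHS]/Num.Def.normr/= mx_normrE.
exact: (le_bigmax _ (fun ij => `|u ij.1 ij.2|) (ord0, i)).
Qed.

Lemma enorm_le_norm u : enorm u <= d%:R * `|u|.
Proof.
rewrite -(@ler_pXn2r _ 2)// ?nnegrE ?mulr_ge0 ?enorm_ge0// enorm_sqr.
have -> : (d%:R * `|u|) ^+ 2 = d%:R * (d%:R * `|u| ^+ 2) by ring.
rewrite (@le_trans _ _ (d%:R * `|u| ^+ 2))//.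
  rewrite -[in d%:R](card_ord d) -sum1_card natr_sum mulr_suml ler_sum// => i _.
  rewrite mul1r -expr2 -[leLHS]real_normK ?num_real//.
  by rewrite ler_pXn2r ?nnegrE// coord_le_norm.
have [d0|d0] := posnP d; last by rewrite ler_peMl ?mulr_ge0 ?sqr_ge0// ler1n.
by rewrite [X in X * _](_ : _ = 0) ?mul0r ?mulr_ge0 ?sqr_ge0// [in LHS]d0.
Qed.

Lemma enorm_le_coords u (c : R) : 0 <= c -> (forall j, `|u ord0 j| <= c) ->
  enorm u <= d%:R * c.
Proof.
move=> c0 uc; rewrite (le_trans (enorm_le_norm _))// ler_wpM2l//.
rewrite /Num.Def.normr/= mx_normrE; apply/bigmax_leP; split => // -[j0 j] _ /=.
by rewrite ord1.
Qed.

End euclidean_norm.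

#[export] Hint Extern 0 (is_true (0 <= enorm _)) => exact: enorm_ge0 : core.

(** * Second order Taylor bounds at a common scale *)

Section tame.
Context {R : realType} {d : nat}.
Implicit Types (y h L : 'rV[R]_d) (f g : 'rV[R]_d -> R) (W : R).

(* [W] is a common scale for [f], for [|y|] times its gradient and for
   [|y|^2] times its second derivatives near [y]. *)
Definition tame f y W := exists L,
  [/\ `|f y| <= W, enorm L <= W / enorm y
    & forall h, enorm h <= enorm y / 2 ->
      `|f (y + h) - f y - dotr L h| <= W * (enorm h / enorm y) ^+ 2].

Lemma tame_eq f g y W : f =1 g -> tame f y W -> tame g y W.
Proof.
move=> fg [L [fW LW hW]]; exists L; split => //; first by rewrite -fg.
by move=> h; rewrite -!fg; exact: hW.
Qed.

Lemma tame_ge0 f y W : tame f y W -> 0 <= W.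
Proof. by move=> [L [fW _ _]]; rewrite (le_trans _ fW). Qed.

Lemma tame_lip f y W h : y != 0 -> tame f y W -> enorm h <= enorm y / 2 ->
  `|f (y + h) - f y| <= 2 * W * (enorm h / enorm y).
Proof.
move=> y0 tf; have W0 := tame_ge0 tf; case: tf => L [fW LW hW] hy.
have y0' : 0 < enorm y by rewrite enorm_gt0.
have := hW h hy; have := ler_dotr L h.
set t := enorm h / enorm y.
have t12 : t <= 1 / 2 by rewrite /t ler_pdivrMr//; lra.
have t0 : 0 <= t by rewrite divr_ge0 ?enorm_ge0.
have : enorm L * enorm h <= W * t.
  have -> : W * t = W / enorm y * enorm h by rewrite /t mulrCA mulrC -!mulrA.
  by rewrite ler_wpM2r ?enorm_ge0.
have : W * t ^+ 2 <= W * t.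
  by rewrite ler_wpM2l// expr2 ler_piMl//; lra.
rewrite !ler_norml; lra.
Qed.

Lemma tame_cst c y W : `|c| <= W -> tame (fun=> c) y W.
Proof.
move=> cW; have W0 : 0 <= W by rewrite (le_trans _ cW).
exists 0; split => //; first by rewrite enorm0 divr_ge0// enorm_ge0.
by move=> h _; rewrite subrr dotr0l subr0 normr0 mulr_ge0 ?sqr_ge0.
Qed.

(** Leibniz rule: the remainder of the product splits into six terms, each at least quadratic in
    [|h|/|y|]. *)
Lemma tameM f g y W W' : y != 0 -> tame f y W -> tame g y W' ->
  tame (fun z => f z * g z) y (5 * (W * W')).
Proof.
move=> y0 tf tg; have W0 := tame_ge0 tf; have W'0 := tame_ge0 tg.
have WW'0 := mulr_ge0 W0 W'0.
case: tf tg => L [fW LW hW] [L' [gW LW' hW']].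
have y0' : 0 < enorm y by rewrite enorm_gt0.
exists (f y *: L' + g y *: L); split.
- rewrite normrM (@le_trans _ _ (W * W'))//; first exact: ler_pM.
  by lra.
- rewrite (le_trans (ler_enormD _ _))// !enormZ.
  rewrite (@le_trans _ _ (W * (W' / enorm y) + W' * (W / enorm y)))//.
    by rewrite lerD// ler_pM ?enorm_ge0.
  rewrite (_ : _ + _ = (2 * (W * W')) / enorm y); last by ring.
  by rewrite ler_wpM2r ?invr_ge0 ?enorm_ge0//; lra.
move=> h hy; set t := enorm h / enorm y.
have t12 : t <= 1 / 2 by rewrite /t ler_pdivrMr//; lra.
have t0 : 0 <= t by rewrite divr_ge0 ?enorm_ge0.
have Lh K V : enorm K <= V / enorm y -> `|dotr K h| <= V * t.
  move=> KV; rewrite (le_trans (ler_dotr _ _))//.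
  have -> : V * t = V / enorm y * enorm h by rewrite /t mulrCA mulrC -!mulrA.
  by rewrite ler_wpM2r ?enorm_ge0.
have := hW h hy; have := hW' h hy; rewrite -/t.
set r := f (y + h) - _ - _; set r' := g (y + h) - _ - _ => r'W rW.
have -> : f (y + h) * g (y + h) - f y * g y - dotr (f y *: L' + g y *: L) h
    = f y * r' + r * g y + dotr L h * dotr L' h + dotr L h * r' + r * dotr L' h
      + r * r'.
  rewrite dotrDl !dotrZl.
  have -> : f (y + h) = f y + dotr L h + r by rewrite /r; ring.
  have -> : g (y + h) = g y + dotr L' h + r' by rewrite /r'; ring.
  by ring.
have LW1 := Lh _ _ LW; have LW1' := Lh _ _ LW'.
have t20 : 0 <= t ^+ 2 by rewrite sqr_ge0.
have B1 : `|f y * r'| <= W * (W' * t ^+ 2) by rewrite normrM ler_pM.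
have B2 : `|r * g y| <= W * t ^+ 2 * W' by rewrite normrM ler_pM.
have B3 : `|dotr L h * dotr L' h| <= W * t * (W' * t) by rewrite normrM ler_pM.
have B4 : `|dotr L h * r'| <= W * t * (W' * t ^+ 2) by rewrite normrM ler_pM.
have B5 : `|r * dotr L' h| <= W * t ^+ 2 * (W' * t) by rewrite normrM ler_pM.
have B6 : `|r * r'| <= W * t ^+ 2 * (W' * t ^+ 2) by rewrite normrM ler_pM.
apply: (@le_trans _ _ (W * (W' * t ^+ 2) + W * t ^+ 2 * W' + W * t * (W' * t)
    + W * t * (W' * t ^+ 2) + W * t ^+ 2 * (W' * t)
    + W * t ^+ 2 * (W' * t ^+ 2))).
  by do 5! (apply: (le_trans (ler_normD _ _)); apply: lerD => //).
(* With [t <= 1/2] the last factor is at most 5, the constant of the statement. *)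
rewrite (_ : _ + _ = W * W' * t ^+ 2 * (3 + 2 * t + t ^+ 2)); last by ring.
rewrite (_ : 5 * _ * _ = W * W' * t ^+ 2 * 5); last by ring.
rewrite ler_wpM2l//; first exact: mulr_ge0.
have : t ^+ 2 <= 1 by rewrite expr_le1//; lra.
by lra.
Qed.

End tame.

Section kernels.
Context {R : realType} {d : nat}.
Implicit Types (y h : 'rV[R]_d) (f : 'rV[R]_d -> R) (r : R).

Lemma tame_coord y (i : 'I_d) : y != 0 -> tame (fun z => z ord0 i) y (enorm y).
Proof.
move=> y0; exists (delta_mx ord0 i); split; first exact: coord_le_enorm.
  rewrite divff ?enorm_eq0// -(@ler_pXn2r _ 2)// ?nnegrE//.
  by rewrite enorm_sqr dotr_delta mxE !eqxx expr1n.
move=> h _; rewrite dotrC dotr_delta mxE [y _ _ + _]addrC addrK subrr normr0.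
by rewrite mulr_ge0// sqr_ge0.
Qed.

Lemma tameX f y W n : y != 0 -> tame f y W ->
  tame (fun z => f z ^+ n) y ((5 * W) ^+ n).
Proof.
move=> y0 tf; elim: n => [|n IH].
  by apply: (@tame_eq _ _ (fun=> 1)) => //; apply: tame_cst; rewrite normr1.
apply: (@tame_eq _ _ (fun z => f z * f z ^+ n)).
  by move=> z; rewrite exprS.
by rewrite exprS -mulrA; exact: tameM.
Qed.

Lemma tame_inv_enorm y : y != 0 -> tame (fun z => (enorm z)^-1) y (6 / enorm y).
Proof.
move=> y0; have n0 : 0 < enorm y by rewrite enorm_gt0.
(* The gradient of [1/|z|] at [y] is [- y/|y|^3]. *)
exists (- (enorm y ^- 3) *: y); split.
- by rewrite ger0_norm ?invr_ge0// ler_peMl ?invr_ge0//; lra.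
- rewrite enormZ normrN ger0_norm ?invr_ge0 ?exprn_ge0//.
  rewrite (_ : enorm y ^- 3 * _ = (enorm y)^-1 / enorm y); last first.
    by field; rewrite enorm_eq0.
  by rewrite ler_wpM2r ?invr_ge0// ler_peMl ?invr_ge0//; lra.
move=> h hy; rewrite dotrZl.
have := ler_dotr y h; have := ler_dist_enorm y h; have := enormD_sqr y h.
have := enorm_ge0 h; move: n0 hy.
set n := enorm y; set m := enorm (y + h); set e := enorm h.
set b := dotr y h => n0 en e0 mE; rewrite ler_norml => /andP[mn1 mn2] bne.
have m0 : 0 < m by lra.
set X := _ - _ - _.
(* Once denominators are cleared, the remainder is visibly quadratic in [e], as [|b| <= n e] and
   [|m - n| <= e]; moreover [n <= 2 m] because [e <= n / 2]. *)
have XE : n ^+ 3 * m * (m + n) * X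
    = b * (m - n) * (m + 2 * n) - e ^+ 2 * n ^+ 2.
  have -> : e ^+ 2 = m ^+ 2 - n ^+ 2 - b *+ 2 by rewrite mE; ring.
  by rewrite /X; field; rewrite !gt_eqF.
have D0 : 0 < n ^+ 3 * m * (m + n) by rewrite !mulr_gt0 ?exprn_gt0 ?addr_gt0.
rewrite -(ler_pM2l D0) -[X in X * `|_|](gtr0_norm D0) -normrM XE.
rewrite (_ : _ * (6 / n * _) = 6 * e ^+ 2 * (m * (m + n))); last first.
  by field; rewrite gt_eqF.
have mn : `|m - n| <= e by rewrite ler_norml; apply/andP; split; lra.
have B : `|b * (m - n) * (m + 2 * n)| <= n * e * e * (m + 2 * n).
  rewrite normrM [X in _ * X]ger0_norm; last by lra.
  by apply: ler_wpM2r; [lra | rewrite normrM; exact: ler_pM].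
rewrite (le_trans (ler_normB _ _))// (ger0_norm (x := _ * n ^+ 2)); last first.
  by rewrite mulr_ge0 ?sqr_ge0.
rewrite (le_trans (lerD B (lexx _)))//.
rewrite (_ : _ + _ = e ^+ 2 * (n * (m + 3 * n))); last by ring.
rewrite -[leRHS]mulrA [leRHS]mulrCA ler_wpM2l ?sqr_ge0//.
have : n * n <= (2 * m) * (2 * m) by rewrite ler_pM//; lra.
have : n * n <= (2 * m) * n by rewrite ler_pM2r//; lra.
have : 0 < m * n by rewrite mulr_gt0.
lra.
Qed.

Definition kern (i : 'I_d) y : R := (enorm y ^+ d)^-1 * y ord0 i.

(** The factor 30 = 5 * 6 is paid through [tameX] for each of the [d] factors [1/|z|], the outer 5
    through [tameM] for the product with the coordinate. *)
Definition kern_cst : R := 5 * 30 ^+ d.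

Lemma tame_kern i y : y != 0 ->
  tame (kern i) y (kern_cst * (enorm y / enorm y ^+ d)).
Proof.
move=> y0; apply: (@tame_eq _ _ (fun z => (enorm z)^-1 ^+ d * z ord0 i)).
  by move=> z; rewrite /kern exprVn.
rewrite (_ : _ * _ = 5 * ((5 * (6 / enorm y)) ^+ d * enorm y)).
  by apply: tameM => //; [exact/tameX/tame_inv_enorm|exact: tame_coord].
rewrite /kern_cst (_ : 5 * (6 / enorm y) = 30 / enorm y); last by ring.
by rewrite expr_div_n; ring.
Qed.

(** The outer square makes the gradient Lipschitz across the sphere of radius [r]. Being radial and
    decreasing, the cutoff gives nonincreasing weights along an enumeration by distance, as Abel
    summation requires. *)
Definition cutoff r y : R := Num.max 0 (1 - enorm y ^+ 2 / r ^+ 2) ^+ 2.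

Lemma cutoff_itv r y : 0 <= cutoff r y <= 1.
Proof.
rewrite /cutoff; set u := Num.max _ _.
have u0 : 0 <= u by rewrite le_max lexx.
rewrite exprn_ge0//= expr_le1// ge_max ler01/= gerBl divr_ge0//.
all: exact: sqr_ge0.
Qed.

Lemma cutoff_eq0 r y : 0 < r -> r <= enorm y -> cutoff r y = 0.
Proof.
move=> r0 ry; rewrite /cutoff max_l ?expr0n// subr_le0.
by rewrite ler_pdivlMr ?exprn_gt0// mul1r lerXn2r ?nnegrE// ltW.
Qed.

Lemma cutoff_le r y y' : 0 < r -> enorm y <= enorm y' ->
  cutoff r y' <= cutoff r y.
Proof.
move=> r0 yy'; rewrite /cutoff lerXn2r ?nnegrE ?le_max ?lexx//.
have : 1 - enorm y' ^+ 2 / r ^+ 2 <= 1 - enorm y ^+ 2 / r ^+ 2.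
  by rewrite lerD2l lerN2 ler_pM2r ?invr_gt0 ?exprn_gt0// lerXn2r ?nnegrE.
move: (1 - _) (1 - _) => u v; rewrite -le_max => uv.
by rewrite !ge_max !le_max lexx uv orbT.
Qed.

Lemma cutoff_ge r y : 0 < r -> 1 - 2 * (enorm y ^+ 2 / r ^+ 2) <= cutoff r y.
Proof.
move=> r0; rewrite /cutoff; set t := _ / _; case: (leP 0 (1 - t)) => t1.
  by have := sqr_ge0 t; rewrite sqrrB; lra.
by rewrite expr0n/=; lra.
Qed.

(** The constant does not depend on [r]: unless the cutoff vanishes at both ends of the step,
    [|y| <= 2 r], so a bound in units of [r] is also one in units of [|y|]. *)
Lemma tame_cutoff r y : 0 < r -> y != 0 -> tame (cutoff r) y 108.
Proof.
move=> r0 y0; have n0 : 0 < enorm y by rewrite enorm_gt0.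
have r20 : 0 < r ^+ 2 by rewrite exprn_gt0.
have n20 : 0 < enorm y ^+ 2 by rewrite exprn_gt0.
set p := Num.max 0 (1 - enorm y ^+ 2 / r ^+ 2).
have p0 : 0 <= p by rewrite le_max lexx.
have p1 : p <= 1 by rewrite ge_max ler01/= gerBl divr_ge0 ?ltW.
have pn : p * (enorm y ^+ 2 / r ^+ 2) <= p.
  rewrite /p; case: (leP 0 (1 - enorm y ^+ 2 / r ^+ 2)) => t1.
    by rewrite ler_piMr//; lra.
  by rewrite mul0r.
(* This gradient is at most [4/|y|] in norm, because [p > 0] forces [|y| <= r]. *)
exists (- (4 * p / r ^+ 2) *: y); split.
- by have /andP[c0 c1] := cutoff_itv r y; rewrite ger0_norm//; lra.
- rewrite enormZ normrN (ger0_norm (x := 4 * p / _)); last first.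
    by rewrite divr_ge0 ?mulr_ge0// ltW.
  rewrite (_ : 4 * p / _ * _ = 4 * (p * (enorm y ^+ 2 / r ^+ 2)) / enorm y); last first.
    by field; rewrite enorm_eq0 y0 gt_eqF.
  by rewrite ler_pM2r ?invr_gt0//; lra.
move=> h hy; rewrite dotrZl.
have := ler_dotr y h; have := ler_dist_enorm y h; have := enormD_sqr y h.
have := enorm_ge0 h; move: hy pn; rewrite /cutoff -/p.
set n := enorm y; set m := enorm (y + h); set e := enorm h.
set b := dotr y h => en pn e0 mE; rewrite !ler_norml => /andP[mn1 mn2].
move=> /andP[bn1 bn2]; set p' := Num.max _ _.
have p'0 : 0 <= p' by rewrite le_max lexx.
have T0 : 0 <= 108 * (e / n) ^+ 2 by rewrite mulr_ge0 ?sqr_ge0.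
have [/andP[/eqP -> /eqP ->]|pp'] := boolP ((p == 0) && (p' == 0)).
  rewrite !expr0n/= subrr mulr0 !mul0r oppr0 mul0r subr0.
  by apply/andP; split; lra.
have n2r : n <= 2 * r.
  rewrite leNgt; apply/negP => rn; move/negP : pp'; apply.
  rewrite /p /p' !max_l ?eqxx// -/n -/m subr_le0 ler_pdivlMr// mul1r.
    by rewrite lerXn2r ?nnegrE//; lra.
  by rewrite lerXn2r ?nnegrE//; lra.
have DE : 1 - m ^+ 2 / r ^+ 2 = 1 - n ^+ 2 / r ^+ 2 - (b *+ 2 + e ^+ 2) / r ^+ 2.
  by rewrite mE; ring.
set D := (b *+ 2 + e ^+ 2) / r ^+ 2 in DE.
have e2 : e ^+ 2 <= n * e / 2 by rewrite expr2; nra.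
have e20 : 0 <= e ^+ 2 by rewrite sqr_ge0.
have DB : `|D| <= 5 / 2 * (n * e) / r ^+ 2.
  rewrite /D normrM [X in _ * X]gtr0_norm ?invr_gt0// ler_pM2r ?invr_gt0//.
  by rewrite ler_norml; apply/andP; split; lra.
have nr : n ^+ 2 / r ^+ 2 <= 4.
  by rewrite ler_pdivrMr// (_ : 4 * _ = (2 * r) ^+ 2);
    [rewrite lerXn2r ?nnegrE//; lra | ring].
(* [D2] and [er] bound the two parts of the remainder by 100 and 8 times [(e / n) ^+ 2], hence
   108. *)
have D2 : D ^+ 2 <= 100 * (e / n) ^+ 2.
  have : `|D| ^+ 2 <= (5 / 2 * (n * e) / r ^+ 2) ^+ 2.
    by rewrite lerXn2r ?nnegrE// (le_trans _ DB).
  rewrite real_normK ?num_real// => /le_trans; apply.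
  rewrite (_ : _ ^+ 2 = 25 / 4 * (n ^+ 2 / r ^+ 2) ^+ 2 * (e / n) ^+ 2).
    rewrite ler_wpM2r ?sqr_ge0//.
    have : (n ^+ 2 / r ^+ 2) ^+ 2 <= 4 ^+ 2.
      by rewrite lerXn2r ?nnegrE// divr_ge0 ?ltW.
    by lra.
  by field; rewrite !gt_eqF.
have er : 2 * p * (e ^+ 2 / r ^+ 2) <= 8 * (e / n) ^+ 2.
  rewrite (_ : e ^+ 2 / r ^+ 2 = (n ^+ 2 / r ^+ 2) * (e / n) ^+ 2).
    rewrite mulrA ler_wpM2r ?sqr_ge0//.
    have : p * (n ^+ 2 / r ^+ 2) <= 1 * 4 by rewrite ler_pM// divr_ge0 ?ltW.
    by lra.
  by field; rewrite !gt_eqF.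
have er0 : 0 <= 2 * p * (e ^+ 2 / r ^+ 2).
  apply: mulr_ge0; first by rewrite mulr_ge0.
  by rewrite divr_ge0// ltW.
have -> : p' ^+ 2 - p ^+ 2 - - (4 * p / r ^+ 2) * b
    = p' ^+ 2 - p ^+ 2 + 2 * p * D - 2 * p * (e ^+ 2 / r ^+ 2).
  by rewrite /D; ring.
have pD : 0 <= p' ^+ 2 - p ^+ 2 + 2 * p * D <= D ^+ 2.
  by rewrite /p' /p DE -/n; exact: sqr_max_expansion.
by apply/andP; split; lra.
Qed.

Definition smooth_kern r (i : 'I_d) y : R := kern i y * cutoff r y.

Definition smooth_cst : R := 5 * (kern_cst * 108).

Lemma tame_smooth_kern r i y : 0 < r -> y != 0 ->
  tame (smooth_kern r i) y (smooth_cst * (enorm y / enorm y ^+ d)).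
Proof.
move=> r0 y0; rewrite /smooth_cst.
rewrite (_ : _ * _ = 5 * ((kern_cst * (enorm y / enorm y ^+ d)) * 108)).
  by apply: tameM => //; [exact: tame_kern|exact: tame_cutoff].
by ring.
Qed.

Lemma kern_le i y : `|kern i y| <= enorm y / enorm y ^+ d.
Proof.
rewrite /kern normrM mulrC (ger0_norm (x := _^-1)) ?invr_ge0 ?exprn_ge0//.
by rewrite ler_wpM2r ?invr_ge0 ?exprn_ge0// coord_le_enorm.
Qed.

End kernels.
Arguments kern_cst : clear implicits.
Arguments smooth_cst : clear implicits.

(** * Sums over point sets *)

Section finite_sums.
Context {R : realType} {T : choiceType}.
Implicit Types (A B F : set T) (f g : T -> R).

Definition fsum A f : R := \sum_(z <- fset_set A) f z.

Definition card A : R := fsum A (fun=> 1).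

Lemma cardE A : card A = (#|` fset_set A|)%:R.
Proof. by rewrite /card /fsum big_const_seq count_predT iter_addr addr0. Qed.

Lemma fsumID B A f : finite_set A -> B `<=` A ->
  fsum A f = fsum B f + fsum (A `\` B) f.
Proof.
move=> fA BA; have fB := sub_finite_set BA fA.
rewrite /fsum (big_fsetID _ (mem (fset_set B)))/=; congr (_ + _).
  congr (\sum_(z <- enum_fset _) _); apply/fsetP => z; rewrite !inE in_fset_set//.
  rewrite in_fset_set//; apply/andP/idP => [[]//|zB]; split=> //.
  by move/set_mem : zB => /BA zA; exact: mem_set.
congr (\sum_(z <- enum_fset _) _); apply/fsetP => z; rewrite fset_setD// !inE.
by rewrite andbC.
Qed.

Lemma eq_fsum A f g : finite_set A -> (forall z, A z -> f z = g z) ->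
  fsum A f = fsum A g.
Proof.
move=> fA fg; apply: eq_big_seq => z; rewrite in_fset_set// => /set_mem.
exact: fg.
Qed.

Lemma ler_fsum A f g : finite_set A -> (forall z, A z -> f z <= g z) ->
  fsum A f <= fsum A g.
Proof.
move=> fA fg; rewrite /fsum !big_seq; apply: ler_sum => z.
by rewrite in_fset_set// => /set_mem; exact: fg.
Qed.

Lemma fsum_ge0 A f : finite_set A -> (forall z, A z -> 0 <= f z) -> 0 <= fsum A f.
Proof.
move=> fA f0; rewrite /fsum big_seq; apply: sumr_ge0 => z.
by rewrite in_fset_set// => /set_mem; exact: f0.
Qed.

Lemma fsumD A f g : fsum A (fun z => f z + g z) = fsum A f + fsum A g.
Proof. exact: big_split. Qed.

Lemma fsumN A f : fsum A (fun z => - f z) = - fsum A f.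
Proof. by rewrite /fsum sumrN. Qed.

Lemma fsumB A f g : fsum A (fun z => f z - g z) = fsum A f - fsum A g.
Proof. by rewrite fsumD fsumN. Qed.

Lemma fsumZ A a f : fsum A (fun z => a * f z) = a * fsum A f.
Proof. by rewrite /fsum mulr_sumr. Qed.

Lemma fsum_cst A c : fsum A (fun=> c) = c * card A.
Proof. by rewrite -fsumZ; apply: eq_bigr => z _; rewrite mulr1. Qed.

Lemma ler_norm_fsum A f : `|fsum A f| <= fsum A (fun z => `|f z|).
Proof. exact: ler_norm_sum. Qed.

Lemma card_ge0 A : 0 <= card A.
Proof. by rewrite cardE. Qed.

Lemma le_card A B : finite_set B -> A `<=` B -> card A <= card B.
Proof. by move=> fB AB; rewrite /card (fsumID _ fB AB) lerDl card_ge0. Qed.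

Lemma ler_fsum_card A f c : finite_set A -> (forall z, A z -> `|f z| <= c) ->
  `|fsum A f| <= c * card A.
Proof.
move=> fA fc; rewrite (le_trans (ler_norm_fsum _ _))// -fsum_cst.
exact: ler_fsum.
Qed.

Lemma fsum_subset_le A B f : finite_set B -> A `<=` B ->
  (forall z, B z -> 0 <= f z) -> fsum A f <= fsum B f.
Proof.
move=> fB AB f0; rewrite (fsumID _ fB AB) lerDl; apply: fsum_ge0.
  exact: finite_setD.
by move=> z [/f0].
Qed.

Lemma fsum_between A F B f c : finite_set B -> A `<=` F -> F `<=` B ->
  (forall z, B z -> ~ A z -> `|f z| <= c) -> 0 <= c ->
  `|fsum F f - fsum A f| <= c * (card B - card A).
Proof.
move=> fB AF FB fc c0; have fF := sub_finite_set FB fB.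
have AB := subset_trans AF FB.
rewrite (fsumID _ fF AF) addrAC subrr add0r.
rewrite (le_trans (ler_fsum_card (c := c) _ _))//.
- exact: finite_setD.
- by move=> z [/FB Bz nAz]; exact: fc.
- apply: ler_wpM2l => //; rewrite /card (fsumID _ fB AB) addrAC subrr add0r.
  by apply: le_card; [exact: finite_setD|exact: setSD].
Qed.

Lemma fsum_enum (e : nat -> T) n f : injective e ->
  fsum (e @` `I_n) f = \sum_(m < n) f (e m).
Proof.
move=> einj; rewrite /fsum fset_set_image ?big_imfset//=; last first.
- by move=> ? ? _ _; exact: einj.
- by rewrite fset_set_II big_imfset//= ?big_enum// => ? ? _ _; exact: val_inj.
Qed.

Lemma finite_set_bound A (h : T -> R) : finite_set A ->
  exists b, forall z, A z -> h z <= b.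
Proof.
move=> fA; exists (fsum A (fun z => `|h z|)) => z Az.
have A1 : [set z] `<=` A by move=> _ ->.
rewrite (le_trans (ler_norm _))// (fsumID _ fA A1) /fsum fset_set1 big_seq_fset1.
by rewrite lerDl; apply: sumr_ge0.
Qed.

End finite_sums.

Section powers.
Context {R : realType}.
Implicit Types a b x : R.

Lemma lerB_exp a b n : 0 <= b -> b <= a ->
  a ^+ n - b ^+ n <= n%:R * (a - b) * a ^+ n.-1.
Proof.
move=> b0 ba; have a0 := le_trans b0 ba.
rewrite subrXX (mulrC n%:R) -mulrA ler_wpM2l ?subr_ge0//.
rewrite -[in n%:R](card_ord n) -sum1_card natr_sum mulr_suml ler_sum// => i _.
rewrite mul1r (_ : n.-1 = (n.-1 - i + i)%N); last first.
  by rewrite subnK// -ltnS prednK// (leq_ltn_trans _ (ltn_ord i)).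
by rewrite addnK exprD ler_pM ?exprn_ge0// lerXn2r ?nnegrE.
Qed.

Lemma expr2n_unbounded b : exists k, b <= 2 ^+ k.
Proof.
exists (Num.truncn `|b|).+1; rewrite (le_trans (ler_norm b))//.
rewrite (le_trans (ltW (truncnS_gt _)))// -natrX ler_nat.
exact/ltnW/ltn_expl.
Qed.

End powers.

Section points.
Context {R : realType} {d : nat}.
Implicit Types (S F : set 'rV[R]_d) (x z : 'rV[R]_d).

Definition pts S x (r : R) := S `&` [set z | enorm (z - x) <= r].

Lemma sub_pts S x y r s : enorm (x - y) + r <= s -> pts S x r `<=` pts S y s.
Proof.
move=> xys z [Sz /= zr]; split => //=; rewrite (le_trans _ xys)//.
by rewrite (le_trans (ler_enormB x _ _))// addrC lerD2l.
Qed.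

Lemma bounded_cball x r : bounded_set [set z : 'rV[R]_d | enorm (z - x) <= r].
Proof.
exists (`|x| + r); split; first exact: num_real.
move=> M xM z /= zr; rewrite ltW// (le_lt_trans _ xM)//.
rewrite -(subrK x z) (le_trans (ler_normD _ _))// addrC lerD2l.
by rewrite (le_trans (norm_le_enorm _)).
Qed.

Definition locally_finite S := forall x r, finite_set (pts S x r).

Definition ball_growth S x C r0 :=
  forall r, r0 <= r -> card (pts S x r) <= C * r ^+ d.

(** Dyadic shells: the one starting at radius [2^j r] holds at most [C (2^(j+1) r)^d] points, each
    of weight at most [(2^j r)^-(d+1)]; the geometric series sums to [C 2^(d+1) / r]. *)
Lemma tail_sum S x C r0 (r : R) F : locally_finite S -> ball_growth S x C r0 ->
  0 <= C -> 0 < r -> r0 <= r -> finite_set F -> F `<=` S ->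
  (forall z, F z -> r < enorm (z - x)) ->
  fsum F (fun z => enorm (z - x) ^- d.+1) <= C * 2 ^+ d.+1 / r.
Proof.
move=> lfS gS C0 r_gt0 r0r fF FS Fr.
have [b bP] := finite_set_bound (fun z => enorm (z - x)) fF.
have [k bk] := expr2n_unbounded (b / r).
have {b bP bk} : forall z, F z -> enorm (z - x) <= 2 ^+ k * r.
  by move=> z /bP /le_trans; apply; rewrite -ler_pdivrMr.
(* Induction on the number [k] of doublings of [r] needed to reach all of [F], peeling off the
   points within [2 r]. *)
elim: k r r_gt0 r0r F fF FS Fr => [|k IH] r r_gt0 r0r F fF FS Fr Fk.
  rewrite (_ : F = set0) ?/fsum ?fset_set0 ?big_seq_fset0.
    by apply: divr_ge0; [rewrite mulr_ge0// exprn_ge0|exact: ltW].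
  apply/seteqP; split => // z Fz; have := Fr z Fz.
  by have := Fk z Fz; rewrite expr0 mul1r => /le_lt_trans h /h; rewrite ltxx.
pose B := F `&` [set z | enorm (z - x) <= 2 * r].
have BF : B `<=` F by apply: subIsetl.
have fB := sub_finite_set BF fF.
rewrite (fsumID _ fF BF).
have -> : C * 2 ^+ d.+1 / r = C * 2 ^+ d / r + C * 2 ^+ d.+1 / (2 * r).
  by rewrite exprS; field; rewrite gt_eqF.
apply: lerD; last first.
  apply: IH.
  - by rewrite mulr_gt0.
  - by rewrite (le_trans r0r)// ler_peMl ?ltW//; lra.
  - exact: finite_setD.
  - by move=> z [/FS].
  - by move=> z [Fz nBz]; rewrite ltNge; apply/negP => zr; exact: nBz.
  - by move=> z [/Fk zk _]; rewrite mulrA -exprSr.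
apply: (@le_trans _ _ (r ^- d.+1 * card B)).
  rewrite -fsum_cst; apply: ler_fsum => // z [Fz _].
  have rz := Fr z Fz; have z0 := lt_trans r_gt0 rz.
  rewrite lef_pV2 ?posrE ?exprn_gt0//.
  by apply: lerXn2r; rewrite ?nnegrE//; exact: ltW.
apply: (@le_trans _ _ (r ^- d.+1 * (C * (2 * r) ^+ d))).
  apply: ler_wpM2l; first by rewrite invr_ge0 exprn_ge0// ltW.
  rewrite (le_trans _ (gS (2 * r) _))//; last first.
    by rewrite (le_trans r0r)// ler_peMl ?ltW//; lra.
  by apply: le_card => // z [/FS].
by rewrite le_eqVlt; apply/orP; left; apply/eqP; rewrite exprMn exprS; field;
  rewrite expf_eq0 gt_eqF// andbF.
Qed.

End points.

(** * Convergence of the series *)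

Section regular_sets.
Context {R : realType} {d : nat}.
Implicit Types (S F : set 'rV[R]_d) (x p z y : 'rV[R]_d) (v r delta : R).

(** The error is small against [r ^ (d - 1)], the inverse size of the kernel at distance [r]: a
    shell of thickness [delta] then carries a total kernel weight [O(delta)]. *)
Definition ball_count v S x := forall eps : R, 0 < eps -> exists r0 : R,
  forall r, r0 <= r -> `|card (pts S x r) - v * r ^+ d| <= eps * r ^+ d.-1.

Definition ball_sums_cauchy S x := forall (i : 'I_d) (eps : R), 0 < eps ->
  exists r0 : R, forall r s, r0 <= r -> r0 <= s ->
  `|fsum (pts S x r) (fun z => kern i (z - x))
    - fsum (pts S x s) (fun z => kern i (z - x))| <= eps.

Definition ratv (q : 'rV[rat]_d) : 'rV[R]_d := map_mx (@ratr R) q.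

(* A deterministic stand-in for a typical Poisson sample: [force_C1] and the
   convergence of the series only use this property of the point set. *)
Definition regular v S := [/\ locally_finite S, 0 < v,
  forall q, ball_count v S (ratv q) & forall q, ball_sums_cauchy S (ratv q)].

Lemma ball_count_growth v S x : ball_count v S x ->
  exists r0, 0 < r0 /\ ball_growth S x (v + 1) r0.
Proof.
move=> /(_ _ ltr01)[r0 r0P]; exists (`|r0| + 1); split.
  by rewrite ltr_wpDl.
move=> r r0r; have r1 : 1 <= r by rewrite (le_trans _ r0r)// lerDr.
have /r0P : r0 <= r.
  by rewrite (le_trans (ler_norm _))// (le_trans _ r0r)// lerDl.
rewrite ler_norml => /andP[_]; rewrite lerBlDr mul1r => /le_trans; apply.
by rewrite mulrDl mul1r addrC lerD2l ler_weXn2l// leq_pred.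
Qed.

Definition shell_cst v : R := (d%:R * v *+ 2 + 2) * 2 ^+ d.-1.

Lemma shell_cst_ge0 v : 0 <= v -> 0 <= shell_cst v.
Proof.
by move=> v0; rewrite mulr_ge0 ?exprn_ge0// addr_ge0// mulrn_wge0// mulr_ge0.
Qed.

(** [ball_count] with [eps := delta] bounds both counting errors; the main terms differ by the
    volume of a shell of thickness [2 delta]. *)
Lemma shell_count v S x delta : 0 <= v -> ball_count v S x ->
  0 < delta -> delta <= 1 -> exists r0, forall r, r0 <= r ->
  card (pts S x (r + delta)) - card (pts S x (r - delta))
    <= shell_cst v * delta * r ^+ d.-1.
Proof.
move=> v0 Sx d0 d1; have [r0 r0P] := Sx _ d0.
exists (`|r0| + 2) => r r0r; have r2 : 2 <= r by rewrite (le_trans _ r0r)// lerDr.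
have r0N : r0 <= `|r0| by exact: ler_norm.
have /r0P : r0 <= r + delta by lra.
have /r0P : r0 <= r - delta by lra.
rewrite !ler_norml => /andP[H1 _] /andP[_ H2].
have A : (r + delta) ^+ d.-1 <= 2 ^+ d.-1 * r ^+ d.-1.
  by rewrite -exprMn lerXn2r ?nnegrE//; lra.
have B : (r - delta) ^+ d.-1 <= 2 ^+ d.-1 * r ^+ d.-1.
  by rewrite -exprMn lerXn2r ?nnegrE//; lra.
have C : v * ((r + delta) ^+ d - (r - delta) ^+ d)
    <= v * (d%:R * (delta *+ 2) * (2 ^+ d.-1 * r ^+ d.-1)).
  rewrite ler_wpM2l// (le_trans (lerB_exp _ _ _))//; [lra|lra|].
  rewrite (_ : r + delta - (r - delta) = delta *+ 2); last by ring.
  by rewrite ler_wpM2l// mulr_ge0// mulrn_wge0// ltW.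
have := ler_wpM2l (ltW d0) A; have := ler_wpM2l (ltW d0) B.
move: H1 H2 C; rewrite /shell_cst; set X := 2 ^+ _; set Y := r ^+ _; lra.
Qed.

(* Partial sums of any enumeration by distance run over such sets: ties at
   distance [r] are cut arbitrarily. *)
Definition admissible S x r F :=
  F `<=` pts S x r /\ S `&` [set z | enorm (z - x) < r] `<=` F.

Lemma kern_le_inv (i : 'I_d) y r : 0 < r -> r <= enorm y ->
  `|kern i y| <= r ^- d.-1.
Proof.
move=> r0 ry; have y0 : 0 < enorm y by rewrite (lt_le_trans r0).
rewrite (le_trans (kern_le _ _))//.
have -> : enorm y ^+ d = enorm y * enorm y ^+ d.-1.
  by rewrite -exprS prednK// (leq_ltn_trans _ (ltn_ord i)).
rewrite invfM mulrA divff ?gt_eqF// mul1r.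
rewrite lef_pV2 ?posrE ?exprn_gt0//.
by apply: lerXn2r; rewrite ?nnegrE// ltW.
Qed.

Definition interp_cst v : R := shell_cst v * 2 ^+ d.-1 *+ 2.

(** [F] and the ball around [p] both lie between the balls of radii [r - delta] and [r + delta]
    around [p]; by [shell_count] only [O(delta r^(d-1))] points lie between these, each of weight
    [O(r^-(d-1))]. *)
Lemma admissible_sum v S x p delta (i : 'I_d) : locally_finite S -> 0 <= v ->
  ball_count v S p -> 0 < delta -> delta <= 1 ->
  enorm (x - p) *+ 2 <= delta ->
  exists r0, forall r F, r0 <= r -> admissible S x r F ->
  `|fsum F (fun z => kern i (z - p)) - fsum (pts S p r) (fun z => kern i (z - p))|
    <= interp_cst v * delta.
Proof.
move=> lfS v0 Sp d0 d1 xp; have [r0 r0P] := shell_count v0 Sp d0 d1.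
exists (`|r0| + 2) => r F r0r [F1 F2].
have r2 : 2 <= r by rewrite (le_trans _ r0r)// lerDr.
have {}r0P : card (pts S p (r + delta)) - card (pts S p (r - delta))
    <= shell_cst v * delta * r ^+ d.-1.
  by apply: r0P; rewrite (le_trans (ler_norm _))// (le_trans _ r0r)// lerDl.
have xpE : enorm (x - p) <= delta / 2 by move: xp; rewrite mulr2n; lra.
(* Every point outside the inner ball is at distance at least [r / 2] from [p], as
   [r >= 2 >= 2 delta]. *)
pose c := (r / 2) ^- d.-1.
have c0 : 0 <= c by rewrite invr_ge0 exprn_ge0//; lra.
have fB : finite_set (pts S p (r + delta)) by exact: lfS.
have H G : pts S p (r - delta) `<=` G -> G `<=` pts S p (r + delta) ->
    `|fsum G (fun z => kern i (z - p))
      - fsum (pts S p (r - delta)) (fun z => kern i (z - p))|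
    <= shell_cst v * 2 ^+ d.-1 * delta.
  move=> AG GB; rewrite (le_trans (fsum_between (c := c) fB AG GB _ _))//.
    move=> z [Sz _] nAz; apply: kern_le_inv; first by lra.
    rewrite leNgt; apply/negP => zp; apply: nAz; split => //=.
    by rewrite ltW// (lt_le_trans zp)//; lra.
  rewrite (le_trans (ler_wpM2l c0 r0P))// /c expr_div_n invf_div.
  have r0' : r ^+ d.-1 != 0 by rewrite expf_neq0// gt_eqF//; lra.
  by rewrite le_eqVlt; apply/orP; left; apply/eqP; field.
rewrite /interp_cst mulr2n mulrDl -(subrK (fsum (pts S p (r - delta))
  (fun z => kern i (z - p))) (fsum F _)) -addrA.
rewrite (le_trans (ler_normD _ _))// lerD//; first apply: H.
- move=> z [Sz /= zr]; apply: F2; split => //=.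
  rewrite (le_lt_trans (ler_enormB p _ _))// (enormBC p).
  by rewrite (le_lt_trans (lerD zr xpE))//; lra.
- apply: (subset_trans F1); apply: sub_pts.
  by rewrite addrC lerD2l; lra.
- rewrite distrC; apply: H; apply: sub_pts; rewrite subrr enorm0; lra.
Qed.

Lemma enorm_delta (a : R) (j : 'I_d) : enorm (a *: delta_mx ord0 j) = `|a|.
Proof.
rewrite enormZ (_ : enorm _ = 1) ?mulr1//.
by apply/eqP; rewrite -(@eqrXn2 _ 2)// enorm_sqr dotr_delta mxE !eqxx expr1n.
Qed.

(** Expand every kernel around [y = z - p]: the linear parts cancel because [h] is the combination
    of the vectors [delta e_j] with coefficients [u j], leaving [d + 1] quadratic remainders. *)
Lemma kern_interpolation (i : 'I_d) p (h : 'rV[R]_d) (u : 'I_d -> R) delta :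
  0 < delta -> (forall j, h ord0 j = u j * delta) -> (forall j, `|u j| <= 1) ->
  exists C r0 : R, [/\ 0 <= C, 0 < r0 & forall z, r0 <= enorm (z - p) ->
    `|kern i (z - (p + h)) - (kern i (z - p) + \sum_j u j *
       (kern i (z - (p + delta *: delta_mx ord0 j)) - kern i (z - p)))|
    <= C * enorm (z - p) ^- d.+1].
Proof.
(* [D] bounds all the shifts, and [|z - p| >= 2 D] keeps them below half of [|z - p|], the range of
   [tame]. *)
move=> d0 hu u1; pose D := (d%:R + 1) * delta.
have D0 : 0 < D by rewrite mulr_gt0// ltr_wpDl.
exists (kern_cst R d * D ^+ 2 *+ d.+1), (2 * D); split; last 2 first.
- by rewrite mulr_gt0.
- move=> z zD; set y := z - p; have y0 : 0 < enorm y.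
    by rewrite (lt_le_trans _ zD)// mulr_gt0.
  have yn0 : y != 0 by rewrite -enorm_gt0.
  have [L [_ _ Lh]] := tame_kern i yn0.
  have rem k : enorm k <= D -> `|kern i (y - k) - kern i y + dotr L k|
      <= kern_cst R d * D ^+ 2 * enorm y ^- d.+1.
    move=> kD; have := Lh (- k); rewrite enormN -scaleN1r dotrZr mulN1r opprK.
    rewrite scaleN1r => /(_ _)/le_trans; apply.
      by rewrite ler_pdivlMr// (le_trans _ zD)// mulrC ler_wpM2l.
    have -> : kern_cst R d * D ^+ 2 / enorm y ^+ d.+1
        = kern_cst R d * (enorm y / enorm y ^+ d) * (D / enorm y) ^+ 2.
      by rewrite (exprS _ d); field; rewrite expf_neq0 gt_eqF.
    rewrite ler_wpM2l// ?lerXn2r ?nnegrE ?divr_ge0 ?(ltW D0)//.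
      rewrite mulr_ge0 ?divr_ge0 ?exprn_ge0// /kern_cst.
      by rewrite mulr_ge0 ?exprn_ge0.
    by rewrite ler_wpM2r ?invr_ge0.
  have hE : h = \sum_j u j *: (delta *: delta_mx ord0 j).
    rewrite [LHS]row_sum_delta; apply: eq_bigr => j _.
    by rewrite scalerA hu.
  have dE j : enorm (delta *: delta_mx ord0 j : 'rV[R]_d) = delta.
    by rewrite enorm_delta gtr0_norm.
  have hD : enorm h <= D.
    have : d%:R * delta <= (d%:R + 1) * delta by apply: ler_wpM2r; [exact: ltW|rewrite lerDl].
    apply: le_trans; apply: enorm_le_coords => [|j]; first exact: ltW.
    by rewrite hu normrM (gtr0_norm d0) ler_piMl// ltW.
  have -> : kern i (z - (p + h)) - (kern i (z - p) + \sum_j u j *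
       (kern i (z - (p + delta *: delta_mx ord0 j)) - kern i (z - p)))
    = (kern i (y - h) - kern i y + dotr L h)
      - \sum_j u j * (kern i (y - delta *: delta_mx ord0 j) - kern i y
                        + dotr L (delta *: delta_mx ord0 j)).
    have zp k : z - (p + k) = y - k by rewrite opprD addrA.
    rewrite zp; under eq_bigr do rewrite zp.
    under [in RHS]eq_bigr do rewrite mulrDr.
    have -> : dotr L h = \sum_j u j * dotr L (delta *: delta_mx ord0 j).
      rewrite {1}hE /dotr; under [RHS]eq_bigr do rewrite mulr_sumr.
      rewrite exchange_big/=; apply: eq_bigr => k _.
      rewrite summxE mulr_sumr; apply: eq_bigr => j _.
      by rewrite !mxE mulrCA.
    by rewrite big_split/= -/y; ring.
  rewrite mulrS mulrDl (le_trans (ler_normB _ _))// lerD//; first exact: rem.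
  rewrite (le_trans (ler_norm_sum _ _ _))//.
  rewrite -[X in _ *+ X](card_ord d) -sumr_const mulr_suml ler_sum// => j _.
  rewrite normrM -[leRHS]mul1r ler_pM//; apply: rem; rewrite dE.
  by rewrite /D; apply: ler_peMl; [exact: ltW|rewrite lerDr].
- by rewrite mulrn_wge0// mulr_ge0 ?sqr_ge0// /kern_cst mulr_ge0 ?exprn_ge0.
Qed.

End regular_sets.
Arguments shell_cst {R} d v.
Arguments interp_cst {R} d v.
Arguments ratv R {d} q.

Section convergence.
Context {R : realType} {d : nat}.
Implicit Types (S F : set 'rV[R]_d) (x p z y : 'rV[R]_d) (v r delta eps : R).

Lemma rat_approx x delta : 0 < delta ->
  exists q, forall i, `|x ord0 i - ratv R q ord0 i| <= delta.
Proof.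
move=> d0.
have H i : exists q : rat, `|x ord0 i - ratr q| <= delta.
  have xd : x ord0 i - delta < x ord0 i + delta by lra.
  have [q] := rat_in_itvoo xd; rewrite in_itv/= => /andP[q1 q2]; exists q.
  by rewrite ler_norml; apply/andP; split; lra.
have /(_ _)/cid-/all_sig[f fP] := H.
by exists (\row_i f i) => i; rewrite !mxE.
Qed.

Lemma ratv_shift (q : 'rV[rat]_d) (c : rat) j :
  ratv R q + ratr c *: delta_mx ord0 j = ratv R (q + c *: delta_mx ord0 j).
Proof.
apply/rowP => i; rewrite !mxE raddfD/= rmorphM/=; congr (_ + _ * _).
by rewrite ratr_nat.
Qed.

(* The kernel at [x] is interpolated by its values at [d + 1] nearby rational
   points: the error decays like [|z|^-(d+1)], which is summable over [S], and
   changing the centre of a ball by [delta] only costs [O(delta)]. *)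
Lemma kern_sums_cauchy v S x (i : 'I_d) eps : regular v S -> 0 < eps ->
  exists r0, forall r s F F', r0 <= r -> r0 <= s ->
    admissible S x r F -> admissible S x s F' ->
  `|fsum F (fun z => kern i (z - x)) - fsum F' (fun z => kern i (z - x))| <= eps.
Proof.
move=> [lfS v0 cS sS] e0.
have I0 : 0 <= interp_cst d v.
  by rewrite mulrn_wge0// mulr_ge0 ?exprn_ge0// shell_cst_ge0// ltW.
(* The final error consists of two tails [eps / 4] and [1 + 2 d] terms of size
   [(2 interp_cst + 1) delta']; the choice of [c] makes the latter total at most [eps / 2]. It is
   rational so that the shifted centres are rational too. *)
pose B := (1 + d%:R *+ 2) * (interp_cst d v *+ 2 + 1).
have B0 : 0 < B.
  by apply: mulr_gt0; [rewrite ltr_wpDr// mulrn_wge0|rewrite ltr_wpDl// mulrn_wge0].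
have d1 : 1 <= d%:R :> R by rewrite ler1n (leq_ltn_trans _ (ltn_ord i)).
have [c [cd1 cB1]] : exists c : rat, 0 < (ratr c : R) *+ 2 * (d%:R + 1) <= 1 /\
    B * ((ratr c : R) *+ 2 * (d%:R + 1)) <= eps / 2.
  pose m := Num.min 1 (eps / 2 / B) / (d%:R + 1) / 2.
  have m0 : 0 < m.
    by rewrite !divr_gt0// ?lt_min ?ltr01 ?divr_gt0//; lra.
  have [c] := rat_in_itvoo m0; rewrite in_itv/= => /andP[c0 cm].
  have cm' : ratr c *+ 2 * (d%:R + 1) <= Num.min 1 (eps / 2 / B).
    have -> : Num.min 1 (eps / 2 / B) = m *+ 2 * (d%:R + 1).
      by rewrite /m; field; lra.
    by rewrite ler_wpM2r ?lerMn2r ?ltW// ltr_wpDl.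
  exists c; move: cm'; rewrite le_min => /andP[-> cB]; split.
    by rewrite mulr_gt0 ?mulrn_wgt0// ltr_wpDl.
  by rewrite mulrC -ler_pdivlMr.
(* [delta'] is twice [(d + 1) delta], a bound on the distances from [x] to all [d + 1] centres, as
   [admissible_sum] asks. *)
move: cd1 cB1; set delta' := ratr c *+ 2 * _ => /andP[d'0 d'1] Bd'.
have : 0 < (ratr c : R).
  by move: d'0; rewrite /delta' pmulr_lgt0 ?pmulrn_lgt0.
set delta : R := ratr c => delta0.
have [q qP] := rat_approx x delta0; set p := ratv R q in qP.
pose u j := (x ord0 j - p ord0 j) / delta.
have u1 j : `|u j| <= 1.
  by rewrite /u normrM normfV (gtr0_norm delta0) ler_pdivrMr// mul1r.
have xp j : (x - p) ord0 j = u j * delta.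
  by rewrite /u divfK ?gt_eqF// [LHS]mxE; congr (_ + _); rewrite [LHS]mxE.
have [C [ra [C0 ra0 aP]]] := kern_interpolation i p delta0 xp u1.
rewrite (addrC p) subrK in aP.
pose pp (j : 'I_d) := p + delta *: delta_mx ord0 j.
pose a z := kern i (z - x) - (kern i (z - p) + \sum_j u j *
  (kern i (z - pp j) - kern i (z - p))).
have xpE : enorm (x - p) <= d%:R * delta.
  apply: enorm_le_coords => [|j]; first exact: ltW.
  by rewrite xp normrM (gtr0_norm delta0) ler_piMl// ltW.
have center p' : (exists q', p' = ratv R q') -> enorm (x - p') *+ 2 <= delta' ->
    exists r0, forall r s F F', r0 <= r -> r0 <= s ->
      admissible S x r F -> admissible S x s F' ->
    `|fsum F (fun z => kern i (z - p')) - fsum F' (fun z => kern i (z - p'))|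
      <= (interp_cst d v *+ 2 + 1) * delta'.
  move=> [q' ->] xp'.
  have [r1 r1P] := admissible_sum i lfS (ltW v0) (cS q') d'0 d'1 xp'.
  have [r2 r2P] := sS q' i _ d'0.
  exists (Num.max r1 r2) => r s F F'; rewrite !ge_max => /andP[r1r r2r].
  move=> /andP[r1s r2s] aF aF'.
  rewrite mulrDl mul1r mulrnAl.
  exact: ler_dist_chain (r1P _ _ r1r aF) (r1P _ _ r1s aF') (r2P _ _ r2r r2s).
have [r0 r0P] : exists r0, forall r s F F', r0 <= r -> r0 <= s ->
      admissible S x r F -> admissible S x s F' ->
    `|fsum F (fun z => kern i (z - p)) - fsum F' (fun z => kern i (z - p))|
      <= (interp_cst d v *+ 2 + 1) * delta'.
  apply: center; first by exists q.
  by move: xpE; rewrite /delta' -/delta !mulr2n; lra.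
have [rj rjP] : exists rj, forall j r s F F', rj <= r -> rj <= s ->
      admissible S x r F -> admissible S x s F' ->
    `|fsum F (fun z => kern i (z - pp j)) - fsum F' (fun z => kern i (z - pp j))|
      <= (interp_cst d v *+ 2 + 1) * delta'.
  have H j : exists rj, forall r s F F', rj <= r -> rj <= s ->
      admissible S x r F -> admissible S x s F' ->
    `|fsum F (fun z => kern i (z - pp j)) - fsum F' (fun z => kern i (z - pp j))|
      <= (interp_cst d v *+ 2 + 1) * delta'.
    apply: center; first by exists (q + c *: delta_mx ord0 j); rewrite -ratv_shift.
    have : enorm (x - pp j) <= d%:R * delta + delta.
      rewrite /pp opprD addrA (le_trans (ler_enormD _ _))// lerD// enormN.
      by rewrite enorm_delta ?gtr0_norm.
    by rewrite /delta' -/delta !mulr2n; lra.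
  have /(_ _)/cid-/all_sig[f fP] := H.
  exists (\sum_j `|f j|) => j r s F F' fr fs; apply: fP.
    rewrite (le_trans _ fr)// (le_trans (ler_norm _))//.
    by rewrite (bigD1 j)//= lerDl sumr_ge0.
  rewrite (le_trans _ fs)// (le_trans (ler_norm _))//.
  by rewrite (bigD1 j)//= lerDl sumr_ge0.
have [rg [rg0 gS]] := ball_count_growth (cS q).
pose D := C * ((v + 1) * 2 ^+ d.+1).
have D0 : 0 <= D by rewrite !mulr_ge0 ?exprn_ge0// addr_ge0// ltW.
(* Beyond [rt] the interpolation errors sum to at most [D / rt <= eps / 4]. *)
pose rt := Num.max ra rg + D *+ 4 / eps.
have rtm : Num.max ra rg <= rt by rewrite lerDl divr_ge0 ?mulrn_wge0// ltW.
have rt0 : 0 < rt by rewrite (lt_le_trans _ rtm)// lt_max ra0.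
have atail F : finite_set F -> F `<=` S ->
    (forall z, F z -> rt < enorm (z - p)) -> `|fsum F a| <= eps / 4.
  move=> fF FS Fr; rewrite (le_trans (ler_norm_fsum _ _))//.
  apply: (@le_trans _ _ (C * fsum F (fun z => enorm (z - p) ^- d.+1))).
    rewrite -fsumZ; apply: ler_fsum => // z /Fr rz; apply: aP.
    by rewrite (le_trans _ (ltW rz))// (le_trans _ rtm)// le_max lexx.
  apply: (@le_trans _ _ (C * ((v + 1) * 2 ^+ d.+1 / rt))).
    rewrite ler_wpM2l// (tail_sum lfS gS)//; first by rewrite addr_ge0// ltW.
    by rewrite (le_trans _ rtm)// le_max lexx orbT.
  rewrite mulrA -/D ler_pdivrMr//.
  have -> : D = eps / 4 * (D *+ 4 / eps) by field; rewrite gt_eqF.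
  by rewrite ler_wpM2l ?divr_ge0 ?ltW// ltrDr lt_max ra0.
have afar r F : rt + d%:R * delta + 1 <= r -> admissible S x r F ->
    `|fsum F a - fsum (pts S p rt) a| <= eps / 4.
  move=> rr [F1 F2].
  have fF : finite_set F by apply: sub_finite_set F1 _; exact: lfS.
  have pF : pts S p rt `<=` F.
    move=> z [Sz /= zp]; apply: F2; split => //=.
    rewrite (le_lt_trans (ler_enormB p _ _))// (enormBC p).
    by rewrite (le_lt_trans (lerD zp xpE))// (lt_le_trans _ rr)// ltrDl.
  rewrite (fsumID _ fF pF) addrAC subrr add0r; apply: atail.
  - exact: finite_setD.
  - by move=> z [/F1[]].
  - by move=> z [/F1[Sz _] nz]; rewrite ltNge; apply/negP => zr; exact: nz.
exists (Num.max (rt + d%:R * delta + 1) (Num.max r0 rj)) => r s F F'.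
rewrite !ge_max => /and3P[r1 r2 r3] /and3P[s1 s2 s3] aF aF'.
have aE G : fsum G (fun z => kern i (z - x)) =
    fsum G a + (fsum G (fun z => kern i (z - p)) + \sum_j u j *
    (fsum G (fun z => kern i (z - pp j)) - fsum G (fun z => kern i (z - p)))).
  have -> : \sum_j u j * (fsum G (fun z => kern i (z - pp j))
      - fsum G (fun z => kern i (z - p)))
      = fsum G (fun z => \sum_j u j * (kern i (z - pp j) - kern i (z - p))).
    rewrite /fsum exchange_big/=; apply: eq_bigr => j _.
    by rewrite -mulr_sumr -sumrB.
  by rewrite -!fsumD; apply: eq_bigr => z _; rewrite /a subrK.
set b := (interp_cst d v *+ 2 + 1) * delta' in r0P rjP.
have b0 : 0 <= b by apply: mulr_ge0; [rewrite addr_ge0// mulrn_wge0|exact: ltW].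
rewrite !aE.
have sumB : `|\sum_j u j * (fsum F (fun z => kern i (z - pp j))
      - fsum F (fun z => kern i (z - p)))
    - \sum_j u j * (fsum F' (fun z => kern i (z - pp j))
      - fsum F' (fun z => kern i (z - p)))| <= d%:R * (b *+ 2).
  rewrite -sumrB (le_trans (ler_norm_sum _ _ _))//.
  rewrite mulr_natl -[X in _ *+ X](card_ord d) -sumr_const ler_sum// => j _.
  rewrite -mulrBr normrM -[leRHS]mul1r ler_pM//.
  exact: ler_distB (rjP j _ _ _ _ r3 s3 aF aF') (r0P _ _ _ _ r2 s2 aF aF').
have := afar _ _ r1 aF; have := afar _ _ s1 aF'.
have := r0P _ _ _ _ r2 s2 aF aF'; move: sumB.
have Bb : b + d%:R * (b *+ 2) <= eps / 2.
  by rewrite (le_trans _ Bd')// /B /b; lra.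
move: Bb; rewrite !ler_norml; move: (\sum_j _) (\sum_j _) => s1' s2'.
move: (fsum _ _) (fsum _ _) (fsum _ _) (fsum _ _) (fsum _ _) => A1 A2 A3 A4 A5.
move=> Bb /andP[? ?] /andP[? ?] /andP[? ?] /andP[? ?].
by apply/andP; split; lra.
Qed.

End convergence.

(** * Cauchy sequences and Abel summation *)

Section real_sequences.
Context {R : realType}.

Lemma real_cauchy (u : nat -> R) :
  (forall eps, 0 < eps -> exists N, forall m n, (N <= m)%N -> (N <= n)%N ->
    `|u m - u n| <= eps) ->
  exists l, forall eps, 0 < eps -> exists N, forall n, (N <= n)%N ->
    `|u n - l| <= eps.
Proof.
move=> uC; have /cauchy_cvgP/cvgrPdist_le ul : cauchy (u @ \oo).
  apply/cauchy_exP => eps e0; have [|N uN] := uC (eps / 2); first by lra.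
  exists (u N); exists N => // n /= Nn; rewrite /ball/= (le_lt_trans (uN _ _ _ _))//.
  by lra.
exists (limn u) => eps /ul[N _ uN]; exists N => n Nn; rewrite distrC; exact: uN.
Qed.

(* Abel summation: [w] truncates the series of general term [a] smoothly. *)
Lemma abel_bound (a w : nat -> R) (l eps B : R) (M N : nat) :
  (forall m, w m.+1 <= w m) -> (forall m, 0 <= w m <= 1) -> w M = 0 ->
  (forall m, (N <= m)%N -> `|\sum_(k < m) a k - l| <= eps) ->
  (forall m, `|\sum_(k < m) a k - l| <= B) -> 0 <= eps ->
  `|\sum_(k < M) a k * w k - l| <= eps + B * (1 - w N).
Proof.
move=> wS w01 wM aN aB e0; pose b m := \sum_(k < m) a k - l.
have B0 : 0 <= B by rewrite (le_trans _ (aB 0%N)).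
(* Summation by parts, [b m] being the error of the [m]-th partial sum. *)
have E m : \sum_(k < m) a k * w k
    = b m * w m + l * w 0%N + \sum_(k < m) b k.+1 * (w k - w k.+1).
  elim: m => [|m IH]; first by rewrite !big_ord0 /b big_ord0; ring.
  have am : a m = b m.+1 - b m by rewrite /b big_ord_recr/=; ring.
  by rewrite 2!big_ord_recr/= IH am; ring.
have wD m n : (m <= n)%N -> w n <= w m.
  elim: n => [|n IH]; first by rewrite leqn0 => /eqP ->.
  by rewrite leq_eqVlt => /orP[/eqP ->//|/IH]; exact: le_trans.
(* The decrements of [w] are nonnegative: those from index [N] on carry errors at most [eps], the
   earlier ones errors at most [B]. *)
have bound m : `|\sum_(k < m) b k.+1 * (w k - w k.+1)|
    <= eps * (w 0%N - w m) + B * (w 0%N - w (minn m N)).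
  elim: m => [|m IH]; first by rewrite big_ord0 normr0 min0n !subrr !mulr0 addr0.
  rewrite big_ord_recr/= (le_trans (ler_normD _ _))// (le_trans (lerD IH (lexx _)))//.
  rewrite normrM (ger0_norm (x := w m - _)) ?subr_ge0//.
  have [Nm|mN] := leqP N m.
    rewrite (minn_idPr (leqW Nm)).
    have := aN m.+1 (leqW Nm); rewrite -/(b m.+1) => H.
    have := ler_wpM2r (_ : 0 <= w m - w m.+1) H; rewrite subr_ge0 => /(_ (wS m)).
    by lra.
  rewrite (minn_idPl mN).
  have := ler_wpM2r (_ : 0 <= w m - w m.+1) (aB m.+1); rewrite -/(b m.+1).
  rewrite subr_ge0 => /(_ (wS m)).
  have : 0 <= eps * (w m - w m.+1) by rewrite mulr_ge0// subr_ge0.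
  by lra.
have := bound M; rewrite E wM mulr0 add0r; set X := \sum_(k < M) _ => XB.
have lB : `|l| <= B by have := aB 0%N; rewrite big_ord0 sub0r normrN.
have wN := wD _ _ (geq_minr M N).
have -> : l * w 0%N + X - l = X - l * (1 - w 0%N) by ring.
rewrite (le_trans (ler_normB _ _))// normrM.
have /andP[w00 w01'] := w01 0%N; rewrite (ger0_norm (x := 1 - _)) ?subr_ge0//.
have := ler_wpM2r (_ : 0 <= 1 - w 0%N) lB; rewrite subr_ge0 => /(_ w01').
have := ler_wpM2l B0 wN; have := ler_wpM2l e0 w01'.
by move: XB; rewrite subr0; lra.
Qed.

End real_sequences.

Section enumeration.
Context {R : realType} {d : nat}.
Implicit Types (S F : set 'rV[R]_d) (x p z y : 'rV[R]_d).

(** Greedy choice: list at each step a nearest point not yet listed, which exists because balls hold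
    finitely many points. *)
Lemma distance_enumeration_ex S x : locally_finite S -> infinite_set S ->
  exists e, distance_enumeration S x e.
Proof.
move=> lfS iS.
have nxt (s : seq 'rV[R]_d) : exists z, [/\ S z, z \notin s
    & forall z', S z' -> z' \notin s -> enorm (z - x) <= enorm (z' - x)].
  have [z0 [Sz0 z0s]] : exists z0, S z0 /\ z0 \notin s.
    apply: contra_notP iS => /forallNP nS.
    apply: (sub_finite_set (B := [set` s])); last exact: finite_seq.
    by move=> z Sz /=; apply/negPn/negP => zs; exact: (nS z).
  pose c := [seq z <- fset_set (pts S x (enorm (z0 - x))) | z \notin s].
  have cP z : z \in c = (z \notin s) && `[< S z /\ enorm (z - x) <= enorm (z0 - x) >].
    by rewrite mem_filter in_fset_set.
  have z0c : z0 \in c by rewrite cP z0s; apply/asboolP.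
  have [z [zc zmin]] : exists z, z \in c /\
      forall z', z' \in c -> enorm (z - x) <= enorm (z' - x).
    move: c z0c {cP} => c; elim: c z0 {Sz0 z0s} => // a c IH z0 _.
    case: c IH => [|b c] IH.
      by exists a; rewrite inE eqxx; split => // z'; rewrite inE => /eqP ->.
    have [|z [zc zmin]] := IH b; first by rewrite inE eqxx.
    have [az|za] := leP (enorm (a - x)) (enorm (z - x)).
      exists a; rewrite inE eqxx; split => // z'; rewrite inE => /orP[/eqP ->//|].
      by move/zmin; exact: le_trans.
    exists z; split; first by rewrite inE zc orbT.
    by move=> z'; rewrite inE => /orP[/eqP ->|/zmin//]; exact: ltW.
  move: zc; rewrite cP => /andP[zs /asboolP[Sz zz0]]; exists z; split => // z' Sz' z's.
  have [z'z0|/ltW z0z'] := leP (enorm (z' - x)) (enorm (z0 - x)).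
    by apply: zmin; rewrite cP z's; exact/asboolP.
  exact: le_trans z0z'.
have {nxt}/(_ _)/cid-/all_sig[nxt nxtP] := nxt.
pose prefix n := iter n (fun s => rcons s (nxt s)) [::].
pose e n := nxt (prefix n).
have prefixP n z : reflect (exists2 m, (m < n)%N & z = e m) (z \in prefix n).
  elim: n => [|n IH]; first by constructor => -[].
  rewrite /= mem_rcons inE; apply: (iffP orP) => [[/eqP ->|/IH[m mn ->]]|].
  - by exists n.
  - by exists m => //; exact: ltnW.
  - move=> [m]; rewrite ltnS leq_eqVlt => /orP[/eqP -> ->|mn zE]; [by left|right].
    by apply/IH; exists m.
have eS n : S (e n) by have [] := nxtP (prefix n).
have elt m n : (m < n)%N -> e m != e n.
  move=> mn; apply/eqP => emn; have [_ /negP + _] := nxtP (prefix n); apply.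
  by apply/prefixP; exists m.
have emin m z : S z -> z \notin prefix m -> enorm (e m - x) <= enorm (z - x).
  by move=> Sz zm; have [_ _] := nxtP (prefix m); exact.
have emono m n : (m <= n)%N -> enorm (e m - x) <= enorm (e n - x).
  move=> mn; apply: emin => //; apply/prefixP => -[k km /esym enk].
  by have := elt k n (leq_trans km mn); rewrite enk eqxx.
have einj : injective e.
  move=> m n emn; case: (ltngtP m n) => // /elt; first by rewrite emn eqxx.
  by rewrite emn eqxx.
exists e; split => //; split.
- by move=> n _; exact: eS.
- by move=> m n _ _; exact: einj.
(* A point never listed would confine the whole injective sequence to the finitely many points of a
   ball. *)
- move=> z Sz; apply: contrapT => ze.
  have : finite_set [set: nat].
    have sub : e @` [set: nat] `<=` pts S x (enorm (z - x)).
      move=> _ [n _ <-]; split => //=; apply: emin => //.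
      by apply/prefixP => -[m _ zm]; apply: ze; exists m.
    have -> : [set: nat] = e @^-1` pts S x (enorm (z - x)).
      by apply/seteqP; split => // n _; apply: sub; exists n.
    by apply: finite_preimage => // m n _ _; exact: einj.
  exact/infinite_nat.
Qed.

End enumeration.

(** * The force of a regular set *)

Section force_of_regular_sets.
Context {R : realType} {d : nat}.
Implicit Types (S F : set 'rV[R]_d) (x p z y l : 'rV[R]_d) (v r eps : R).

Lemma norm_le_coords (m n : nat) (A : 'M[R]_(m, n)) (c : R) : 0 <= c ->
  (forall i j, `|A i j| <= c) -> `|A| <= c.
Proof.
move=> c0 Ac; rewrite /Num.Def.normr/= mx_normrE.
by apply/bigmax_leP; split => // -[i j] _ /=.
Qed.

Lemma uniform_bound (I : finType) (Q : I -> R -> Prop) :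
  (forall i r s, r <= s -> Q i r -> Q i s) ->
  (forall i, exists r, Q i r) -> exists r, forall i, Q i r.
Proof.
move=> Qm /(_ _)/cid-/all_sig[f fP]; exists (\sum_i `|f i|) => i.
apply: Qm (fP i); rewrite (le_trans (ler_norm _))//.
by rewrite (bigD1 i)//= lerDl sumr_ge0.
Qed.

Lemma regular_infinite v S : (0 < d)%N -> regular v S -> infinite_set S.
Proof.
move=> d0 [lfS v0 cS _] fS; have [r0 r0P] := cS 0 (v / 2) ltac:(lra).
have [b bP] : exists b : R, forall r, card (pts S (ratv R 0) r) <= b.
  by exists (card S) => r; apply: le_card => // z [].
pose r := `|r0| + 1 + `|b| *+ 2 / v.
have b0 : 0 <= `|b| *+ 2 / v by rewrite divr_ge0 ?mulrn_wge0// ltW.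
have r1 : 1 <= r by have := normr_ge0 r0; rewrite /r; lra.
have /r0P : r0 <= r.
  by have := ler_norm r0; have := normr_ge0 r0; rewrite /r; lra.
rewrite ler_norml => /andP[+ _]; have := bP r.
have -> : r ^+ d = r ^+ d.-1 * r by rewrite -exprSr prednK.
have rd1 : 1 <= r ^+ d.-1 by rewrite exprn_ege1.
have vr : v * r > `|b| *+ 2.
  rewrite /r !mulrDr (mulrC _ (_ / v)) divfK ?gt_eqF// ltrDr.
  by rewrite -mulrDr mulr_gt0// ltr_wpDl.
have := ler_norm b; move=> bb cb H.
have : v / 2 * (r ^+ d.-1 * (r *+ 2 - 1)) <= b by move: H; lra.
apply/negP; rewrite -ltNge (le_lt_trans bb)//.
apply: (@lt_le_trans _ _ (v / 2 * r)); first by lra.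
rewrite ler_wpM2l//; first lra.
by rewrite -[leLHS]mul1r ler_pM//; lra.
Qed.

Lemma ball_growth_any v S x : regular v S ->
  exists C r0 : R, [/\ 0 <= C, 0 < r0 & ball_growth S x C r0].
Proof.
move=> [lfS v0 cS _]; have [r0 [r00 gS]] := ball_count_growth (cS 0).
set q := ratv R 0 in gS.
exists ((v + 1) * 2 ^+ d), (r0 + enorm (x - q)); split.
- by rewrite mulr_ge0 ?exprn_ge0// addr_ge0// ltW.
- by rewrite ltr_wpDr.
move=> r r0r; have xr : enorm (x - q) <= r by lra.
rewrite -mulrA -exprMn (le_trans _ (gS _ _))//; last first.
  by have := enorm_ge0 (x - q); lra.
apply: le_card => //; apply: sub_pts; lra.
Qed.

Lemma inv_sum_bounded v S x : regular v S -> exists M : R, 0 <= M /\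
  forall F, finite_set F -> F `<=` S ->
    fsum F (fun z => enorm (z - x) ^- d.+1) <= M.
Proof.
move=> rS; have [C [r0 [C0 r00 gS]]] := ball_growth_any x rS.
have [lfS _ _ _] := rS; pose N := fsum (pts S x r0) (fun z => enorm (z - x) ^- d.+1).
have N0 : 0 <= N by apply: fsum_ge0 => // z _; rewrite invr_ge0 exprn_ge0.
exists (N + C * 2 ^+ d.+1 / r0); split.
  by rewrite addr_ge0// divr_ge0 ?(ltW r00)// mulr_ge0// exprn_ge0.
move=> F fF FS.
rewrite (fsumID (B := F `&` [set z | enorm (z - x) <= r0]) _ fF); last exact: subIsetl.
apply: lerD.
  apply: fsum_subset_le => //; first by move=> z [/FS].
  by move=> z _; rewrite invr_ge0 exprn_ge0.
apply: (tail_sum lfS gS) => //.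
- exact: finite_setD.
- by move=> z [/FS].
- by move=> z [Fz nz]; rewrite ltNge; apply/negP => zr; exact: nz.
Qed.

Definition kern_limit S x l := forall eps, 0 < eps -> exists r0,
  forall r F, r0 <= r -> admissible S x r F ->
  forall i : 'I_d, `|fsum F (fun z => kern i (z - x)) - l ord0 i| <= eps.

Lemma admissible_pts S x r : admissible S x r (pts S x r).
Proof. by split => // z [Sz /= /ltW zr]. Qed.

Lemma natr_unbounded r : exists N, forall n, (N <= n)%N -> r <= n%:R.
Proof.
exists (Num.truncn `|r|).+1 => n Nn; rewrite (le_trans (ler_norm r))//.
by rewrite (le_trans (ltW (truncnS_gt _)))// ler_nat.
Qed.

Lemma kern_limit_ex v S x : regular v S -> exists l, kern_limit S x l.
Proof.
move=> rS.
have H (i : 'I_d) : exists li : R, forall eps, 0 < eps -> exists r0,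
    forall r F, r0 <= r -> admissible S x r F ->
    `|fsum F (fun z => kern i (z - x)) - li| <= eps.
  pose u n := fsum (pts S x n%:R) (fun z => kern i (z - x)).
  have uC : forall eps, 0 < eps -> exists N, forall m n, (N <= m)%N -> (N <= n)%N ->
      `|u m - u n| <= eps.
    move=> eps /(kern_sums_cauchy x i rS)[r0 r0P]; have [N NP] := natr_unbounded r0.
    exists N => m n /NP mr /NP nr; apply: (r0P _ _ _ _ mr nr); exact: admissible_pts.
  have [li liP] := real_cauchy uC.
  exists li => eps e0; have e2 : 0 < eps / 2 by lra.
  have [N NP] := liP _ e2; have [r0 r0P] := kern_sums_cauchy x i rS e2.
  have [N' N'P] := natr_unbounded r0.
  exists r0 => r F rr aF; have := NP _ (leq_maxl N N').
  have := r0P _ _ _ _ rr (N'P _ (leq_maxr N N')) aF (admissible_pts _ _ _).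
  rewrite -/(u _) !ler_norml => /andP[? ?] /andP[? ?]; apply/andP; split; lra.
have {H}/(_ _)/cid-/all_sig[l lP] := H.
exists (\row_i l i) => eps e0.
have [||r0 r0P] := @uniform_bound 'I_d (fun i r0 =>
    forall r F, r0 <= r -> admissible S x r F ->
    `|fsum F (fun z => kern i (z - x)) - l i| <= eps).
- by move=> i r s rs Qr r' F sr'; apply: Qr; exact: le_trans sr'.
- by move=> i; exact: lP.
- by exists r0 => r F rr aF i; rewrite [X in _ - X]mxE; exact: (r0P i r F rr aF).
Qed.

Lemma enumeration_unbounded S x e r : locally_finite S ->
  distance_enumeration S x e -> exists N, forall n, (N <= n)%N -> r < enorm (e n - x).
Proof.
move=> lfS [[eS einj _] emono].
suff [N Nr] : exists N, r < enorm (e N - x).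
  by exists N => n /emono; exact: lt_le_trans.
apply/not_existsP => H; apply: infinite_nat.
have -> : [set: nat] = e @^-1` pts S x r.
  apply/seteqP; split => // n _; split; first exact: eS.
  by have /negP := H n; rewrite -leNgt.
by apply: finite_preimage => // m n _ _; apply: einj; rewrite inE.
Qed.

Lemma enumeration_admissible S x e n : distance_enumeration S x e ->
  admissible S x (enorm (e n - x)) (e @` `I_n).
Proof.
move=> [[eS einj esurj] emono]; split.
  by move=> _ [m /= mn <-]; split; [exact: eS|exact/emono/ltnW].
move=> z [/esurj[m _ <-] /= mn]; exists m => //=.
by rewrite ltnNge; apply/negP => /emono; rewrite leNgt mn.
Qed.

Lemma enumeration_inj S x e : distance_enumeration S x e -> injective e.
Proof. by move=> [[_ einj _] _] m n; apply: einj; rewrite inE. Qed.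

(** Partial sums of an enumeration run over admissible sets whose radius [|e n - x|] tends to
    infinity. *)
Lemma kern_limit_sum v S x l : (0 < d)%N -> regular v S -> kern_limit S x l ->
  sum_by_distance S x (attraction x) l.
Proof.
move=> d0 rS Sl; have [lfS _ _ _] := rS; split.
  exact: distance_enumeration_ex (regular_infinite d0 rS).
move=> e eE; apply/cvgrPdist_le => eps e0; have [r0 r0P] := Sl eps e0.
have [N NP] := enumeration_unbounded r0 lfS eE.
exists N => // n /= /NP/ltW/r0P/(_ (enumeration_admissible n eE)) H.
rewrite distrC; apply: norm_le_coords => [|o i]; first exact: ltW.
rewrite (ord1 o) !mxE (le_trans _ (H i))// (fsum_enum _ _ (enumeration_inj eE)).
rewrite summxE /series/= big_mkord.
rewrite le_eqVlt; apply/orP; left; apply/eqP; congr (`|_ - _|).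
by apply: eq_bigr => m _; rewrite mxE.
Qed.

Lemma sum_by_distance_unique S x (f : 'rV[R]_d -> 'rV[R]_d) l l' :
  sum_by_distance S x f l -> sum_by_distance S x f l' -> l = l'.
Proof.
move=> [[e eE] lP] [_ l'P].
exact: cvg_unique (lP _ eE) (l'P _ eE).
Qed.

Lemma force_sum S x l : sum_by_distance S x (attraction x) l -> force S x = l.
Proof.
move=> Sl; apply: xget_unique => // l' Sl'.
exact: sum_by_distance_unique Sl' Sl.
Qed.

Lemma kern_limit_force v S x : (0 < d)%N -> regular v S ->
  kern_limit S x (force S x).
Proof.
move=> d0 rS; have [l Sl] := kern_limit_ex x rS.
by rewrite (force_sum (kern_limit_sum d0 rS Sl)).
Qed.

Definition smooth_sum S x r (i : 'I_d) : R :=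
  fsum (pts S x r) (fun z => smooth_kern r i (z - x)).

Lemma smooth_sumE S x r i F : 0 < r -> locally_finite S -> finite_set F ->
  F `<=` S -> S `&` [set z | enorm (z - x) < r] `<=` F ->
  smooth_sum S x r i = fsum F (fun z => smooth_kern r i (z - x)).
Proof.
move=> r0 lfS fF FS SF; pose B := S `&` [set z | enorm (z - x) < r].
have BE A : finite_set A -> A `<=` S -> B `<=` A ->
    fsum A (fun z => smooth_kern r i (z - x))
    = fsum B (fun z => smooth_kern r i (z - x)).
  move=> fA AS BA; rewrite (fsumID _ fA BA) -[RHS]addr0; congr (_ + _).
  rewrite (eq_fsum (g := fun=> 0)) ?fsum_cst ?mul0r//; first exact: finite_setD.
  move=> z [/AS Sz nBz]; rewrite /smooth_kern cutoff_eq0 ?mulr0//.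
  by rewrite leNgt; apply/negP => zr; exact: nBz.
rewrite /smooth_sum (BE F)// BE// => [z []//|z [Sz /= /ltW zr]]; by split.
Qed.

(** Along an enumeration by distance the cutoffs are nonincreasing weights in [[0, 1]], and
    [abel_bound] applies. *)
Lemma smooth_sum_cvg v S x i eps : (0 < d)%N -> regular v S -> 0 < eps ->
  exists r0, forall r, r0 <= r -> `|smooth_sum S x r i - force S x ord0 i| <= eps.
Proof.
move=> d0 rS e0; have [lfS _ _ _] := rS.
have Sl := kern_limit_force x d0 rS; set l := force S x in Sl *.
have [e eE] := distance_enumeration_ex x lfS (regular_infinite d0 rS).
pose a m := kern i (e m - x); pose Q m := \sum_(k < m) a k.
have einj := enumeration_inj eE.
have QE m : Q m = fsum (e @` `I_m) (fun z => kern i (z - x)).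
  by rewrite fsum_enum.
have Qlim ep : 0 < ep -> exists N, forall m, (N <= m)%N -> `|Q m - l ord0 i| <= ep.
  move=> ep0; have [r0 r0P] := Sl ep ep0.
  have [N NP] := enumeration_unbounded r0 lfS eE.
  exists N => m /NP/ltW/r0P H; rewrite QE; apply: H.
  exact: enumeration_admissible.
have [B BP] : exists B : R, forall m, `|Q m - l ord0 i| <= B.
  have [N NP] := Qlim 1 ltr01.
  exists (1 + \sum_(k < N) `|Q k - l ord0 i|) => m.
  have [/NP/le_trans|mN] := leqP N m; first by apply; rewrite lerDl sumr_ge0.
  by rewrite (bigD1 (Ordinal mN))//= addrCA lerDl addr_ge0// sumr_ge0.
have B0 : 0 <= B by rewrite (le_trans _ (BP 0%N)).
have [N NP] := Qlim (eps / 2) ltac:(lra).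
(* [N] is fixed before [r]: by [cutoff_ge] the early terms cost at most [B (1 - w N) <= D / r ^+ 2],
   which tends to 0. *)
pose D := B * (2 * enorm (e N - x) ^+ 2).
have D0 : 0 <= D by rewrite mulr_ge0// mulr_ge0// exprn_ge0.
exists (1 + D *+ 2 / eps) => r rr.
have De : 0 <= D *+ 2 / eps by rewrite divr_ge0 ?mulrn_wge0// ltW.
have r1 : 1 <= r by lra.
have r0 : 0 < r by lra.
have [M MP] := enumeration_unbounded r lfS eE.
rewrite (@smooth_sumE S x r i (e @` `I_M))//; last first.
- move=> z [Sz /= zr]; have [[_ _ es] _] := eE; have [m _ mz] := es _ Sz; exists m => //=.
  rewrite ltnNge; apply/negP => /MP; rewrite mz => /(lt_trans zr).
  by rewrite ltxx.
- by move=> _ [m _ <-]; have [[eS _ _] _] := eE; exact: eS.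
- exact/finite_image/finite_II.
rewrite fsum_enum//.
pose w m := cutoff r (e m - x).
have wS m : w m.+1 <= w m by apply: cutoff_le => //; case: eE => _; exact.
have wM : w M = 0 by apply: cutoff_eq0 => //; exact/ltW/MP.
have w01 m : 0 <= w m <= 1 by exact: cutoff_itv.
have e2 : 0 <= eps / 2 by lra.
have := abel_bound wS w01 wM NP BP e2; move/le_trans; apply.
have := cutoff_ge (e N - x) r0; rewrite -/(w N) => wN.
have : B * (1 - w N) <= D / r ^+ 2.
  by rewrite /D -mulrA; apply: ler_wpM2l => //; lra.
have : D / r ^+ 2 <= eps / 2; last by lra.
rewrite ler_pdivrMr ?exprn_gt0//.
have -> : D = eps / 2 * (D *+ 2 / eps) by field; rewrite gt_eqF.
rewrite ler_wpM2l// (le_trans (_ : _ <= r))//; first by lra.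
by rewrite expr2 ler_peMl// ltW.
Qed.

End force_of_regular_sets.

(** * Differentiability off the points *)

Section differentiability.
Context {R : realType} {d : nat}.
Implicit Types (S F : set 'rV[R]_d) (x p z y h L : 'rV[R]_d) (v r eps eta : R).

Definition taylor_bound (f : 'rV[R]_d -> R) x L eta (M : R) :=
  forall h, enorm h <= eta ->
    `|f (x + h) - f x - dotr L h| <= M * enorm h ^+ 2.

(** The factor 4 leaves room for moving the centre by [eta] and then by a step [h] of length [eta],
    with [h] still at most half the distance to every point. *)
Lemma dist_gt0 S p : locally_finite S -> ~ S p ->
  exists eta, 0 < eta /\ forall z, S z -> 4 * eta <= enorm (z - p).
Proof.
move=> lfS Sp.
have [b bP] := finite_set_bound (fun z => (enorm (z - p))^-1) (lfS p 1).
exists (4 * (`|b| + 1))^-1; have b0 := normr_ge0 b; split.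
  by rewrite invr_gt0; lra.
move=> z Sz; have zp : 0 < enorm (z - p).
  by rewrite enorm_gt0 subr_eq0; apply/eqP => zp; apply: Sp; rewrite -zp.
rewrite invfM mulrA divff// mul1r.
have [z1|/ltW z1] := leP (enorm (z - p)) 1; last first.
  by rewrite (le_trans _ z1)// invf_le1; lra.
rewrite -[leRHS]invrK lef_pV2 ?posrE ?invr_gt0 ?ltr_wpDl//.
by have := bP z (conj Sz z1); have := ler_norm b; lra.
Qed.

Lemma dotr_suml (I : Type) (s : seq I) (f : I -> 'rV[R]_d) h :
  dotr (\sum_(z <- s) f z) h = \sum_(z <- s) dotr (f z) h.
Proof.
elim: s => [|z s IH]; first by rewrite !big_nil dotr0l.
by rewrite !big_cons dotrDl IH.
Qed.

Lemma dotrNl L h : dotr (- L) h = - dotr L h.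
Proof. by rewrite -scaleN1r dotrZl mulN1r. Qed.

(** [M] depends neither on [r] nor on [x]: the quadratic remainders of the terms are of order
    [|z - p| ^ -(d + 1)], summable over [S]. Nothing is claimed about the size of [L]. *)
Lemma smooth_sum_taylor v S p : regular v S -> ~ S p -> exists eta M,
  [/\ 0 < eta, 0 <= M, (forall z, S z -> 4 * eta <= enorm (z - p))
    & forall i r x, 0 < r -> enorm (x - p) <= eta ->
      exists L, taylor_bound (fun y => smooth_sum S y r i) x L eta M].
Proof.
move=> rS Sp; have [lfS _ _ _] := rS.
have [eta [eta0 etaP]] := dist_gt0 lfS Sp.
have [M [M0 MP]] := inv_sum_bounded p rS.
have c0 : 0 <= smooth_cst R d.
  by rewrite /smooth_cst /kern_cst !mulr_ge0// exprn_ge0.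
have c1 : 0 <= smooth_cst R d * 2 ^+ d.+1 by rewrite mulr_ge0// exprn_ge0.
exists eta, (smooth_cst R d * 2 ^+ d.+1 * M); split => //; first exact: mulr_ge0.
move=> i r x r0 xp.
have zx z : S z -> enorm (z - p) / 2 <= enorm (z - x) /\ 3 * eta <= enorm (z - x).
  move=> /etaP zp; have := ler_enormB x z p => H.
  by split; lra.
have Lex z : exists L, S z -> forall h, enorm h <= eta ->
    `|smooth_kern r i (z - (x + h)) - smooth_kern r i (z - x) + dotr L h|
    <= smooth_cst R d * 2 ^+ d.+1 * enorm (z - p) ^- d.+1 * enorm h ^+ 2.
  have [Sz|nSz] := pselect (S z); last by exists 0.
  have [zx2 zx3] := zx z Sz; have zx0 : 0 < enorm (z - x) by lra.
  have zp0 : 0 < enorm (z - p) by have := etaP z Sz; lra.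
  have yn0 : z - x != 0 by rewrite -enorm_gt0.
  have [L [_ _ Lh]] := tame_smooth_kern i r0 yn0.
  exists L => _ h hh; have := Lh (- h).
  rewrite enormN -[X in dotr _ X]scaleN1r dotrZr mulN1r opprK => /(_ _)/le_trans.
  rewrite opprD addrA; apply; first by lra.
  have -> : smooth_cst R d * (enorm (z - x) / enorm (z - x) ^+ d)
      * (enorm h / enorm (z - x)) ^+ 2
      = smooth_cst R d * enorm (z - x) ^- d.+1 * enorm h ^+ 2.
    by rewrite (exprS _ d); field; rewrite expf_neq0 gt_eqF.
  rewrite ler_wpM2r ?exprn_ge0// -mulrA ler_wpM2l//.
  rewrite -invf_div -expr_div_n lef_pV2 ?posrE ?exprn_gt0//; last first.
    by rewrite divr_gt0.
  by apply: lerXn2r; rewrite ?nnegrE// divr_ge0.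
have {Lex}/(_ _)/cid-/all_sig[Lz LzP] := Lex.
(* A common index set for all centres within [2 eta] of [p], so that the sums at [x] and [x + h] can
   be subtracted termwise. *)
pose F := pts S p (r + 2 * eta).
have fF : finite_set F by exact: lfS.
have sE y : enorm (y - p) <= 2 * eta ->
    smooth_sum S y r i = fsum F (fun z => smooth_kern r i (z - y)).
  move=> yp; rewrite (@smooth_sumE _ _ S y r i F)//; first by move=> z [].
  move=> z [Sz /= zr]; split => //=; rewrite (le_trans (ler_enormB y _ _))//.
  by rewrite lerD// ltW.
exists (- \sum_(z <- fset_set F) Lz z) => h hh.
rewrite dotrNl opprK dotr_suml !sE; last 2 first.
- by lra.
- rewrite addrAC (le_trans (ler_enormD _ _))//; lra.
rewrite -[X in _ + X]/(fsum F (fun z => dotr (Lz z) h)) -fsumB -fsumD.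
rewrite (le_trans (ler_norm_fsum _ _))//.
apply: (@le_trans _ _ (fsum F (fun z => smooth_cst R d * 2 ^+ d.+1
    * enorm h ^+ 2 * enorm (z - p) ^- d.+1))).
  by apply: ler_fsum => // z [Sz _]; rewrite (le_trans (LzP z Sz h hh))// mulrAC.
rewrite fsumZ -[leRHS]mulrAC ler_wpM2l//; first by rewrite mulr_ge0 ?exprn_ge0.
by apply: MP => // z [].
Qed.

(** No convergence of the gradients of [g n] is assumed: a difference quotient of step [t]
    determines them up to [M t], so convergence of the values makes each coordinate Cauchy. *)
Lemma taylor_bound_limit (g : nat -> 'rV[R]_d -> R) f p eta M : 0 < eta -> 0 <= M ->
  (forall n x, enorm (x - p) <= eta -> exists L, taylor_bound (g n) x L eta M) ->
  (forall x, enorm (x - p) <= 2 * eta -> forall eps, 0 < eps ->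
    exists N, forall n, (N <= n)%N -> `|g n x - f x| <= eps) ->
  forall x, enorm (x - p) <= eta -> exists L, taylor_bound f x L eta M.
Proof.
move=> eta0 M0 gT gf x xp.
have xpd h : enorm h <= eta -> enorm (x + h - p) <= 2 * eta.
  by move=> hh; rewrite addrAC (le_trans (ler_enormD _ _))//; lra.
have xp2 : enorm (x - p) <= 2 * eta by lra.
have /(_ _)/cid-/all_sig[L LP] := fun n => gT n x xp.
have Lcoord n j t : 0 < t -> t <= eta ->
    `|g n (x + t *: delta_mx ord0 j) - g n x - t * L n ord0 j| <= M * t ^+ 2.
  move=> t0 te; have := LP n (t *: delta_mx ord0 j).
  by rewrite enorm_delta gtr0_norm// dotrZr dotr_delta; apply.
have lj j : exists l, forall eps, 0 < eps -> exists N, forall n, (N <= n)%N ->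
    `|L n ord0 j - l| <= eps.
  apply: real_cauchy => eps e0.
  (* Two remainders [M t^2 <= eps t / 4] and four value errors [eps t / 8] will add up to
     [eps t]. *)
  pose t := Num.min eta (eps / (M + 1) / 4).
  have M1 : 0 < M + 1 by lra.
  have t0 : 0 < t by rewrite lt_min eta0 !divr_gt0.
  have te : t <= eta by rewrite ge_min lexx.
  have Mt : M * t <= eps / 4.
    apply: (@le_trans _ _ ((M + 1) * (eps / (M + 1) / 4))).
      by apply: ler_pM => //; [exact: ltW|lra|rewrite ge_min lexx orbT].
    by rewrite le_eqVlt; apply/orP; left; apply/eqP; field; rewrite gt_eqF.
  have td : enorm (t *: delta_mx ord0 j : 'rV[R]_d) <= eta.
    by rewrite enorm_delta gtr0_norm.
  have et : 0 < eps * t / 8 by rewrite divr_gt0 ?mulr_gt0.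
  have [N1 N1P] := gf _ (xpd _ td) _ et; have [N2 N2P] := gf _ xp2 _ et.
  exists (maxn N1 N2) => m n; rewrite !geq_max => /andP[m1 m2] /andP[n1 n2].
  rewrite -(ler_pM2l t0) -[X in X * `|_|](gtr0_norm t0) -normrM.
  have := N1P _ m1; have := N1P _ n1; have := N2P _ m2; have := N2P _ n2.
  have := Lcoord m j t t0 te; have := Lcoord n j t t0 te.
  have MtE : M * t ^+ 2 <= eps * t / 4.
    by have := ler_wpM2r (ltW t0) Mt; rewrite expr2; lra.
  rewrite mulrBr !ler_norml; move=> /andP[? ?] /andP[? ?] /andP[? ?].
  by move=> /andP[? ?] /andP[? ?] /andP[? ?]; apply/andP; split; lra.
have {lj}/(_ _)/cid-/all_sig[l lP] := lj.
exists (\row_j l j) => h hh; apply/ler_addgt0Pr => eps e0.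
pose c := 1 + \sum_j `|h ord0 j|.
have s0 : 0 <= \sum_j `|h ord0 j| by exact: sumr_ge0.
have ec : 0 < eps / 2 / c by rewrite !divr_gt0// /c; lra.
have e4 : 0 < eps / 4 by lra.
have [N1 N1P] := gf _ (xpd _ hh) _ e4; have [N2 N2P] := gf _ xp2 _ e4.
have [N3 N3P] : exists N3, forall n, (N3 <= n)%N -> forall j,
    `|L n ord0 j - l j| <= eps / 2 / c.
  have /(_ _)/cid-/all_sig[N NP] := fun j => lP j _ ec.
  by exists (\max_j N j) => n Nn j; apply/NP/(leq_trans _ Nn)/leq_bigmax.
pose K := maxn N3 (maxn N1 N2).
have := N1P K; have := N2P K; have := N3P K; have := LP K h hh.
rewrite /K !leq_max !leqnn !orbT -/K => LK /(_ isT) Ll /(_ isT) gfx /(_ isT) gfh.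
have : `|dotr (L K) h - dotr (\row_j l j) h| <= eps / 2.
  rewrite /dotr -sumrB (le_trans (ler_norm_sum _ _ _))//.
  apply: (@le_trans _ _ (\sum_j eps / 2 / c * `|h ord0 j|)).
    by apply: ler_sum => j _; rewrite mxE -mulrBl normrM ler_wpM2r.
  rewrite -mulr_sumr mulrAC ler_pdivrMr; last by rewrite /c; lra.
  by rewrite ler_wpM2l ?divr_ge0 ?ltW// /c ltrDr.
move: LK gfx gfh; rewrite !ler_norml.
move=> /andP[? ?] /andP[? ?] /andP[? ?] /andP[? ?]; apply/andP; split; lra.
Qed.

(** With [t = |y - x|], the point [y + t e_j] is reached by expansions at [x] and at [y]. The three
    remainders cost [M t^2], [M t^2] and [4 M t^2], hence [6 M t] after division by [t]. *)
Lemma taylor_bound_lip f p eta M (L : 'rV[R]_d -> 'rV[R]_d) : 0 <= M ->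
  (forall x, enorm (x - p) <= eta -> taylor_bound f x (L x) eta M) ->
  forall x y, enorm (x - p) <= eta -> enorm (y - p) <= eta ->
  enorm (y - x) <= eta / 2 -> forall j,
  `|L y ord0 j - L x ord0 j| <= 6 * M * enorm (y - x).
Proof.
move=> M0 fL x y xp yp xy j.
have [->|yx] := eqVneq y x; first by rewrite !subrr normr0 enorm0 mulr0.
set t := enorm (y - x) in xy *.
have t0 : 0 < t by rewrite enorm_gt0 subr_eq0.
have := fL y yp (t *: delta_mx ord0 j).
have := fL x xp (y - x + t *: delta_mx ord0 j).
have := fL x xp (y - x); have xyE : x + (y - x) = y by rewrite addrC subrK.
have xtE : x + (y - x + t *: delta_mx ord0 j) = y + t *: delta_mx ord0 j.
  by rewrite addrA xyE.
rewrite xtE xyE (dotrDr _ (y - x)) !dotrZr !dotr_delta enorm_delta (gtr0_norm t0).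
rewrite -/t => H1 H2 H3.
have : enorm (y - x + t *: delta_mx ord0 j) <= 2 * t.
  by rewrite (le_trans (ler_enormD _ _))// enorm_delta (gtr0_norm t0) -/t; lra.
set w := enorm _ in H2 * => wt.
have w2 : w ^+ 2 <= 4 * t ^+ 2.
  rewrite (_ : 4 * _ = (2 * t) ^+ 2); last by ring.
  by apply: lerXn2r; rewrite ?nnegrE ?enorm_ge0// mulr_ge0// ltW.
have := ler_wpM2l M0 w2 => Mw.
have {}H1 := H1 ltac:(lra); have {}H3 := H3 ltac:(lra); have {}H2 := H2 ltac:(lra).
rewrite -(ler_pM2l t0) -[X in X * `|_|](gtr0_norm t0) -normrM mulrBr.
move: H1 H2 H3; rewrite !ler_norml; move=> /andP[? ?] /andP[? ?] /andP[? ?].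
by apply/andP; split; lra.
Qed.

Lemma force_taylor v S p : (0 < d)%N -> regular v S -> ~ S p ->
  exists eta M (L : 'I_d -> 'rV[R]_d -> 'rV[R]_d), [/\ 0 < eta, 0 <= M &
    forall i x, enorm (x - p) <= eta ->
      taylor_bound (fun y => force S y ord0 i) x (L i x) eta M].
Proof.
move=> d0 rS Sp; have [eta [M [eta0 M0 etaP sT]]] := smooth_sum_taylor rS Sp.
have H i x : exists L, enorm (x - p) <= eta ->
    taylor_bound (fun y => force S y ord0 i) x L eta M.
  have [xp|xp] := pselect (enorm (x - p) <= eta); last by exists 0.
  have [|y yp eps e0|L LP] := @taylor_bound_limit
    (fun n y => smooth_sum S y n.+1%:R i) (fun y => force S y ord0 i)
    p eta M eta0 M0 _ _ x xp.
  - by move=> n y; exact: sT.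
  - have [r0 r0P] := smooth_sum_cvg y i d0 rS e0.
    have [N NP] := natr_unbounded r0; exists N => n Nn.
    by apply/r0P/NP; exact: leqW.
  - by exists L.
have /(_ _)/cid-/all_sig[L LP] := fun ix : 'I_d * 'rV[R]_d => H ix.1 ix.2.
by exists eta, M, (fun i x => L (i, x)); split => // i x; exact: (LP (i, x)).
Qed.

Lemma near_dist_le (V : normedModType R) (x : V) (c : R) : 0 < c ->
  \forall y \near x, `|x - y| <= c.
Proof.
by move=> c0; apply: (@cvgr_dist_le _ _ _ (nbhs x) _ id x) => //; exact: cvg_id.
Qed.

Lemma norm_mulmx (h : 'rV[R]_d) (A : 'M[R]_(d, d)) :
  `|h *m A| <= d%:R * `|h| * `|A|.
Proof.
apply: norm_le_coords => [|j0 j]; first by rewrite !mulr_ge0.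
rewrite (ord1 j0) mxE (le_trans (ler_norm_sum _ _ _))//.
rewrite -mulrA mulr_natl -[X in _ *+ X](card_ord d) -sumr_const ler_sum// => k _.
rewrite normrM ler_pM ?coord_le_norm//.
rewrite /Num.Def.normr/= mx_normrE.
exact: (le_bigmax _ (fun ij => `|A ij.1 ij.2|) (k, j)).
Qed.

Lemma mulmxr_continuous (A : 'M[R]_(d, d)) :
  continuous (fun h : 'rV[R]_d => h *m A).
Proof.
move=> x; apply/(@cvgrPdist_le _ _ _ (nbhs x) (nbhs_filter x)) => eps e0.
have c0 : 0 < d%:R * `|A| + 1 by rewrite ltr_wpDl// mulr_ge0.
have := near_dist_le (x : 'rV[R]_d) (divr_gt0 e0 c0); apply: filterS => y xy.
rewrite -mulmxBl (le_trans (norm_mulmx _ _))//.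
by move: xy; rewrite ler_pdivlMr//; have := normr_ge0 (x - y); lra.
Qed.

Lemma force_C1 v S : (0 < d)%N -> regular v S ->
  continuously_differentiable_on (~` S) (force S).
Proof.
move=> d0 rS.
have H p : ~ S p -> exists eta M (A : 'rV[R]_d -> 'M[R]_(d, d)),
    [/\ 0 < eta, 0 <= M,
       forall x, enorm (x - p) <= eta -> differentiable (force S) x /\
         jacobian (force S) x = A x
     & forall x, enorm (x - p) <= eta -> enorm (x - p) <= eta / 2 ->
         `|A x - A p| <= M * enorm (x - p)].
  move=> Sp; have [eta [M [L [eta0 M0 LP]]]] := force_taylor d0 rS Sp.
  (* Row vectors are multiplied by matrices on their right, so the gradient of the [i]-th component
     is the [i]-th column. *)
  pose A x : 'M[R]_(d, d) := \matrix_(j, i) L i x ord0 j.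
  exists eta, (6 * M), A; split => //; first by lra.
    move=> x xp; pose df : {linear 'rV[R]_d -> 'rV[R]_d} := mulmxr (A x).
    have dfc : continuous df.
      exact: mulmxr_continuous.
    have fE : force S \o shift x = cst (force S x) + df +o_ (0 : 'rV[R]_d) id.
      apply/eqaddoP => eps e0.
      have c0 : 0 < M * d%:R ^+ 2 + 1 by rewrite ltr_wpDl// mulr_ge0// exprn_ge0.
      have dR0 : 0 < d%:R :> R by rewrite ltr0n.
      have c1 : 0 < Num.min (eta / d%:R) (eps / (M * d%:R ^+ 2 + 1)).
        by rewrite lt_min !divr_gt0.
      have := near_dist_le (0 : 'rV[R]_d) c1; apply: filterS => h.
      rewrite sub0r normrN le_min => /andP[h1 h2].
      have hd := enorm_le_norm h.
      have he : enorm h <= eta.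
        by rewrite (le_trans hd)// mulrC -ler_pdivlMr.
      apply: norm_le_coords => [|j i]; first by rewrite mulr_ge0// ltW.
      rewrite (ord1 j) !fctE/= !mxE.
      have := LP i x xp h he; rewrite (addrC x h).
      have -> : \sum_k h ord0 k * A x k i = dotr (L i x) h.
        by apply: eq_bigr => k _; rewrite mxE mulrC.
      rewrite opprD addrA => /le_trans; apply.
      apply: (@le_trans _ _ (M * (d%:R * `|h|) ^+ 2)).
        by rewrite ler_wpM2l// lerXn2r ?nnegrE// mulr_ge0.
      rewrite exprMn expr2 (expr2 `|h|) !mulrA ler_wpM2r//.
      move: h2; rewrite ler_pdivlMr// mulrDr mulr1 expr2 => /(le_trans _); apply.
      by have := normr_ge0 h; lra.
    have dE := diff_unique dfc fE; split.
      by apply/diff_locallyP; rewrite dE.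
    apply/row_matrixP => j; rewrite /jacobian.
    by rewrite -[in LHS]/(lin1_mx _) rowE mul_rV_lin1/= dE /= rowE.
  move=> x xp xp2; apply: norm_le_coords => [|j i].
    by rewrite !mulr_ge0.
  rewrite !mxE; apply: (taylor_bound_lip M0 (LP i)) => //.
  by rewrite subrr enorm0 ltW.
split=> [x /H[eta [M [A [eta0 _ AP _]]]]|].
  by have [] := AP x; rewrite ?subrr ?enorm0 ?ltW.
apply: continuous_in_subspaceT => x; rewrite inE => Sx.
have [eta [M [A [eta0 M0 AP Alip]]]] := H x Sx.
apply/(@cvgrPdist_le _ _ _ (nbhs x) (nbhs_filter x)) => eps e0.
have AxE : jacobian (force S) x = A x by apply: (AP x _).2; rewrite subrr enorm0 ltW.
rewrite AxE.
have c0 : 0 < Num.min (eta / 2) (eps / (M + 1)) / d%:R.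
  by rewrite divr_gt0 ?ltr0n// lt_min !divr_gt0//; lra.
have := near_dist_le (x : 'rV[R]_d) c0; apply: filterS => y xy.
have xyn : enorm (y - x) <= Num.min (eta / 2) (eps / (M + 1)).
  rewrite (le_trans (enorm_le_norm _))// mulrC -ler_pdivlMr ?ltr0n//.
  by rewrite distrC.
have {xyn} : enorm (y - x) <= eta / 2 /\ enorm (y - x) <= eps / (M + 1).
  by move: xyn; rewrite le_min => /andP[].
move=> [{}xy xye]; have xy2 : M * enorm (y - x) <= eps.
  move: xye; rewrite ler_pdivlMr; last by lra.
  by have := enorm_ge0 (y - x); lra.
rewrite (AP y _).2; last by lra.
by rewrite distrC (le_trans (Alip _ _ _))//; lra.
Qed.


End differentiability.

(** * Grid approximation of the force *)

Section cells.
Context {R : realType} {d : nat}.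
Implicit Types (S F : set 'rV[R]_d) (x z y h a : 'rV[R]_d) (v r eps : R).

(** Of the order of [(n+1)^d] points matter, and moving a point to the corner of its cell costs an
    error of the order of the side; the side [(n+1)^-(d+1)] makes the total [O(1/n)]. *)
Definition fineness n := (n.+1 ^ d.+1)%N.

(** The unshifted grid fills [[-2(n+1), 2(n+1))^d], which holds the open ball of radius [n+1] around
    [x] once [|x| <= n+1]. *)
Definition cell_index n : finType := {ffun 'I_d -> 'I_(4 * n.+1 * fineness n)}.

Definition corner n (j : cell_index n) : 'rV[R]_d :=
  \row_i ((j i)%:R / (fineness n)%:R - 2 * n.+1%:R).

(* The grid shifted by [a], so that by stationarity the law of the family of
   counts in its cells does not depend on [a]. *)
Definition cell n a (j : cell_index n) : set 'rV[R]_d :=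
  [set z | forall i, 0 <= z ord0 i - a ord0 i - corner j ord0 i
                     < (fineness n)%:R^-1].

Lemma fineness_gt0 n : 0 < (fineness n)%:R :> R.
Proof. by rewrite ltr0n expn_gt0. Qed.

Lemma cell_inj n a (j j' : cell_index n) z : cell a j z -> cell a j' z -> j = j'.
Proof.
move=> jz j'z; apply/ffunP => i; apply/val_inj/eqP.
have := jz i; have := j'z i; rewrite /corner !mxE.
set t := z _ _ - _; set k := (fineness n)%:R; have k0 : 0 < k by exact: fineness_gt0.
have H (m : nat) : 0 <= t - (m%:R / k - 2 * n.+1%:R) < k^-1 ->
    m%:R <= (t + 2 * n.+1%:R) * k < m.+1%:R.
  have -> : t - (m%:R / k - 2 * n.+1%:R) = ((t + 2 * n.+1%:R) * k - m%:R) / k.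
    by field; rewrite gt_eqF.
  rewrite pmulr_lge0 ?invr_gt0// -[X in _ < X]mul1r ltr_pM2r ?invr_gt0//.
  by rewrite subr_ge0 ltrBlDl natr1.
move=> /H/andP[a1 a2] /H/andP[b1 b2].
have := le_lt_trans a1 b2; have := le_lt_trans b1 a2.
by rewrite !ltr_nat !ltnS eqn_leq => -> ->.
Qed.

Lemma cell_ex n a z :
  (forall i, - (2 * n.+1%:R) <= z ord0 i - a ord0 i < 2 * n.+1%:R) ->
  exists j : cell_index n, cell a j z.
Proof.
move=> za; have k0 := fineness_gt0 n.
pose t i := (z ord0 i - a ord0 i + 2 * n.+1%:R) * (fineness n)%:R.
have t0 i : 0 <= t i by have /andP[? _] := za i; rewrite mulr_ge0 ?(ltW k0)//; lra.
have tn i : (Num.truncn (t i) < 4 * n.+1 * fineness n)%N.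
  rewrite truncn_lt_nat// /t !natrM ltr_pM2r//.
  by have /andP[_ ?] := za i; lra.
exists [ffun i => Ordinal (tn i)] => i; rewrite !mxE ffunE/=.
have /andP[t1 t2] := truncn_itv (t0 i).
set m := Num.truncn _ in t1 t2 *.
have -> : z ord0 i - a ord0 i - (m%:R / (fineness n)%:R - 2 * n.+1%:R)
    = (t i - m%:R) / (fineness n)%:R.
  by rewrite /t; field; rewrite gt_eqF.
rewrite divr_ge0 ?subr_ge0 ?(ltW k0)//= -[ltRHS]mul1r ltr_pM2r ?invr_gt0//.
by rewrite ltrBlDl natr1.
Qed.

Lemma cell_dist n a (j : cell_index n) z : cell a j z ->
  enorm (corner j - (z - a)) <= d%:R / (fineness n)%:R.
Proof.
move=> jz; apply: enorm_le_coords; first by rewrite invr_ge0 ltW// fineness_gt0.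
move=> i; have := jz i; rewrite !mxE.
by rewrite ler_norml => /andP[? ?]; apply/andP; split; lra.
Qed.

Lemma cell_bounded n a (j : cell_index n) z : cell a j z ->
  enorm (z - a) <= d%:R * (2 * n.+1%:R).
Proof.
move=> jz; apply: enorm_le_coords; first by rewrite mulr_ge0.
move=> i; have k0 := fineness_gt0 n; have := jz i; rewrite !mxE => /andP[z1 z2].
have j0 : 0 <= (j i)%:R / (fineness n)%:R :> R by rewrite divr_ge0// ltW.
have j4 : ((j i)%:R + 1) / (fineness n)%:R <= 4 * n.+1%:R :> R.
  by rewrite ler_pdivrMr// natr1 -!natrM ler_nat.
by rewrite ler_norml; apply/andP; split; move: j4; rewrite mulrDl mul1r; lra.
Qed.

(** The weights do not involve [a], which enters through the counts only. Points of a shifted cell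
    are close to [corner j + a], so the sum approximates the one centred at [x + a]. *)
Definition cell_sum S a n x (i : 'I_d) : R :=
  \sum_(j : cell_index n)
    smooth_kern n.+1%:R i (corner j - x) * card (S `&` cell a j).

(** Each point is replaced by the corner of its cell; all points stay at distance [4 eta] from
    [x + a], where [tame_lip] controls the smooth kernel. *)
Lemma cell_sum_dist v S a x i : (0 < d)%N -> regular v S -> ~ S (x + a) ->
  exists C, forall n, C <= n.+1%:R ->
    `|cell_sum S a n x i - smooth_sum S (x + a) n.+1%:R i| <= C / n.+1%:R.
Proof.
move=> d0 rS Sxa; have [lfS _ _ _] := rS.
have [eta [eta0 etaP]] := dist_gt0 lfS Sxa.
have [G [r0 [G0 r00 gS]]] := ball_growth_any (x + a) rS.
have sc0 : 0 <= smooth_cst R d.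
  by rewrite /smooth_cst /kern_cst !mulr_ge0// exprn_ge0.
pose c := 2 * smooth_cst R d * d%:R / (4 * eta) ^+ d.
have c0 : 0 <= c by rewrite divr_ge0 ?exprn_ge0 ?mulr_ge0// ltW.
(* The first term is the final bound. The others, through [C <= n + 1], put the radius in the range
   of [gS], make the grid cover the ball, and bring the diameter bound [d / k] below 1 and [eta]. *)
pose C := c * G * 2 ^+ d + r0 + enorm x + d%:R + d%:R / eta.
have cG0 : 0 <= c * G * 2 ^+ d by apply: mulr_ge0; [exact: mulr_ge0|rewrite exprn_ge0].
have de0 : 0 <= d%:R / eta by rewrite divr_ge0// ltW.
have dR0 : 0 <= d%:R :> R by [].
exists C => n Cn; have x0 := enorm_ge0 x.
have k0 := fineness_gt0 n; set k : R := (fineness n)%:R in k0 *.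
have n0 : 0 < n.+1%:R :> R by rewrite ltr0n.
have n1 : 1 <= n.+1%:R :> R by rewrite ler1n.
have kE : k = n.+1%:R ^+ d.+1 by rewrite /k /fineness natrX.
have nk : n.+1%:R <= k by rewrite kE exprS ler_peMr ?exprn_ege1// ltW.
have dk1 : d%:R / k <= 1 by rewrite ler_pdivrMr// mul1r (le_trans _ nk)//; rewrite /C in Cn; lra.
have dke : d%:R / k <= eta.
  rewrite ler_pdivrMr// mulrC -ler_pdivrMr// (le_trans _ nk)//.
  by rewrite /C in Cn; lra.
pose F := S `&` [set z | exists j : cell_index n, cell a j z].
have fF : finite_set F.
  apply: sub_finite_set (lfS a (d%:R * (2 * n.+1%:R))).
  by move=> z [Sz [j jz]]; split => //=; exact: cell_bounded jz.
have FS : F `<=` S by move=> z [].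
have cover : S `&` [set z | enorm (z - (x + a)) < n.+1%:R] `<=` F.
  move=> z [Sz /= zr]; split => //=; apply: cell_ex => i'.
  have : `|(z - (x + a)) ord0 i'| < n.+1%:R by exact: le_lt_trans (coord_le_enorm _ _) _.
  have := coord_le_enorm x i'; rewrite !mxE ler_norml ltr_norml.
  move=> /andP[? ?] /andP[? ?]; rewrite /C in Cn; apply/andP; split; lra.
rewrite (smooth_sumE i n0 lfS fF FS cover).
pose k_ z := \sum_(j : cell_index n)
  smooth_kern n.+1%:R i (corner j - x) * (`[< cell a j z >])%:R.
have -> : cell_sum S a n x i = fsum F k_.
  rewrite /cell_sum /fsum exchange_big/=; apply: eq_bigr => j _.
  rewrite -mulr_sumr; congr (_ * _).
  have jF : S `&` cell a j `<=` F by move=> z [Sz jz]; split => //; exists j.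
  rewrite -[RHS]/(fsum F (fun z => (`[< cell a j z >])%:R)) (fsumID _ fF jF).
  rewrite (eq_fsum (A := F `\` _) (g := fun=> 0)); last 2 first.
  - exact: finite_setD.
  - by move=> z [[Sz _] nz]; rewrite asboolF// => jz; exact: nz.
  rewrite fsum_cst mul0r addr0; apply: eq_fsum; first exact: sub_finite_set jF fF.
  by move=> z [_ jz]; rewrite asboolT.
have kE' (j : cell_index n) z : cell a j z -> k_ z = smooth_kern n.+1%:R i (corner j - x).
  move=> jz; rewrite /k_ (bigD1 j)//= asboolT// mulr1 big1 ?addr0// => j' j'j.
  rewrite asboolF ?mulr0// => j'z; move/eqP : j'j; apply; exact: cell_inj j'z jz.
rewrite -fsumB.
have kbound z : F z -> `|k_ z - smooth_kern n.+1%:R i (z - (x + a))| <= c / k.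
  move=> [Sz [j jz]]; rewrite (kE' j)//.
  have yp : 4 * eta <= enorm (z - (x + a)) by exact: etaP.
  have y0 : 0 < enorm (z - (x + a)) by lra.
  have yn0 : z - (x + a) != 0 by rewrite -enorm_gt0.
  have hE : corner j - x = z - (x + a) + (corner j - (z - a)).
    rewrite opprD opprB !addrA; apply/rowP => b; rewrite !mxE; ring.
  have hd := cell_dist jz; set h := corner j - (z - a) in hE hd.
  have hy : enorm h <= enorm (z - (x + a)) / 2 by rewrite -/k in hd; lra.
  rewrite hE (le_trans (tame_lip yn0 (tame_smooth_kern i n0 yn0) hy))//.
  have -> : 2 * (smooth_cst R d * (enorm (z - (x + a)) / enorm (z - (x + a)) ^+ d))
      * (enorm h / enorm (z - (x + a)))
      = 2 * smooth_cst R d * (enorm h / enorm (z - (x + a)) ^+ d).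
    by field; rewrite expf_neq0 gt_eqF.
  have -> : c / k = 2 * smooth_cst R d * (d%:R / k * (4 * eta) ^- d).
    by rewrite /c; ring.
  apply: ler_wpM2l; first by rewrite mulr_ge0.
  apply: ler_pM => //; first by rewrite invr_ge0 exprn_ge0.
  have e4 : 0 < 4 * eta by rewrite mulr_gt0.
  rewrite lef_pV2 ?posrE ?exprn_gt0//.
  by apply: lerXn2r; rewrite ?nnegrE// ltW.
(* Points farther than [n + 2] contribute 0 to both sums, as their corners are still at distance at
   least [n + 1] from [x]. *)
pose F1 := F `&` [set z | enorm (z - (x + a)) <= n.+2%:R].
have F1F : F1 `<=` F by exact: subIsetl.
rewrite (fsumID _ fF F1F) (eq_fsum (A := F `\` F1) (g := fun=> 0)); last 2 first.
- exact: finite_setD.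
- move=> z [[Sz [j jz]] nz]; rewrite (kE' j)//.
  have zn : n.+2%:R < enorm (z - (x + a)).
    by rewrite ltNge; apply/negP => zn; apply: nz; split => //; split => //; exists j.
  rewrite /smooth_kern !cutoff_eq0 ?mulr0 ?subrr//.
    by rewrite (le_trans _ (ltW zn))// ler_nat.
  have hE : z - (x + a) = corner j - x - (corner j - (z - a)).
    by apply/rowP => b; rewrite !mxE; ring.
  have := ler_enormD (corner j - x) (- (corner j - (z - a))); rewrite -hE enormN.
  have := cell_dist jz; rewrite -/k; move: zn; rewrite -natr1; lra.
rewrite fsum_cst mul0r addr0.
have fF1 := sub_finite_set F1F fF.
rewrite (le_trans (ler_fsum_card (c := c / k) fF1 _))//.
  by move=> z /F1F; exact: kbound.
have ck0 : 0 <= c / k by rewrite divr_ge0// ltW.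
apply: (@le_trans _ _ (c / k * (G * n.+2%:R ^+ d))).
  rewrite ler_wpM2l// (le_trans _ (gS _ _))//; last first.
    by rewrite -natr1; rewrite /C in Cn; lra.
  by apply: le_card => // z [[Sz _] zn].
apply: (@le_trans _ _ (c / k * (G * (2 * n.+1%:R) ^+ d))).
  rewrite ler_wpM2l// ler_wpM2l// lerXn2r ?nnegrE ?mulr_ge0//.
  by rewrite -natr1; lra.
apply: (@le_trans _ _ (c * G * 2 ^+ d / n.+1%:R)).
  rewrite le_eqVlt; apply/orP; left; apply/eqP.
  by rewrite kE exprS exprMn; field; rewrite expf_neq0 ?gt_eqF.
by rewrite ler_pM2r ?invr_gt0// /C; lra.
Qed.

Lemma cell_sum_cvg v S a x i eps : (0 < d)%N -> regular v S -> ~ S (x + a) ->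
  0 < eps -> exists N, forall n, (N <= n)%N ->
  `|cell_sum S a n x i - force S (x + a) ord0 i| <= eps.
Proof.
move=> d0 rS Sxa e0; have [C CP] := cell_sum_dist i d0 rS Sxa.
have e2 : 0 < eps / 2 by lra.
have [r0 r0P] := smooth_sum_cvg (x + a) i d0 rS e2.
have [N NP] := natr_unbounded (`|r0| + `|C| + `|C| / (eps / 2)).
exists N => n Nn; have := NP _ (leqW Nn) => rn.
have c0 := normr_ge0 C; have cC := ler_norm C; have rr := ler_norm r0.
have r00 := normr_ge0 r0.
have ce0 : 0 <= `|C| / (eps / 2) by rewrite divr_ge0// ltW.
have := CP n ltac:(lra); have := r0P n.+1%:R ltac:(lra).
have : C / n.+1%:R <= eps / 2.
  rewrite ler_pdivrMr ?ltr0n// (le_trans cC)// mulrC -ler_pdivrMr//; lra.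
move: (C / _) (cell_sum _ _ _ _ _) (smooth_sum _ _ _ _) => c' u w.
by rewrite !ler_norml => ? /andP[? ?] /andP[? ?]; apply/andP; split; lra.
Qed.

End cells.

(** * Lebesgue measure on Borel sets *)

Section borel_sets.
Context {R : realType} {d : nat}.

Definition borelType : Type :=
  g_sigma_algebraType [set U : set 'rV[R]_d | open U].

HB.instance Definition _ := Measurable.on borelType.

Lemma continuous_borel (f : 'rV[R]_d -> R) : continuous f ->
  measurable_fun [set: borelType] (f : borelType -> R).
Proof.
move=> /continuousP cf; apply: (measurability _ (RGenOpens.measurableE R)).
move=> _ [_ [a [b ->] <-]]; rewrite setTI; apply: sub_sigma_algebra.
exact/cf/interval_open.
Qed.

Lemma coord_borel (i : 'I_d) :
  measurable_fun [set: borelType] (fun v : borelType => (v : 'rV[R]_d) ord0 i).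
Proof. by apply: continuous_borel; exact: coord_continuous. Qed.

(** There are countably many rational boxes, so [measurable_rV] can reduce Borel measurability of
    vectors to that of their coordinates. *)
Lemma open_rat_boxes (U : set 'rV[R]_d) : open U -> exists Q : set ('rV[rat]_d * nat),
  U = \bigcup_(q in Q) [set v : 'rV[R]_d | forall i,
        `|v ord0 i - ratv R q.1 ord0 i| < (q.2.+1%:R)^-1].
Proof.
move=> oU; exists [set q | [set v : 'rV[R]_d | forall i,
  `|v ord0 i - ratv R q.1 ord0 i| < (q.2.+1%:R)^-1] `<=` U].
apply/seteqP; split=> [x Ux|x [q]]; last by apply.
have /nbhs_normP[e /= e0 eU] : nbhs x U by exact: open_nbhs_nbhs.
have [N NP] := natr_unbounded (4 / e); pose c : R := (N.+1%:R)^-1.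
have c0 : 0 < c by rewrite invr_gt0.
have ce : c <= e / 4.
  by rewrite /c -[leRHS]invrK lef_pV2 ?posrE ?invr_gt0 ?divr_gt0// invf_div NP.
have [|q qP] := rat_approx x (_ : 0 < c / 2); first by lra.
exists (q, N) => /= [v vP|i]; last by rewrite (le_lt_trans (qP i))// -/c; lra.
apply: eU => /=; apply: (@le_lt_trans _ _ (e / 2)); last by lra.
apply: norm_le_coords => [|j i]; first by lra.
rewrite (ord1 j) !mxE.
have := qP i; have := vP i; rewrite -/c.
rewrite ltr_norml !ler_norml => /andP[? ?] /andP[? ?]; apply/andP; split; lra.
Qed.

Lemma measurable_rV disp (T : measurableType disp) (f : T -> 'rV[R]_d) :
  (forall i, measurable_fun [set: T] (fun t => f t ord0 i)) ->
  measurable_fun [set: T] (f : T -> borelType).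
Proof.
move=> mf; apply: (@measurability _ _ T borelType setT f [set U : set 'rV[R]_d | open U]) => //.
move=> _ [U /= /open_rat_boxes[Q ->] <-]; rewrite setTI preimage_bigcup.
rewrite bigcup_mkcond; apply: countable_bigcupT_measurable => [|q].
  exact: countableP.
case: ifP => // _.
rewrite (_ : _ @^-1` _ = \bigcap_(i in [set: 'I_d]) (fun t => f t ord0 i) @^-1`
    [set s | `|s - ratv R q.1 ord0 i| < (q.2.+1%:R)^-1]); last first.
  by apply/seteqP; split => t /= H i; [move=> _; exact: H|exact: H].
apply: fin_bigcap_measurable => // i _.
rewrite -[X in measurable X]setTI; apply: mf => //; apply: open_measurable.
rewrite (_ : [set s | _] = ball (ratv R q.1 ord0 i) (q.2.+1%:R)^-1).
  exact: ball_open.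
by apply/seteqP; split => s /=; rewrite /ball/= distrC.
Qed.

End borel_sets.
Arguments borelType : clear implicits.

Section volume.
Context {R : realType}.

Lemma borel_preimage m n (f : 'rV[R]_m -> 'rV[R]_n) A :
  (forall i, continuous (fun v => f v ord0 i)) -> borel A -> borel (f @^-1` A).
Proof.
move=> cf bA; have mf : measurable_fun [set: borelType R m] (f : _ -> borelType R n).
  by apply: measurable_rV => i; exact: continuous_borel.
by have := mf measurableT A bA; rewrite setTI.
Qed.

Definition cons_rV d (u : measurableTypeR R * borelType R d) : borelType R d.+1 :=
  row_mx (u.1%:M : 'rV[R]_1) (u.2 : 'rV[R]_d).

Lemma cons_rV0 d (u : measurableTypeR R * borelType R d) (j : 'I_1) :
  (cons_rV u : 'rV[R]_d.+1) ord0 (lshift d j) = u.1.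
Proof. by apply: etrans (row_mxEl _ _ _ _) _; rewrite [LHS]mxE !ord1 eqxx mulr1n. Qed.

Lemma cons_rVS d (u : measurableTypeR R * borelType R d) (j : 'I_d) :
  (cons_rV u : 'rV[R]_d.+1) ord0 (rshift 1 j) = (u.2 : 'rV[R]_d) ord0 j.
Proof. exact: row_mxEr. Qed.

Lemma cons_rV_measurable d :
  measurable_fun [set: measurableTypeR R * borelType R d] (@cons_rV d).
Proof.
apply: measurable_rV => i; have [j ij|j ij] := @splitP 1 d i.
  rewrite (_ : i = lshift d j); last exact/val_inj.
  rewrite (_ : (fun _ => _) = fst); first exact: measurable_fst.
  by apply/funext => u; exact: cons_rV0.
rewrite (_ : i = rshift 1 j); last exact/val_inj.
rewrite (_ : (fun _ => _) = (fun v : borelType R d => (v : 'rV[R]_d) ord0 j) \o snd).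
  by apply: measurableT_comp; [exact: coord_borel|exact: measurable_snd].
by apply/funext => u; exact: cons_rVS.
Qed.

Lemma volume_ge0 d (A : set 'rV[R]_d) : (0 <= volume A)%E.
Proof.
elim: d A => [|d IH] A /=; first by rewrite lee_fin.
by apply: integral_ge0.
Qed.

Lemma volume0 d : volume (set0 : set 'rV[R]_d) = 0%E.
Proof.
elim: d => [|d IH] /=; first by rewrite indic0.
by rewrite integral0_eq// => t _; exact: IH.
Qed.

Definition sup_cube d (n : nat) : set 'rV[R]_d :=
  [set v | forall i, `|v ord0 i| <= n%:R].

Arguments sup_cube : clear implicits.

Lemma borel_sup_cube d n : borel (sup_cube d n).
Proof.
have -> : sup_cube d n = \bigcap_(i in [set: 'I_d])
    ((fun v : borelType R d => (v : 'rV[R]_d) ord0 i) @^-1` [set s | `|s| <= n%:R]).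
  by apply/seteqP; split => t /= H i; [move=> _; exact: H|exact: H].
apply: (@fin_bigcap_measurable _ (borelType R d)) => // i _.
rewrite -[X in measurable X]setTI; apply: coord_borel => //.
rewrite (_ : [set s | _] = `[- n%:R, n%:R]%classic); first exact: measurable_itv.
by apply/seteqP; split => s /=; rewrite in_itv/= ler_norml.
Qed.

Lemma sigma_finite_volume d :
  (forall n, volume (sup_cube d n) < +oo)%E ->
  sigma_finite [set: borelType R d] (@volume R d).
Proof.
move=> vfin; exists (sup_cube d) => [|n]; last by split; [exact: borel_sup_cube|].
apply/seteqP; split => // v _; have [N NP] := natr_unbounded `|v : 'rV[R]_d|.
exists N => // i /=; rewrite (le_trans (coord_le_norm _ _))//.
exact: NP.
Qed.

Section volume_step.
Variable d : nat.
Hypothesis additive : semi_sigma_additive (@volume R d : set (borelType R d) -> _).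
Hypothesis vfin : (forall n, volume (sup_cube d n) < +oo)%E.

Let mu : set (borelType R d) -> \bar R := @volume R d.

HB.instance Definition _ := isMeasure.Build _ _ _ mu
  (@volume0 d) (@volume_ge0 d) additive.
HB.instance Definition _ := Measure_isSigmaFinite.Build _ _ _ mu
  (sigma_finite_volume vfin).

Let lm : {measure set (measurableTypeR R) -> \bar R} := lebesgue_measure.
Let pm : {measure set (measurableTypeR R * borelType R d) -> \bar R} :=
  (lm \x mu)%E.

Let volumeE (A : set 'rV[R]_d.+1) : volume A = pm (@cons_rV d @^-1` A).
Proof.
apply: eq_integral => t _ /=; congr (volume _).
by apply/seteqP; split => v /=; rewrite /xsection/= inE.
Qed.

Let section_measurable (A : set (borelType R d.+1)) : measurable A ->
  measurable_fun [set: measurableTypeR R] (fun t =>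
    volume [set v : 'rV[R]_d | A (row_mx (t%:M : 'rV[R]_1) v)]).
Proof.
move=> mA.
rewrite (_ : (fun t => _) = mu \o xsection (@cons_rV d @^-1` A)); last first.
  apply/funext => t /=; congr (volume _).
  by apply/seteqP; split => v /=; rewrite /xsection/= inE.
apply: (measurable_fun_xsection mu).
rewrite -[X in measurable X]setTI.
exact: cons_rV_measurable.
Qed.

Lemma volume_section_measurable (A : set (borelType R d.+1)) : measurable A ->
  measurable_fun [set: measurableTypeR R] (fun t =>
    volume [set v : 'rV[R]_d | A (row_mx (t%:M : 'rV[R]_1) v)]).
Proof. exact: section_measurable. Qed.

Lemma volume_additive_step :
  semi_sigma_additive (@volume R d.+1 : set (borelType R d.+1) -> _).
Proof.
move=> F mF tF mUF.
rewrite volumeE preimage_bigcup.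
rewrite (_ : (fun n => _) =
    (fun n => \sum_(0 <= i < n) pm (@cons_rV d @^-1` F i))%E); last first.
  by apply/funext => n; apply: eq_bigr => i _; exact: volumeE.
have mcons B : measurable B -> measurable (@cons_rV d @^-1` B).
  by move=> mB; rewrite -[X in measurable X]setTI; exact: cons_rV_measurable.
apply: measure_semi_sigma_additive.
- by move=> n; exact: mcons.
- apply/trivIsetP => /= i j _ _ ij; rewrite -preimage_setI.
  by move/trivIsetP : tF => /(_ _ _ _ _ ij) ->//; rewrite preimage_set0.
- by rewrite -preimage_bigcup; exact: mcons.
Qed.

Lemma volume_sup_cube_step n : (volume (sup_cube d.+1 n) < +oo)%E.
Proof.
rewrite volumeE (_ : _ @^-1` _ = `[- n%:R, n%:R]%classic `*` sup_cube d n).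
  set I := `[- n%:R, n%:R]%classic.
  have -> : pm (I `*` sup_cube d n) = (lm I * mu (sup_cube d n))%E.
    by apply: (product_measure1E lm mu); [exact: measurable_itv|exact: borel_sup_cube].
  have lmI : (lm I < +oo)%E.
    have -> : lm I = lebesgue_measure [set` `[(- n%:R : R), n%:R]] by [].
    by rewrite lebesgue_measure_itv/=; case: ifP => _; rewrite ?ltry.
  have muI : (mu (sup_cube d n) < +oo)%E := vfin n.
  by apply: lte_mul_pinfty; rewrite ?ge0_fin_numE.
apply/seteqP; split => -[t v] /=.
  move=> H; split => [|i] /=.
    by have := H (lshift d (ord0 : 'I_1)); rewrite cons_rV0 in_itv/= ler_norml.
  by have := H (rshift 1 i); rewrite cons_rVS.
rewrite in_itv/= -ler_norml => -[tn vn] i; have [j ij|j ij] := @splitP 1 d i.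
  by rewrite (_ : i = lshift d j) ?cons_rV0//; exact/val_inj.
rewrite (_ : i = rshift 1 j) ?cons_rVS; last exact/val_inj.
exact: vn.
Qed.

End volume_step.

(** The two claims go together in the induction: finiteness on cubes gives sigma-finiteness, hence a
    product measure with the Lebesgue measure, which the next volume computes. *)
Lemma volume_additive_finite d :
  semi_sigma_additive (@volume R d : set (borelType R d) -> _) /\
  forall n, (volume (sup_cube d n) < +oo)%E.
Proof.
elim: d => [|d [add fin]]; last first.
  by split; [exact: volume_additive_step|exact: volume_sup_cube_step].
split=> [|n]; last by rewrite /= ltry.
exact: (@measure_semi_sigma_additive _ _ _ (@dirac _ (borelType R 0) (0 : 'rV[R]_0) R)).
Qed.

End volume.

Section affine_volume.
Context {R : realType}.

Definition borel_volume d : set (borelType R d) -> \bar R := @volume R d.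

HB.instance Definition _ d := isMeasure.Build _ _ _ (@borel_volume d)
  (@volume0 R d) (@volume_ge0 R d) (proj1 (@volume_additive_finite R d)).
HB.instance Definition _ d := Measure_isSigmaFinite.Build _ _ _ (@borel_volume d)
  (sigma_finite_volume (proj2 (@volume_additive_finite R d))).

(** Both sides are measures in [A], and the Lebesgue measure is determined by its values on
    half-open intervals. *)
Lemma lebesgue_measure_affine (s a : R) (A : set (measurableTypeR R)) : s != 0 ->
  measurable A ->
  lebesgue_measure A
  = (`|s|%:E * lebesgue_measure ((fun t : R => (s * t + a)%R) @^-1` A))%E.
Proof.
move=> s0 mA; have as0 : 0 < `|s| by rewrite normr_gt0.
pose phi : measurableTypeR R -> measurableTypeR R := fun t : R => s * t + a.
have mphi : measurable_fun [set: measurableTypeR R] phi.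
  apply: (@continuous_measurable_fun R) => t.
  by apply: cvgD; [apply: cvgMr; exact: cvg_id|exact: cvg_cst].
pose nu : {measure set (measurableTypeR R) -> \bar R} :=
  mscale (NngNum (normr_ge0 s)) (pushforward lebesgue_measure phi).
apply: (@lebesgue_measure_unique R (nu mphi)) => // _ [[x y] _ <-].
rewrite -[RHS]/(`|s|%:E * lebesgue_measure (phi @^-1` `]x, y]))%E.
have [sp|sn] := ltP 0 s.
  have -> : phi @^-1` `]x, y] = `](x - a) / s, (y - a) / s]%classic.
    apply/seteqP; split => t /=; rewrite !in_itv/= /phi ltr_pdivrMr// ler_pdivlMr//
      ltrBlDr lerBrDr (mulrC s)//.
  rewrite !lebesgue_measure_itv/= !lte_fin ltr_pM2r ?invr_gt0// ltrD2r.
  case: ifP => _; last by rewrite mule0.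
  rewrite -!EFinB -EFinM gtr0_norm//; congr (_%:E); field.
  exact: s0.
have {}sn : s < 0 by rewrite lt_neqAle s0.
(* A negative factor reverses the interval: the preimage is closed on the left and open on the
   right. *)
have -> : phi @^-1` `]x, y] = `[(y - a) / s, (x - a) / s[%classic.
  apply/seteqP; split => t /=; rewrite !in_itv/= /phi ltr_ndivlMr// ler_ndivrMr//
    ltrBlDr lerBrDr (mulrC s) andbC//.
rewrite !lebesgue_measure_itv/= !lte_fin ltr_nM2r ?invr_lt0// ltrD2r.
case: ifP => _; last by rewrite mule0.
rewrite -!EFinB -EFinM ltr0_norm//; congr (_%:E); field.
exact: s0.
Qed.

Lemma ge0_integral_affine (s a : R) (f : R -> \bar R) : s != 0 ->
  measurable_fun [set: measurableTypeR R] (f : measurableTypeR R -> \bar R) ->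
  (forall t, 0 <= f t)%E ->
  (\int[lebesgue_measure]_t f t
   = `|s|%:E * \int[lebesgue_measure]_t f (s * t + a)%R)%E.
Proof.
move=> s0 mf f0.
pose phi : measurableTypeR R -> measurableTypeR R := fun t : R => s * t + a.
have mphi : measurable_fun [set: measurableTypeR R] phi.
  apply: (@continuous_measurable_fun R) => t.
  by apply: cvgD; [apply: cvgMr; exact: cvg_id|exact: cvg_cst].
pose nu : {measure set (measurableTypeR R) -> \bar R} :=
  pushforward lebesgue_measure phi.
transitivity (\int[mscale (NngNum (normr_ge0 s)) (nu mphi)]_t f t)%E.
  apply: eq_measure_integral => A mA _.
  exact: lebesgue_measure_affine.
rewrite ge0_integral_mscale//; congr (_ * _)%E.
by rewrite (ge0_integral_pushforward mphi).
Qed.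

Lemma borel_section d (A : set 'rV[R]_d.+1) (t : R) : borel A ->
  borel [set v : 'rV[R]_d | A (row_mx (t%:M : 'rV[R]_1) v)].
Proof.
move=> bA; have mA : measurable (@cons_rV R d @^-1` A).
  rewrite -[X in measurable X]setTI.
  exact: (@cons_rV_measurable R d measurableT A bA).
rewrite (_ : [set v | _] = xsection (@cons_rV R d @^-1` A) t).
  exact: (measurable_xsection t mA).
by apply/seteqP; split => v /=; rewrite /xsection/= inE.
Qed.

(** Induction on the dimension: the first coordinate gives one factor [|s|] by
    [ge0_integral_affine], the sections give the others. Translations, reflections and ball volumes
    are the cases [s = 1], [-1] and [r]. *)
Lemma volume_affine d (s : R) (a : 'rV[R]_d) (A : set 'rV[R]_d) : s != 0 -> borel A ->
  volume A = ((`|s| ^+ d)%:E * volume [set v : 'rV[R]_d | A (s *: v + a)%R])%E.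
Proof.
move=> s0; elim: d a A => [|d IH] a A bA.
  rewrite expr0 mul1e /= !indicE; congr (_%:R%:E); congr (nat_of_bool _).
  have E : (s *: 0 + a)%R = 0%R by exact: thinmx0.
  by apply/idP/idP; rewrite !inE/= E.
have vf := @volume_additive_finite R d.
have mA := volume_section_measurable vf.1 vf.2 bA.
pose a0 := lsubmx (a : 'rV_(1 + d)) ord0 ord0; pose a' := rsubmx (a : 'rV_(1 + d)).
have rowE t v : (s *: row_mx (t%:M : 'rV[R]_1) v + a)%R =
    row_mx ((s * t + a0)%:M : 'rV[R]_1) (s *: v + a')%R.
  rewrite -[a in LHS](hsubmxK (a : 'rV_(1 + d))) scale_row_mx add_row_mx.
  congr row_mx; apply/rowP => i; rewrite !mxE !ord1 eqxx !mulr1n.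
  by rewrite /a0 mxE.
pose B := [set v : 'rV[R]_d.+1 | A (s *: v + a)%R].
have bB : borel B.
  apply: (@borel_preimage _ _ _ (fun v => s *: v + a)%R) => // i v.
  rewrite (_ : (fun v => _) = (fun v : 'rV[R]_d.+1 => s * v ord0 i + a ord0 i)%R).
    apply: (@continuous_comp _ _ _ (fun v : 'rV[R]_d.+1 => v ord0 i)
      (fun t : R => s * t + a ord0 i)%R); first exact: coord_continuous.
    by apply: cvgD; [apply: cvgMr; exact: cvg_id|exact: cvg_cst].
  by apply/funext => w; rewrite !mxE.
have mB := volume_section_measurable vf.1 vf.2 bB.
rewrite [LHS]/= (ge0_integral_affine a0 s0 mA) => [|t]; last exact: volume_ge0.
rewrite exprS EFinM -muleA; congr (_ * _)%E.
rewrite -[volume _]/(\int[lebesgue_measure]_t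
  volume [set v : 'rV[R]_d | B (row_mx (t%:M : 'rV[R]_1) v)])%E.
rewrite -ge0_integralZl//; last by move=> t _; exact: volume_ge0.
apply: eq_integral => t _; rewrite (IH a' _ (borel_section _ bA)).
by congr (_ * volume _)%E; apply/seteqP; split => v /=; rewrite /B/= rowE.
Qed.

End affine_volume.

Section ball_volume.
Context {R : realType} {d : nat}.
Implicit Types (x : 'rV[R]_d) (r : R) (A B : set 'rV[R]_d).

Lemma enorm_continuous : continuous (@enorm R d).
Proof.
move=> x; apply/(@cvgrPdist_le _ _ _ (nbhs x) (nbhs_filter x)) => eps e0.
have c0 : 0 < d%:R + 1 :> R by rewrite ltr_wpDl.
have := near_dist_le x (divr_gt0 e0 c0); apply: filterS => y xy.
have : `|enorm x - enorm y| <= enorm (x - y).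
  by have := ler_dist_enorm y (x - y); rewrite (addrC y) subrK.
move/le_trans; apply; rewrite (le_trans (enorm_le_norm _))//.
move: xy; rewrite ler_pdivlMr//; have := normr_ge0 (x - y); lra.
Qed.

Definition cball x r : set 'rV[R]_d := [set z | enorm (z - x) <= r].

Lemma closed_borel A : closed A -> borel A.
Proof.
move=> cA; rewrite -(setCK A).
apply: (@measurableC _ (borelType R d)); apply: sub_sigma_algebra.
exact: closed_openC.
Qed.

Lemma le_continuous_closed (f g : 'rV[R]_d -> R) : continuous f -> continuous g ->
  closed [set z | f z <= g z].
Proof.
move=> cf cg; rewrite (_ : [set z | _] = (fun z => g z - f z) @^-1` [set t | 0 <= t]).
  have /continuous_closedP : continuous (fun z => g z - f z).
    by move=> z; exact: cvgB (cg z) (cf z).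
  by apply; exact: closed_ge.
by apply/seteqP; split => z /=; rewrite subr_ge0.
Qed.

Lemma enormB_continuous x : continuous (fun z : 'rV[R]_d => enorm (z - x)).
Proof.
move=> z; apply: (@continuous_comp _ _ _ (fun z : 'rV[R]_d => z - x) (@enorm R d)).
  by apply: continuousB; [exact: cvg_id|exact: cst_continuous].
exact: enorm_continuous.
Qed.

Lemma borel_cball x r : borel (cball x r).
Proof.
apply: closed_borel; apply: le_continuous_closed; first exact: enormB_continuous.
exact: cst_continuous.
Qed.

Lemma le_volume A B : borel A -> borel B -> A `<=` B -> (volume A <= volume B)%E.
Proof.
move=> bA bB AB.
by apply: (@le_measure _ _ _ (@borel_volume R d)); rewrite ?inE.
Qed.

Lemma volume_setT_gt0 : (0 < volume [set: 'rV[R]_d])%E.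
Proof.
elim: d => [|n IH] /=; first by rewrite indicT lte_fin ltr01.
rewrite (_ : (fun t => _) = cst (volume [set: 'rV[R]_n])); last first.
  by apply/funext => t /=; congr volume; apply/seteqP; split.
rewrite integral_cst//.
have := lebesgue_measure_itv (`]-oo, +oo[ : interval R).
by rewrite set_itvNyy /= => ->; rewrite mule_gt0// ltry.
Qed.

Definition unit_ball_volume : R := fine (volume (cball 0 1)).

Lemma volume_translate A x : borel A ->
  volume [set v : 'rV[R]_d | A (v + x)] = volume A.
Proof.
move=> bA; rewrite (@volume_affine R d 1 x A)// ?oner_neq0// normr1 expr1n mul1e.
by congr volume; apply/seteqP; split => v /=; rewrite scale1r.
Qed.

Lemma volume_reflect A x : borel A ->
  volume [set v : 'rV[R]_d | A (x - v)] = volume A.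
Proof.
move=> bA; rewrite (@volume_affine R d (-1) x A)// ?oppr_eq0 ?oner_neq0//.
rewrite normrN1 expr1n mul1e.
by congr volume; apply/seteqP; split => v /=; rewrite scaleN1r addrC.
Qed.

Lemma volume_unit_ball_fin : volume (cball 0 1) \is a fin_num.
Proof.
rewrite ge0_fin_numE ?volume_ge0//.
apply: le_lt_trans (proj2 (@volume_additive_finite R d) 1%N).
apply: le_volume; [exact: borel_cball|exact: borel_sup_cube|].
by move=> v /=; rewrite /cball/= subr0 => v1 i; rewrite (le_trans (coord_le_enorm _ _)).
Qed.

Lemma volume_cball x r : 0 < r -> volume (cball x r) = (unit_ball_volume * r ^+ d)%:E.
Proof.
move=> r0; rewrite (@volume_affine R d r x _ (lt0r_neq0 r0))//; last exact: borel_cball.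
rewrite EFinM /unit_ball_volume fineK ?volume_unit_ball_fin// muleC gtr0_norm//.
congr (_ * _)%E; congr volume; apply/seteqP; split => v /=.
  by rewrite /cball/= addrK subr0 enormZ gtr0_norm// -{2}(mulr1 r) ler_pM2l.
by rewrite /cball/= addrK subr0 enormZ gtr0_norm// -{2}(mulr1 r) ler_pM2l.
Qed.

Lemma volume_cball_fin x r : 0 < r -> (volume (cball x r) < +oo)%E.
Proof. by move=> r0; rewrite volume_cball// ltry. Qed.

(** If the unit ball were null, so would be every ball by scaling, and hence the whole space, a
    countable union of balls. *)
Lemma unit_ball_volume_gt0 : 0 < unit_ball_volume.
Proof.
rewrite lt0r fine_ge0 ?volume_ge0// andbT; apply/eqP => v0.
have := volume_setT_gt0; rewrite (_ : [set: _] = \bigcup_n cball 0 n.+1%:R); last first.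
  apply/seteqP; split => // v _; have [N NP] := natr_unbounded (enorm v).
  by exists N => //; rewrite /cball/= subr0 NP.
apply/negP; rewrite -leNgt.
have := @generalized_Boole_inequality _ _ _ (@borel_volume R d) (fun n => cball 0 n.+1%:R).
move=> /(_ _ _)/le_trans; apply.
- by move=> n; exact: borel_cball.
- by apply: bigcupT_measurable => n; exact: borel_cball.
rewrite eseries0// => n _ _.
by apply: etrans (volume_cball _ _) _; rewrite ?v0 ?mul0r.
Qed.

Lemma volume_set1 x : (0 < d)%N -> volume [set x] = 0%E.
Proof.
move=> d0; apply/eqP; rewrite eq_le volume_ge0 andbT.
apply/lee_addgt0Pr => eps e0; rewrite add0e.
have v0 := unit_ball_volume_gt0.
pose r := Num.min 1 (eps / unit_ball_volume).
have r0 : 0 < r by rewrite lt_min ltr01 divr_gt0.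
apply: (@le_trans _ _ (volume (cball x r))).
  apply: le_volume; last by move=> _ -> /=; rewrite /cball/= subrr enorm0 ltW.
    rewrite (_ : [set x] = cball x 0); first exact: borel_cball.
    apply/seteqP; split => [_ ->|z]; rewrite /cball/= ?subrr ?enorm0//.
    move=> z0; apply/eqP; rewrite -subr_eq0 -enorm_eq0 eq_le z0/=.
    exact: enorm_ge0.
  exact: borel_cball.
rewrite volume_cball// lee_fin mulrC -ler_pdivlMr//.
rewrite (@le_trans _ _ r)//; last by rewrite ge_min lexx orbT.
rewrite -[leRHS]expr1 ler_wiXn2l// ?(ltW r0)// ge_min lexx//.
Qed.

End ball_volume.
Arguments unit_ball_volume : clear implicits.

(** * Poisson discrepancies *)

Section poisson_tails.
Context {R : realType}.

(** Through [exp t <= 1 / (1 - t)], followed by [(1 + t + 2 t^2)(1 - t) = 1 + t^2 (1 - 2 t) >=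
    1]. *)
Lemma expR_quadratic (t : R) : `|t| <= 1 / 2 -> expR t <= 1 + t + 2 * t ^+ 2.
Proof.
rewrite ler_norml => /andP[t1 t2]; have t0 : 0 < 1 - t by lra.
apply: (@le_trans _ _ (1 - t)^-1).
  rewrite -[leLHS]invrK -expRN lef_pV2 ?posrE ?expR_gt0//.
  exact: expR_ge1Dx.
rewrite -[X in X <= _]mul1r ler_pdivrMr//.
have : 0 <= t ^+ 2 * (1 - 2 * t) by rewrite mulr_ge0 ?sqr_ge0//; lra.
by lra.
Qed.

Lemma eseries_exp (x : R) : (\sum_(n <oo) (x ^+ n / n`!%:R)%:E)%E = (expR x)%:E.
Proof.
rewrite expRE -EFin_lim; last first.
  rewrite /pseries/=; under eq_fun do rewrite mulrC.
  exact: is_cvg_series_exp_coeff.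
apply/congr_lim/funext => n/=; rewrite /pseries/= /series/= -sumEFin//.
by under eq_bigr do rewrite mulrC.
Qed.

Lemma poisson_prob1 (L : R) n : 0 <= L ->
  poisson_prob L 0 [set n] = (L ^+ n / n`!%:R * expR (- L))%:E.
Proof.
rewrite le_eqVlt => /orP[/eqP <-|L0]; rewrite /poisson_prob.
  rewrite ltxx diracE oppr0 expR0 mulr1 expr0n.
  case: n => [|n] /=; first by rewrite fact0 invr1 mulr1 mem_set.
  by rewrite mul0r memNset.
rewrite L0 esum_set1 ?lee_fin ?poisson_pmf_ge0//.
by rewrite /poisson_pmf L0.
Qed.

(** From the term of order [n] in the exponential series; it trades the exponential decay for one
    power more than the number of sets in [discrepancy_ae]. *)
Lemma expR_le_inv (q : R) n : 0 < q -> expR (- q) <= n`!%:R / q ^+ n.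
Proof.
move=> q0; rewrite expRN -[leRHS]invrK lef_pV2 ?posrE ?expR_gt0//; last first.
  by rewrite invr_gt0 divr_gt0 ?exprn_gt0// ltr0n fact_gt0.
rewrite invf_div; case: n => [|n].
  by rewrite expr0 fact0 divr1 ltW// expR_gt1.
have := expR_ge1Dxn n (ltW q0); lra.
Qed.

End poisson_tails.

Lemma measure_finite_subadditive {disp : measure_display} {T : measurableType disp}
    {R : realType} (mu : {measure set T -> \bar R}) (I : finType) (A : I -> set T) :
  (forall i, measurable (A i)) ->
  (mu (\bigcup_(i in [set: I]) A i) <= \sum_(i : I) mu (A i))%E.
Proof.
move=> mA; rewrite (_ : \bigcup_(i in _) _ = \big[setU/set0]_(i <- index_enum I) A i).
  elim: (index_enum I) => [|i s IH]; first by rewrite !big_nil measure0.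
  rewrite !big_cons (@le_trans _ _ (mu (A i) + mu (\big[setU/set0]_(j <- s) A j))%E)//.
    by apply: measureU2 => //; exact: bigsetU_measurable.
  exact: leeD2l.
rewrite -bigcup_seq; apply: eq_bigcupl; split => i _ //=.
by rewrite mem_index_enum.
Qed.

Section poisson_process.
Context {disp : measure_display} {T : measurableType disp} {R : realType}.
Context {P : probability T R} {d : nat} {Z : T -> set 'rV[R]_d}.
Hypothesis Z_poisson : standard_poisson_process P Z.
Implicit Types A : set 'rV[R]_d.

Definition count (A : set 'rV[R]_d) (w : T) : R := card (Z w `&` A).

Lemma npointsE A w : bounded_set A -> npoints (Z w) A = (count A w)%:E.
Proof.
move=> bA; have fA := spp_locally_finite Z_poisson w bA.
by rewrite /npoints /counting asboolT// /count cardE.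
Qed.

Lemma count_measurable A : borel A -> bounded_set A ->
  measurable_fun [set: T] (count A).
Proof.
move=> bA bdA; rewrite (_ : count A = fine \o (fun w => npoints (Z w) A)).
  apply: measurableT_comp; first exact: fine_measurable.
  exact: (spp_measurable Z_poisson).
by apply/funext => w /=; rewrite npointsE.
Qed.

Lemma count_poisson A n : borel A -> bounded_set A -> (volume A < +oo)%E ->
  P [set w | count A w = n%:R] =
  ((fine (volume A)) ^+ n / n`!%:R * expR (- fine (volume A)))%:E.
Proof.
move=> bA bdA vA; rewrite -poisson_prob1 ?fine_ge0 ?volume_ge0//.
rewrite -(spp_poisson Z_poisson n bA vA); congr (P _).
by apply/seteqP; split => w /=; rewrite npointsE//; [move=> -> | case].
Qed.

Lemma countE A w : exists n : nat, count A w = n%:R.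
Proof. by rewrite /count cardE; eexists. Qed.

Lemma measurable_count_eq A n : borel A -> bounded_set A ->
  measurable [set w | count A w = n%:R].
Proof.
move=> bA bdA; rewrite (_ : [set w | _] = count A @^-1` [set n%:R]).
  by rewrite -[X in measurable X]setTI; apply: count_measurable.
by apply/seteqP; split.
Qed.

(* Chernoff's bound for both tails at once: [t] may have either sign. *)
Lemma count_chernoff A (t b : R) : borel A -> bounded_set A -> (volume A < +oo)%E ->
  (P [set w | (t * b <= t * count A w)%R]
   <= (expR (- (t * b) + fine (volume A) * (expR t - 1)))%:E)%E.
Proof.
move=> bA bdA vA; set L := fine (volume A).
have L0 : 0 <= L by rewrite fine_ge0// volume_ge0.
pose E n := if (t * b <= t * n%:R)%R then [set w | count A w = n%:R] else set0.
have mE n : measurable (E n).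
  by rewrite /E; case: ifP => _ //; exact: measurable_count_eq.
have -> : [set w | t * b <= t * count A w] = \bigcup_n E n.
  apply/seteqP; split => w /=.
    have [n nE] := countE A w => tb; exists n => //.
    by rewrite /E -nE tb.
  by move=> [n _]; rewrite /E; case: ifP => // tb /= ->.
apply: (@le_trans _ _ (\sum_(n <oo) P (E n))%E).
  by apply: generalized_Boole_inequality => //; exact: bigcupT_measurable.
pose c := expR (- (t * b) - L).
(* The summand is the Poisson weight at [n] times [exp (t (n - b))], a factor at least 1 whenever
   the test in [E n] succeeds; the series sums to the right-hand side. *)
apply: (@le_trans _ _ (\sum_(n <oo) (c * ((L * expR t) ^+ n / n`!%:R))%:E)%E).
  apply: lee_nneseries => [*|n _]; first exact: measure_ge0.
  rewrite /E; case: ifPn => tb; last first.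
    by rewrite measure0 lee_fin !mulr_ge0 ?expR_ge0// ?exprn_ge0 ?mulr_ge0 ?expR_ge0.
  rewrite count_poisson// -/L lee_fin.
  have -> : c * ((L * expR t) ^+ n / n`!%:R)
      = L ^+ n / n`!%:R * expR (- L) * expR (t * n%:R - t * b).
    by rewrite /c expRB exprMn -expRM_natr expRD !expRN; ring.
  rewrite ler_peMr ?mulr_ge0 ?expR_ge0 ?invr_ge0 ?exprn_ge0//.
  by rewrite -[leLHS]expR0 ler_expR subr_ge0.
under eq_eseriesr do rewrite EFinM.
rewrite nneseriesZl; last first.
  by move=> n _; rewrite lee_fin divr_ge0// exprn_ge0// mulr_ge0// expR_ge0.
rewrite eseries_exp -EFinM lee_fin /c -expRD le_eqVlt; apply/orP; left; apply/eqP.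
by congr expR; ring.
Qed.

Lemma measurable_count_deviation A (s L : R) : borel A -> bounded_set A ->
  measurable [set w | s < `|count A w - L|].
Proof.
move=> bA bdA.
rewrite (_ : [set w | _] = count A @^-1` [set x | s < `|x - L|]).
  rewrite -[X in measurable X]setTI; apply: count_measurable => //.
  apply: open_measurable.
  rewrite (_ : [set x | _] = (fun x => `|x - L|) @^-1` [set y | s < y]).
    have /continuousP : continuous (fun x : R => `|x - L|).
      move=> x; apply: (@continuous_comp _ _ _ (fun x : R => x - L) (fun y : R => `|y|)).
        by apply: cvgB; [exact: cvg_id|exact: cvg_cst].
      exact: norm_continuous.
    by apply; exact: open_gt.
  by apply/seteqP; split.
by apply/seteqP; split.
Qed.

(** Chernoff's bound with [t] and with [- t]: both exponents are at most [- t s + 2 L t^2], since in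
    [exp t - 1 <= t + 2 t^2] the linear term cancels against the mean. *)
Lemma count_deviation A (t s : R) : borel A -> bounded_set A ->
  (volume A < +oo)%E -> 0 < t -> t <= 1 / 2 ->
  (P [set w | (s < `|count A w - fine (volume A)|)%R]
   <= (2 * expR (- (t * s) + 2 * fine (volume A) * t ^+ 2))%:E)%E.
Proof.
move=> bA bdA vA t0 t2; set L := fine (volume A).
have L0 : 0 <= L by rewrite fine_ge0// volume_ge0.
have mb t' b : measurable [set w | t' * b <= t' * count A w].
  rewrite (_ : [set w | _] = count A @^-1` [set x | t' * b <= t' * x]).
    rewrite -[X in measurable X]setTI; apply: count_measurable => //.
    apply: closed_measurable.
    rewrite (_ : [set x | _] = (fun x => t' * x) @^-1` [set y | t' * b <= y]).
      have /continuous_closedP : continuous (fun x : R => t' * x).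
        by move=> x; apply: cvgMr; exact: cvg_id.
      by apply; exact: closed_ge.
    by apply/seteqP; split.
  by apply/seteqP; split.
pose U := [set w | t * (L + s) <= t * count A w].
pose D := [set w | (- t) * (L - s) <= (- t) * count A w].
apply: (@le_trans _ _ (P (U `|` D))).
  apply: le_measure; rewrite ?inE//.
  - exact: measurable_count_deviation.
  - by apply: measurableU; exact: mb.
  move=> w /=; have [H|H] := leP 0 (count A w - L) => sw; [left|right].
    by rewrite /U/= ler_pM2l//; move: sw; rewrite ger0_norm//; lra.
  by rewrite /D/= ler_nM2l ?oppr_lt0//; move: sw; rewrite ltr0_norm//; lra.
apply: (@le_trans _ _ (P U + P D)%E).
  by apply: measureU2; exact: mb.
have H t' s' : `|t'| <= 1 / 2 -> t' ^+ 2 = t ^+ 2 -> t' * s' = t * s ->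
    (P [set w | (t' * (L + s') <= t' * count A w)%R]
     <= (expR (- (t * s) + 2 * L * t ^+ 2))%:E)%E.
  move=> t'1 t'2 ts; rewrite (le_trans (count_chernoff _ _ bA bdA vA))//.
  rewrite lee_fin ler_expR -/L.
  have := ler_wpM2l L0 (expR_quadratic t'1); rewrite mulrDr -ts t'2; lra.
rewrite mulr_natl mulr2n EFinD; apply: leeD.
  by apply: H => //; rewrite gtr0_norm.
have := H (- t) (- s); apply; [|by rewrite sqrrN|by rewrite mulrNN].
by rewrite normrN gtr0_norm.
Qed.

Lemma cvg_eseries_half (D : R) : (\sum_(k <oo) (D / 2 ^+ k)%:E < +oo)%E.
Proof.
have /cvg_lim := @cvg_geometric_eseries_half R (D *+ 2) 0.
rewrite expr0 divr1 => H.
rewrite (_ : (\sum_(k <oo) _)%E = (D *+ 2)%:E) ?ltry//.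
rewrite -H//; apply/congr_lim/funext => n; apply: eq_bigr => k _.
by congr EFin; rewrite natrX exprD expr1; field; rewrite expf_neq0.
Qed.

(** With [q = 2 ^ k] and [t = q ^ (- 2d)], the term [2 V t^2] stays below [2 C] while
    [t s = q ^ (2d - 5) >= q], which uses [d >= 3]. Each set fails with probability at most
    [2 e^(2C) e^(-q)]; [expR_le_inv] at exponent [p + 1] beats the [B q^p] sets and leaves a
    summable [O(1/q)]. *)
Lemma discrepancy_ae (I : nat -> finType) (A : forall k, I k -> set 'rV[R]_d)
    (B C : R) (p : nat) : (3 <= d)%N ->
  (forall k j, borel (A k j)) -> (forall k j, bounded_set (A k j)) ->
  (forall k j, volume (A k j) <= (C * (2 ^+ k) ^+ (4 * d))%:E)%E ->
  (forall k, #|I k|%:R <= B * (2 ^+ k) ^+ p) ->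
  {ae P, forall w, exists k0, forall k, (k0 <= k)%N -> forall j,
    `|count (A k j) w - fine (volume (A k j))| <= (2 ^+ k) ^+ (4 * d - 5)}.
Proof.
move=> d3 bA bdA vA cI.
pose s k : R := (2 ^+ k) ^+ (4 * d - 5).
pose E k j := [set w | s k < `|count (A k j) w - fine (volume (A k j))|].
pose F k := \bigcup_(j in [set: I k]) E k j.
have mE k j : measurable (E k j).
  exact: measurable_count_deviation.
have mF k : measurable (F k).
  by apply: fin_bigcup_measurable => [|j _]; [exact: finite_finset|exact: mE].
pose D0 := B * (2 * expR (2 * C)) * (p.+1)`!%:R; pose D := Num.max 1 D0.
have PF k : (P (F k) <= (D / 2 ^+ k)%:E)%E.
  (* At [k = 0] the parameter [t] would be 1, beyond the reach of [count_deviation]; the trivial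
     bound is absorbed by the maximum in [D]. *)
  case: k => [|k].
    rewrite expr0 divr1 (le_trans (probability_le1 _ (mF _)))// lee_fin.
    by rewrite le_max lexx.
  set q : R := 2 ^+ k.+1.
  have q1 : 1 <= q by rewrite exprn_ege1// ler1n.
  have q0 : 0 < q by rewrite exprn_gt0.
  have q2 : 2 <= q by rewrite /q exprS ler_peMr// exprn_ege1// ler1n.
  pose t := (q ^+ (2 * d))^-1.
  have t0 : 0 < t by rewrite invr_gt0 exprn_gt0.
  have t2 : t <= 1 / 2.
    rewrite /t div1r lef_pV2 ?posrE ?exprn_gt0//.
    rewrite (le_trans q2)// -[X in X <= _]expr1 ler_weXn2l//; lia.
  have ts : q <= t * s k.+1.
    rewrite /t /s -/q mulrC ler_pdivlMr ?exprn_gt0// -exprS ler_weXn2l//; lia.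
  have PE j : (P (E k.+1 j) <= (2 * expR (2 * C) * (p.+1`!%:R / q ^+ p.+1))%:E)%E.
    have Vfin : (volume (A k.+1 j) < +oo)%E by rewrite (le_lt_trans (vA _ _)) ?ltry.
    apply: (le_trans (count_deviation (s k.+1) _ _ Vfin t0 t2)) => //.
    rewrite lee_fin -[leRHS]mulrA; apply: ler_wpM2l => //.
    apply: (le_trans _ (ler_wpM2l (expR_ge0 _) (expR_le_inv p.+1 q0))).
    rewrite -expRD ler_expR.
    have : fine (volume (A k.+1 j)) * t ^+ 2 <= C.
      have := vA k.+1 j; rewrite -/q -[X in (X <= _)%E]fineK; last first.
        by rewrite ge0_fin_numE// volume_ge0.
      rewrite lee_fin /t exprVn -[(q ^+ (2 * d)) ^+ 2]exprM => vq.
      rewrite ler_pdivrMr ?exprn_gt0//.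
      by rewrite (_ : (2 * d * 2 = 4 * d)%N); last by lia.
    move: ts; rewrite -[2 * fine _ * _]mulrA.
    move: (fine _ * t ^+ 2) (t * s _) (q) => x y z; lra.
  apply: (@le_trans _ _ (\sum_(j : I k.+1) P (E k.+1 j))%E).
    exact: measure_finite_subadditive.
  apply: (le_trans (lee_sum _ (fun j _ => PE j))).
  rewrite sumEFin lee_fin sumr_const -[leLHS]mulr_natl.
  apply: (@le_trans _ _ (D0 / q)); last by rewrite ler_pM2r ?invr_gt0// le_max lexx orbT.
  apply: (le_trans (ler_wpM2r _ (cI k.+1))).
    by rewrite !mulr_ge0 ?expR_ge0 ?invr_ge0 ?exprn_ge0 ?ltW.
  rewrite -/q /D0 exprS le_eqVlt; apply/orP; left; apply/eqP; field.
  have qn0 : q != 0 by rewrite gt_eqF.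
  by rewrite qn0 expf_neq0.
have sF : (\sum_(k <oo) P (F k) < +oo)%E.
  apply: le_lt_trans (cvg_eseries_half D).
  by apply: lee_nneseries => [*|k _]; [exact: measure_ge0|exact: PF].
exists (lim_sup_set F); split.
- by apply: bigcapT_measurable => n; apply: bigcup_measurable => k _; exact: mF.
- exact: lim_sup_set_cvg0 mF sF.
- move=> w /= nw n _; apply: contrapT => nF; apply: nw; exists n => k nk j.
  rewrite leNgt; apply/negP => Ekj; apply: nF; exists k => //; exists j => //.
Qed.

End poisson_process.

(** * Sums over dyadic shells *)

Section shell_sums.
Context {R : realType} {d : nat}.
Implicit Types (S : set 'rV[R]_d) (x : 'rV[R]_d).

(** For [u >= 0], the number of integers [l >= 1] with [l <= u] is the integer part of [u]; the two
    sums treat the positive and the negative part. *)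
Lemma level_count_error (u : R) (M : nat) : `|u| <= M%:R ->
  `|u - (\sum_(l < M) (l.+1%:R <= u)%R%:R - \sum_(l < M) (l.+1%:R <= - u)%R%:R)| <= 1.
Proof.
have pos (y : R) : 0 <= y -> y <= M%:R ->
    \sum_(l < M) (l.+1%:R <= y)%R%:R = (Num.truncn y)%:R :> R.
  move=> y0 yM; under eq_bigr do rewrite -truncn_gt_nat.
  rewrite -natr_sum; congr (_%:R).
  have tM : (Num.truncn y <= M)%N by rewrite -(ler_nat R) (le_trans _ yM)// truncn_le.
  rewrite -[RHS](minn_idPr tM); elim: (M) => [|m IH]; first by rewrite big_ord0; lia.
  by rewrite big_ord_recr /= IH; case: ltnP => /=; lia.
have neg (y : R) : y <= 0 -> \sum_(l < M) (l.+1%:R <= y)%R%:R = 0 :> R.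
  move=> y0; apply: big1 => l _; rewrite leNgt (le_lt_trans y0)//.
have err (y : R) : 0 <= y -> `|y - (Num.truncn y)%:R| <= 1.
  move=> y0; have /andP[t1 t2] := truncn_itv y0.
  by rewrite ler_norml; move: t2; rewrite -natr1; move: (_%:R) t1 => t; lra.
rewrite ler_norml => /andP[Mu uM]; have [u0|u0] := leP 0 u.
  by rewrite pos// neg ?oppr_le0// subr0 err.
rewrite (neg u) ?(ltW u0)// pos; [|by lra|by lra].
rewrite sub0r opprK -normrN opprD err//; lra.
Qed.

Lemma fsum_indicator (A : set 'rV[R]_d) (b : 'rV[R]_d -> bool) : finite_set A ->
  fsum A (fun z => (b z)%:R) = card (A `&` [set z | b z]) :> R.
Proof.
move=> fA; rewrite (@fsumID R _ (A `&` [set z | b z]))//.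
rewrite (@eq_fsum _ _ _ _ (fun=> 1)); last first.
- by move=> z [_ /= ->].
- exact: finite_setIl.
rewrite (@eq_fsum _ _ (_ `\` _) _ (fun=> 0)); last first.
- by move=> z [Az nz]; case: (boolP (b z)) => // bz; case: nz.
- exact: finite_setD.
rewrite -/(card _) [X in _ + X](_ : _ = 0) ?addr0//.
by rewrite /fsum big1.
Qed.

(* The points [z] of the shell of radii [r] and [s] around [x] such that
   [+- kern i (z - x) >= l / r ^ (d + 1)]. *)
Definition level_set x (i : 'I_d) (r : R) (b : bool) (s : R) (l : nat) :=
  [set z : 'rV[R]_d | [/\ r < enorm (z - x), enorm (z - x) <= s &
     l%:R * enorm (z - x) ^+ d <= (-1) ^+ b * (z - x) ord0 i * r ^+ d.+1]].

(** After multiplication by [r ^+ d.+1] the kernel takes values in [[- r^2, r^2]] on the shell. Up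
    to an error 1 per point, each value is a signed number of levels, so the sum becomes one of
    count differences over [r^2] levels. *)
Lemma shell_sum_le S x (i : 'I_d) (r s c : R) (M : nat) : locally_finite S -> 0 < r ->
  r ^+ 2 = M%:R ->
  (forall l, (l <= M)%N ->
    `|card (S `&` level_set x i r false s l) - card (S `&` level_set x i r true s l)| <= c) ->
  `|fsum (pts S x s `\` pts S x r) (fun z => kern i (z - x))|
    <= (r ^+ 2 * c + card (pts S x s `\` pts S x r)) / r ^+ d.+1.
Proof.
move=> lfS r0 rM Hc; set H := _ `\` _.
have fH : finite_set H by apply: finite_setD; exact: lfS.
have d0 : (0 < d)%N by rewrite (leq_ltn_trans _ (ltn_ord i)).
have Hr z : H z -> r < enorm (z - x).
  by move=> [[Sz zs] nz]; rewrite ltNge; apply/negP => zr; apply: nz.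
pose u z := kern i (z - x) * r ^+ d.+1.
have uM z : H z -> `|u z| <= M%:R.
  move=> /Hr Hz; rewrite /u normrM (ger0_norm (exprn_ge0 _ (ltW r0))).
  rewrite (le_trans (ler_wpM2r _ (kern_le_inv i r0 (ltW Hz)))) ?exprn_ge0 ?(ltW r0)//.
  rewrite -rM le_eqVlt; apply/orP; left; apply/eqP.
  rewrite (_ : d.+1 = (d.-1 + 2)%N); last by lia.
  by rewrite exprD mulrA mulVf ?mul1r// expf_neq0// gt_eqF.
have uE b l z : H z -> (l%:R <= (-1) ^+ b * u z)
    = (l%:R * enorm (z - x) ^+ d <= (-1) ^+ b * (z - x) ord0 i * r ^+ d.+1).
  move=> /Hr Hz; rewrite -ler_pdivlMr ?exprn_gt0 ?(lt_trans r0)//.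
  by congr (_ <= _); rewrite /u /kern; ring.
have level b l : card (S `&` level_set x i r b s l)
    = fsum H (fun z => (l%:R <= (-1) ^+ b * u z)%R%:R) :> R.
  rewrite fsum_indicator//; congr card; apply/seteqP; split => z.
    move=> [Sz [rz zs zl]].
    have Hz : H z by split; [split|move=> [_ /=]; rewrite leNgt rz].
    by split => //=; rewrite uE.
  move=> [Hz /=]; rewrite uE// => zl; have [[Sz zs] _] := Hz.
  by split => //; split => //; exact: Hr.
have -> : fsum H (fun z => kern i (z - x)) = fsum H u / r ^+ d.+1.
  rewrite mulrC -fsumZ; apply: eq_fsum => // z _.
  by rewrite /u mulrCA mulVf ?mulr1// expf_neq0// gt_eqF.
rewrite normrM (ger0_norm (x := _^-1)) ?invr_ge0 ?exprn_ge0 ?(ltW r0)//.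
rewrite ler_wpM2r ?invr_ge0 ?exprn_ge0 ?(ltW r0)//.
pose f z : R := \sum_(l < M) (l.+1%:R <= u z)%R%:R - \sum_(l < M) (l.+1%:R <= - u z)%R%:R.
have -> : fsum H u = fsum H f + fsum H (fun z => u z - f z).
  by rewrite -fsumD; apply: eq_fsum => // z _; rewrite addrC subrK.
rewrite (le_trans (ler_normD _ _))// lerD//; last first.
  rewrite -[leRHS]mul1r ler_fsum_card// => z Hz; exact: level_count_error (uM _ Hz).
have -> : fsum H f = \sum_(l < M) (card (S `&` level_set x i r false s l.+1)
    - card (S `&` level_set x i r true s l.+1)).
  rewrite sumrB fsumB; congr (_ - _).
    rewrite [LHS]exchange_big/=; apply: eq_bigr => l _; rewrite level.
    by apply: eq_fsum => // z _; rewrite expr0 mul1r.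
  rewrite [LHS]exchange_big/=; apply: eq_bigr => l _; rewrite level.
  by apply: eq_fsum => // z _; rewrite expr1 mulN1r.
rewrite (le_trans (ler_norm_sum _ _ _))// rM mulrC.
rewrite (le_trans (ler_sum _ (fun l _ => Hc _ (ltn_ord l))))//.
by rewrite sumr_const card_ord mulr_natr.
Qed.

End shell_sums.

Section balanced_sets.
Context {R : realType} {d : nat}.
Implicit Types (S : set 'rV[R]_d) (x : 'rV[R]_d) (v r : R).

(* At radius [r = 16 ^ k] this is [r ^ (d - 1) / 2 ^ k]; it exceeds the standard
   deviation [r ^ (d / 2)] of the counts by a power of [2 ^ k] as [d >= 3]. *)
Definition discrepancy (k : nat) : R := (2 ^+ k) ^+ (4 * d - 5).

(** Integer squared radii and levels leave polynomially many sets in [2 ^ k]. The factor 2 makes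
    room for the integer following [r ^+ 2] when [r] reaches [16 ^ k.+1]. *)
Definition balanced v S x k :=
  (forall n, (0 < n <= 2 * 256 ^ k.+1)%N ->
    `|card (pts S x (Num.sqrt n%:R)) - v * Num.sqrt n%:R ^+ d| <= discrepancy k) /\
  (forall (i : 'I_d) n l, (n <= 2 * 256 ^ k.+1)%N -> (l <= 256 ^ k)%N ->
    `|card (S `&` level_set x i (16 ^+ k) false (Num.sqrt n%:R) l)
      - card (S `&` level_set x i (16 ^+ k) true (Num.sqrt n%:R) l)|
    <= 2 * discrepancy k).

Lemma pow16_ge k : 2 ^+ k <= 16 ^+ k :> R.
Proof. by apply: lerXn2r; rewrite ?nnegrE//; lra. Qed.

Lemma pow16_sqr k : (16 ^+ k) ^+ 2 = (256 ^ k)%:R :> R.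
Proof. by rewrite natrX -exprM mulnC exprM; congr (_ ^+ _); rewrite expr2 -natrM. Qed.

Lemma discrepancy_le k r : (3 <= d)%N -> 16 ^+ k <= r ->
  discrepancy k <= r ^+ d.-1 / 2 ^+ k.
Proof.
move=> d3 kr; rewrite ler_pdivlMr ?exprn_gt0// /discrepancy -exprSr.
rewrite (_ : (4 * d - 5).+1 = (4 * d.-1)%N); last by lia.
rewrite exprM [X in X ^+ _](_ : _ = 16 ^+ k).
  by apply: lerXn2r; rewrite ?nnegrE ?exprn_ge0 ?(le_trans _ kr).
by rewrite -exprM mulnC exprM; congr (_ ^+ _); rewrite -natrX.
Qed.

(** [r ^+ 2] lies between the consecutive integers [n] and [n + 1]: rounding the squared radius
    costs a shell of thickness at most [1 / r]. *)
Lemma sqrt_near r (n := Num.truncn (r ^+ 2)) : 1 <= r ->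
  [/\ (0 < n)%N, Num.sqrt n%:R <= r, r <= Num.sqrt n.+1%:R,
      Num.sqrt n.+1%:R <= 2 * r &
      (Num.sqrt n.+1%:R - r) * r <= 1 /\ (r - Num.sqrt n%:R) * r <= 1].
Proof.
move=> r1; have r0 : 0 <= r by lra.
have /andP[n1 n2] := truncn_itv (sqr_ge0 r); rewrite -/n in n1 n2.
have n0 : (0 < n)%N by rewrite /n (truncn_ge_nat 1 (sqr_ge0 r)) exprn_ege1.
have ar : Num.sqrt n%:R <= r by rewrite -[leRHS]ger0_norm// -sqrtr_sqr ler_wsqrtr.
have rb : r <= Num.sqrt n.+1%:R.
  by rewrite -[leLHS]ger0_norm// -sqrtr_sqr ler_wsqrtr// ltW.
have a2 : Num.sqrt n%:R ^+ 2 = n%:R :> R by rewrite sqr_sqrtr.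
have b2 : Num.sqrt n.+1%:R ^+ 2 = n%:R + 1 :> R by rewrite sqr_sqrtr// natr1.
have a0 : 0 <= Num.sqrt n%:R :> R by exact: sqrtr_ge0.
have {}n2 : r ^+ 2 < n%:R + 1 by rewrite natr1.
have rr : 1 <= r ^+ 2 by rewrite exprn_ege1.
split => //; last split.
- rewrite -[leRHS]ger0_norm; last by lra.
  by rewrite -sqrtr_sqr ler_wsqrtr// -natr1; lra.
- have : 0 <= (Num.sqrt n.+1%:R - r) * Num.sqrt n.+1%:R.
    by rewrite mulr_ge0 ?subr_ge0// sqrtr_ge0.
  by move: n%:R (Num.sqrt n.+1%:R) b2 n1 => m b ? ? ?; lra.
- have : 0 <= (r - Num.sqrt n%:R) * Num.sqrt n%:R.
    by rewrite mulr_ge0 ?subr_ge0.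
  by move: n%:R (Num.sqrt n%:R) a2 n2 => m b ? ? ?; lra.
Qed.

(** Counts are monotone in the radius, which can thus be rounded to either side; the volume gained
    or lost is of order [r ^ (d - 1) / r], and [r >= 16 ^ k >= 2 ^ k]. *)
Lemma balanced_count v S x k r : (3 <= d)%N -> 0 <= v -> locally_finite S ->
  balanced v S x k -> 16 ^+ k <= r <= 16 ^+ k.+1 ->
  `|card (pts S x r) - v * r ^+ d| <= (v * d%:R * 2 ^+ d + 1) * (r ^+ d.-1 / 2 ^+ k).
Proof.
move=> d3 v0 lfS [bal _] /andP[kr rk].
have r1 : 1 <= r by rewrite (le_trans _ kr)// exprn_ege1// ler1n.
have r0 : 0 < r by lra.
have [] := sqrt_near r1; set n := Num.truncn _; set a := Num.sqrt n%:R.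
set b := Num.sqrt n.+1%:R => n0 ar rb b2r [br ra].
have nk : (n <= 256 ^ k.+1)%N.
  rewrite -(ler_nat R) -pow16_sqr (le_trans (y := r ^+ 2))//.
    by rewrite /n truncn_le sqr_ge0.
  by apply: lerXn2r; rewrite ?nnegrE ?exprn_ge0 ?(ltW r0).
have a0 : 0 <= a by exact: sqrtr_ge0.
have Ha := bal n; have Hb := bal n.+1; rewrite -/a -/b in Ha Hb.
have {}Ha : `|card (pts S x a) - v * a ^+ d| <= discrepancy k.
  by apply: Ha; rewrite n0 (leq_trans nk)// leq_pmull.
have {}Hb : `|card (pts S x b) - v * b ^+ d| <= discrepancy k.
  by apply: Hb; rewrite ltn0Sn mul2n -addnn -addn1 leq_add// expn_gt0.
have disc := discrepancy_le d3 kr; set e := _ / _ in disc *.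
have q0 : 0 < 2 ^+ k :> R by rewrite exprn_gt0.
have qr : r^-1 <= (2 ^+ k)^-1.
  by rewrite lef_pV2 ?posrE// (le_trans (pow16_ge k)).
have cab : card (pts S x a) <= card (pts S x r) :> R /\
    card (pts S x r) <= card (pts S x b) :> R.
  by split; apply: le_card => //; apply: sub_pts; rewrite subrr enorm0 add0r.
have rd0 : 0 <= r ^+ d.-1 by rewrite exprn_ge0 ?ltW.
have e0 : 0 <= e by rewrite divr_ge0// ltW.
have bd : b ^+ d - r ^+ d <= d%:R * 2 ^+ d * e.
  apply: (le_trans (lerB_exp d (ltW r0) rb)); rewrite -!mulrA ler_wpM2l//.
  have brr : b - r <= r^-1 by rewrite -[leRHS]mul1r ler_pdivlMr.
  apply: (@le_trans _ _ ((2 ^+ k)^-1 * (2 * r) ^+ d.-1)).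
    apply: ler_pM => //; rewrite ?subr_ge0 ?exprn_ge0 ?(le_trans _ rb) ?(ltW r0)//.
      exact: le_trans qr.
    by apply: lerXn2r => //; rewrite ?nnegrE ?(le_trans _ rb) ?(ltW r0)//; lra.
  by rewrite exprMn mulrCA [_^-1 * _]mulrC ler_wpM2r// ler_weXn2l ?ler1n// leq_pred.
have ad : r ^+ d - a ^+ d <= d%:R * 2 ^+ d * e.
  apply: (le_trans (lerB_exp d a0 ar)); rewrite -!mulrA ler_wpM2l//.
  have arr : r - a <= r^-1 by rewrite -[leRHS]mul1r ler_pdivlMr.
  apply: (@le_trans _ _ ((2 ^+ k)^-1 * r ^+ d.-1)).
    by rewrite ler_wpM2r// (le_trans arr).
  by rewrite [_^-1 * _]mulrC -/e ler_peMl// exprn_ege1// ler1n.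
move: Ha Hb cab (ler_wpM2l v0 bd) (ler_wpM2l v0 ad) disc.
rewrite !ler_norml !mulrBr mulrDl mul1r !mulrA.
move: (v * d%:R * 2 ^+ d * e) (v * _) (v * _) (v * _) (discrepancy k) => t1 t2 t3 t4 t5.
move: (card _) (card _) (card _) => c1 c2 c3.
by move=> /andP[? ?] /andP[? ?] [? ?] ? ? ?; apply/andP; split; lra.
Qed.

End balanced_sets.

Section balanced_sums.
Context {R : realType} {d : nat}.
Variables (S : set 'rV[R]_d) (x : 'rV[R]_d) (v : R).
Hypotheses (d3 : (3 <= d)%N) (v0 : 0 <= v) (lfS : locally_finite S).

Let c1 := v * d%:R * 2 ^+ d + 1.
(** The shell up to the rounded radius costs [2 + (v + c1) 16^d]; the remaining [3 c1 16^d] pays for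
    the points between the rounded radius and the radius itself. *)
Let c2 := 2 + (v + 4 * c1) * 16 ^+ d.

Lemma balanced_shell (i : 'I_d) k r : balanced v S x k ->
  16 ^+ k <= r <= 16 ^+ k.+1 ->
  `|fsum (pts S x r) (fun z => kern i (z - x))
    - fsum (pts S x (16 ^+ k)) (fun z => kern i (z - x))| <= c2 / 2 ^+ k.
Proof.
move=> bal /andP[kr rk]; pose t : R := 16 ^+ k.
have t1 : 1 <= t by rewrite exprn_ege1// ler1n.
have t0 : 0 < t by rewrite (lt_le_trans ltr01).
have r1 : 1 <= r by rewrite (le_trans t1).
have r0 : 0 < r by rewrite (lt_le_trans ltr01).
have q0 : 0 < 2 ^+ k :> R by rewrite exprn_gt0.
have [] := sqrt_near r1; set n := Num.truncn _; set a := Num.sqrt n%:R.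
move=> n0 ar _ _ [_ ra].
have a0 : 0 <= a by exact: sqrtr_ge0.
have nk : (n <= 2 * 256 ^ k.+1)%N.
  apply: (@leq_trans (256 ^ k.+1)); last by rewrite leq_pmull.
  rewrite -(ler_nat R) -pow16_sqr (le_trans (y := r ^+ 2))//.
    by rewrite /n truncn_le sqr_ge0.
  by apply: lerXn2r; rewrite ?nnegrE ?exprn_ge0 ?(ltW r0).
have ta : t <= a.
  rewrite -[leLHS](ger0_norm (ltW t0)) -sqrtr_sqr ler_wsqrtr// /t pow16_sqr ler_nat.
  rewrite /n truncn_ge_nat ?sqr_ge0// -pow16_sqr.
  by apply: lerXn2r; rewrite ?nnegrE ?exprn_ge0 ?(ltW r0).
have c1_ge1 : 1 <= c1 by rewrite /c1 lerDr !mulr_ge0// exprn_ge0.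
have rt : r <= 16 * t by rewrite /t -exprS.
have rdt : r ^+ d.-1 <= 16 ^+ d * t ^+ d.-1.
  rewrite (@le_trans _ _ ((16 * t) ^+ d.-1))//.
    by apply: lerXn2r; rewrite ?nnegrE ?(ltW r0)// (le_trans (ltW r0)).
  by rewrite exprMn ler_wpM2r ?exprn_ge0 ?(ltW t0)// ler_weXn2l ?ler1n// leq_pred.
have Cr : card (pts S x r) <= (v + c1) * 16 ^+ d * t ^+ d.
  have /ler_normlP[_] := balanced_count d3 v0 lfS bal (introT andP (conj kr rk)).
  rewrite lerBlDr -/c1 => /le_trans; apply.
  have rdt' : r ^+ d <= 16 ^+ d * t ^+ d.
    by rewrite -exprMn; apply: lerXn2r; rewrite ?nnegrE ?(ltW r0)// (le_trans (ltW r0)).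
  have rr : r ^+ d.-1 / 2 ^+ k <= r ^+ d.
    rewrite ler_pdivrMr// -[leLHS]mulr1; apply: ler_pM => //.
    - by rewrite exprn_ge0// ltW.
    - by rewrite ler_weXn2l// leq_pred.
    - by rewrite exprn_ege1// ler1n.
  rewrite [leRHS](_ : _ = c1 * (16 ^+ d * t ^+ d) + v * (16 ^+ d * t ^+ d));
    last by ring.
  apply: lerD; apply: ler_wpM2l => //; first by rewrite (le_trans _ c1_ge1).
  exact: le_trans rdt'.
have Cra : card (pts S x r) - card (pts S x a) <= 3 * c1 * 16 ^+ d * (t ^+ d.-1 / 2 ^+ k).
  have /ler_normlP[_] := balanced_count d3 v0 lfS bal (introT andP (conj kr rk)).
  have ak : 16 ^+ k <= a <= 16 ^+ k.+1 by rewrite ta (le_trans ar).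
  have /ler_normlP[] := balanced_count d3 v0 lfS bal ak; rewrite -/c1.
  have ad : v * (r ^+ d - a ^+ d) <= c1 * (r ^+ d.-1 / 2 ^+ k).
    have arr : r - a <= (2 ^+ k)^-1.
      apply: (@le_trans _ _ r^-1); first by rewrite -[leRHS]mul1r ler_pdivlMr.
      by rewrite lef_pV2 ?posrE// (le_trans _ kr)// pow16_ge.
    have rd0 : 0 <= r ^+ d.-1 by rewrite exprn_ge0// ltW.
    apply: (@le_trans _ _ (v * (d%:R * (2 ^+ k)^-1 * r ^+ d.-1))).
      rewrite ler_wpM2l// (le_trans (lerB_exp d a0 ar))//.
      by rewrite ler_wpM2r// ler_wpM2l.
    rewrite (_ : v * _ = v * d%:R * (r ^+ d.-1 / 2 ^+ k)); last by ring.
    rewrite ler_wpM2r ?divr_ge0 ?(ltW q0)//.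
    by rewrite /c1 ler_wpDr// ler_peMr ?mulr_ge0// exprn_ege1// ler1n.
  have aa : c1 * (a ^+ d.-1 / 2 ^+ k) <= c1 * (r ^+ d.-1 / 2 ^+ k).
    apply: ler_wpM2l; first by rewrite (le_trans _ c1_ge1).
    rewrite ler_wpM2r ?invr_ge0 ?(ltW q0)//.
    by apply: lerXn2r; rewrite ?nnegrE ?(ltW r0).
  have tt : c1 * (r ^+ d.-1 / 2 ^+ k) <= c1 * (16 ^+ d * t ^+ d.-1 / 2 ^+ k).
    apply: ler_wpM2l; first by rewrite (le_trans _ c1_ge1).
    by rewrite ler_wpM2r ?invr_ge0 ?(ltW q0).
  move: ad aa tt.
  rewrite (_ : 3 * c1 * _ * _ = 3 * (c1 * (16 ^+ d * t ^+ d.-1 / 2 ^+ k))); last by ring.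
  rewrite mulrBr; move: (c1 * _) (c1 * _) (c1 * _) (v * _) (v * _) => e1 e2 e3 e4 e5.
  by move: (card _) (card _) => f1 f2; lra.
have Ht : fsum (pts S x a) (fun z => kern i (z - x))
      - fsum (pts S x t) (fun z => kern i (z - x))
    = fsum (pts S x a `\` pts S x t) (fun z => kern i (z - x)).
  rewrite (@fsumID _ _ (pts S x t) (pts S x a))//; first by rewrite addrC addKr.
  by apply: sub_pts; rewrite subrr enorm0 add0r.
have Ha : `|fsum (pts S x r) (fun z => kern i (z - x))
      - fsum (pts S x a) (fun z => kern i (z - x))|
    <= 3 * c1 * 16 ^+ d / 2 ^+ k.
  apply: (le_trans (@fsum_between _ _ _ _ (pts S x r) _ (t ^- d.-1) _ _ _ _ _)) => //.
  - by apply: sub_pts; rewrite subrr enorm0 add0r.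
  - move=> z [Sz zr] za; apply: kern_le_inv => //; rewrite leNgt; apply/negP => zt.
    by apply: za; split => //=; rewrite (le_trans (ltW zt)).
  - by rewrite invr_ge0 exprn_ge0// ltW.
  rewrite mulrC ler_pdivrMr ?exprn_gt0//.
  by apply: (le_trans Cra); rewrite le_eqVlt; apply/orP; left; apply/eqP; ring.
have Hs : `|fsum (pts S x a `\` pts S x t) (fun z => kern i (z - x))|
    <= (2 + (v + c1) * 16 ^+ d) / 2 ^+ k.
  apply: (le_trans (shell_sum_le lfS t0 (pow16_sqr k) (fun l lk => bal.2 i n l nk lk))).
  have disc := discrepancy_le d3 (lexx (16 ^+ k : R)); rewrite -/t in disc.
  have tE : t ^+ d.+1 = t ^+ 2 * t ^+ d.-1 by rewrite -exprD add2n prednK ?(leq_trans _ d3).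
  rewrite ler_pdivrMr ?exprn_gt0//.
  rewrite [leRHS](_ : _ = 2 / 2 ^+ k * t ^+ d.+1
    + (v + c1) * 16 ^+ d / 2 ^+ k * t ^+ d.+1); last by ring.
  apply: lerD.
    rewrite (_ : 2 / 2 ^+ k * _ = t ^+ 2 * (2 * (t ^+ d.-1 / 2 ^+ k))); last by rewrite tE; ring.
    by rewrite ler_wpM2l ?exprn_ge0 ?(ltW t0)// ler_wpM2l.
  apply: (@le_trans _ _ (card (pts S x r))).
    apply: le_card => // z [[Sz za] _]; split => //=; exact: le_trans ar.
  apply: (le_trans Cr).
  rewrite [leRHS](_ : _ = (v + c1) * 16 ^+ d * t ^+ d * (t / 2 ^+ k));
    last by rewrite exprS; ring.
  apply: ler_peMr; last by rewrite ler_pdivlMr// mul1r pow16_ge.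
  have c10 : 0 <= v + c1 by rewrite addr_ge0 // (le_trans _ c1_ge1).
  by apply: mulr_ge0; [apply: mulr_ge0 => //; exact: exprn_ge0|rewrite exprn_ge0 ?(ltW t0)].
rewrite -/t (_ : fsum _ _ - _ = (fsum (pts S x r) (fun z => kern i (z - x))
   - fsum (pts S x a) (fun z => kern i (z - x))) + (fsum (pts S x a) (fun z => kern i (z - x))
   - fsum (pts S x t) (fun z => kern i (z - x)))); last by ring.
rewrite (le_trans (ler_normD _ _))// Ht (le_trans (lerD Ha Hs))// -mulrDl /c2.
by rewrite ler_wpM2r ?invr_ge0 ?(ltW q0)// le_eqVlt; apply/orP; left; apply/eqP; ring.
Qed.

Lemma pow16_level K (r : R) : 16 ^+ K <= r ->
  exists k, (K <= k)%N /\ 16 ^+ k <= r <= 16 ^+ k.+1.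
Proof.
move=> Kr; have [M rM] : exists M, r <= 16 ^+ (K + M).
  have [m rm] := expr2n_unbounded r; exists m.
  by rewrite (le_trans rm)// (le_trans (pow16_ge m))// ler_weXn2l ?ler1n// leq_addl.
elim: M rM => [rM|M IH rM].
  by exists K; split => //; rewrite Kr (le_trans rM)// addn0 ler_weXn2l ?ler1n.
have [/IH //|Mr] := leP r (16 ^+ (K + M)).
by exists (K + M)%N; rewrite leq_addr (ltW Mr) -addnS rM.
Qed.

Lemma half_pow_small (c eps : R) : 0 <= c -> 0 < eps ->
  exists K, forall k, (K <= k)%N -> c / 2 ^+ k <= eps.
Proof.
move=> c0 eps0; have [K cK] := expr2n_unbounded (c / eps); exists K => k Kk.
rewrite ler_pdivrMr ?exprn_gt0// mulrC -ler_pdivrMr// (le_trans cK)//.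
by rewrite ler_weXn2l ?ler1n.
Qed.

(** Complete shells telescope to a geometric series with sum at most [2 c2 / 2 ^ K]; the last,
    incomplete shell adds at most [c2 / 2 ^ K]. *)
Lemma balanced_far (i : 'I_d) K (r : R) : (forall k, (K <= k)%N -> balanced v S x k) ->
  16 ^+ K <= r ->
  `|fsum (pts S x r) (fun z => kern i (z - x))
    - fsum (pts S x (16 ^+ K)) (fun z => kern i (z - x))| <= 3 * c2 / 2 ^+ K.
Proof.
move=> bal Kr; pose t r := fsum (pts S x r) (fun z => kern i (z - x)).
have shell k r' : (K <= k)%N -> 16 ^+ k <= r' <= 16 ^+ k.+1 ->
    `|t r' - t (16 ^+ k)| <= c2 / 2 ^+ k.
  by move=> Kk kr; apply: balanced_shell => //; exact: bal.
have tele m : `|t (16 ^+ (K + m)) - t (16 ^+ K)|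
    <= 2 * (c2 / 2 ^+ K) - 2 * (c2 / 2 ^+ (K + m)).
  elim: m => [|m IH]; first by rewrite addn0 !subrr normr0.
  have := shell (K + m)%N (16 ^+ (K + m).+1) (leq_addr _ _).
  rewrite lexx ler_weXn2l ?ler1n// => /(_ isT); rewrite addnS.
  have -> : c2 / 2 ^+ (K + m).+1 = 2^-1 * (c2 / 2 ^+ (K + m)).
    by rewrite exprS invfM; ring.
  move: IH; rewrite !ler_norml.
  move: (c2 / _) (c2 / _) (t _) (t _) (t _) => a b t1 t2 t3.
  by move=> /andP[? ?] /andP[? ?]; apply/andP; split; lra.
have [k [Kk kr]] := pow16_level Kr.
have := tele (k - K)%N; rewrite subnKC// => te; have sh := shell _ _ Kk kr.
have c20 : 0 <= c2.
  have := le_trans (normr_ge0 _) sh; rewrite pmulr_lge0// invr_gt0 exprn_gt0//.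
have ck : 0 <= c2 / 2 ^+ k by rewrite divr_ge0// exprn_ge0.
have cK : c2 / 2 ^+ k <= c2 / 2 ^+ K.
  by rewrite ler_wpM2l// lef_pV2 ?posrE ?exprn_gt0// ler_weXn2l ?ler1n.
rewrite -/(t r) -/(t (16 ^+ K)) -mulrA.
move: te sh ck cK; rewrite !ler_norml.
move: (c2 / _) (c2 / _) (t _) (t _) (t _) => a b t1 t2 t3.
by move=> /andP[? ?] /andP[? ?] ? ?; apply/andP; split; lra.
Qed.

Lemma balanced_regular : (exists K, forall k, (K <= k)%N -> balanced v S x k) ->
  ball_count v S x /\ ball_sums_cauchy S x.
Proof.
move=> [K0 bal]; split => [eps eps0|i eps eps0].
  have c10 : 0 <= c1 by rewrite addr_ge0// !mulr_ge0// exprn_ge0.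
  have [K1 K1P] := half_pow_small c10 eps0.
  exists (16 ^+ maxn K0 K1) => r /pow16_level[k []].
  rewrite geq_max => /andP[K0k K1k] kr.
  apply: (le_trans (balanced_count d3 v0 lfS (bal _ K0k) kr)); rewrite -/c1.
  rewrite (_ : c1 * _ = c1 / 2 ^+ k * r ^+ d.-1); last by ring.
  rewrite ler_wpM2r ?K1P// exprn_ge0// (le_trans _ (andP kr).1)// exprn_ge0.
have c20 : 0 <= 6 * c2.
  have := le_trans (normr_ge0 _) (balanced_far i bal (lexx _)).
  by rewrite pmulr_lge0 ?invr_gt0 ?exprn_gt0//; lra.
have [K1 K1P] := half_pow_small c20 eps0.
set K := maxn K0 K1.
have balK k : (K <= k)%N -> balanced v S x k.
  by move=> Kk; apply: bal; rewrite (leq_trans _ Kk)// leq_maxl.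
exists (16 ^+ K) => r s /(balanced_far i balK) rK /(balanced_far i balK) sK.
have := K1P K (leq_maxr _ _); move: rK sK.
rewrite (_ : 6 * c2 / _ = 2 * (3 * c2 / 2 ^+ K)); last by ring.
rewrite !ler_norml; move: (3 * c2 / _) (fsum _ _) (fsum _ _) (fsum _ _) => a b1 b2 b3.
by move=> /andP[? ?] /andP[? ?] ?; apply/andP; split; lra.
Qed.

End balanced_sums.

(** * Almost sure regularity of the Poisson process *)

Section poisson_regular.
Context {disp : measure_display} {T : measurableType disp} {R : realType}.
Context {P : probability T R} {d : nat} {Z : T -> set 'rV[R]_d}.
Hypotheses (Z_poisson : standard_poisson_process P Z) (d3 : (3 <= d)%N).

Let v0 := unit_ball_volume R d.

Lemma borel_level_set (x : 'rV[R]_d) i r b s l : borel (level_set x i r b s l).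
Proof.
rewrite (_ : level_set _ _ _ _ _ _ = (~` cball x r `&` cball x s) `&`
  [set z | l%:R * enorm (z - x) ^+ d <= (-1) ^+ b * (z - x) ord0 i * r ^+ d.+1]); last first.
  apply/seteqP; split => z; rewrite /cball/=.
    by move=> [rz zs zl]; split => //; split => //=; apply/negP; rewrite -ltNge.
  by move=> [[/= /negP]]; rewrite -ltNge.
apply: (@measurableI _ (borelType R d)).
  apply: (@measurableI _ (borelType R d)); last exact: borel_cball.
  by apply: (@measurableC _ (borelType R d)); exact: borel_cball.
apply: closed_borel; apply: le_continuous_closed.
  have cE : continuous (fun z : 'rV[R]_d => enorm (z - x) ^+ d).
    move=> z.
    apply: (@continuous_comp _ _ _ (fun z : 'rV[R]_d => enorm (z - x)) (fun y : R => y ^+ d)).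
      exact: enormB_continuous.
    exact: exprn_continuous.
  move=> z; apply: (@continuous_comp _ _ _ (fun z : 'rV[R]_d => enorm (z - x) ^+ d)
    (fun y : R => l%:R * y)).
    exact: cE.
  exact: mulrl_continuous.
have cC : continuous (fun z : 'rV[R]_d => (z - x) ord0 i).
  move=> z.
  apply: (@continuous_comp _ _ _ (fun z : 'rV[R]_d => z - x) (fun y : 'rV[R]_d => y ord0 i)).
    by apply: continuousB; [exact: cvg_id|exact: cst_continuous].
  exact: coord_continuous.
move=> z; apply: (@continuous_comp _ _ _ (fun z : 'rV[R]_d => (z - x) ord0 i)
  (fun y : R => (-1) ^+ b * y * r ^+ d.+1)).
  exact: cC.
apply: (@continuous_comp _ _ _ (fun y : R => (-1) ^+ b * y) (fun y : R => y * r ^+ d.+1)).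
  exact: mulrl_continuous.
exact: mulrr_continuous.
Qed.

Lemma level_set_sub (x : 'rV[R]_d) i r b s l : level_set x i r b s l `<=` cball x s.
Proof. by move=> z []. Qed.

Lemma volume_level_set (x : 'rV[R]_d) i r s l :
  volume (level_set x i r true s l) = volume (level_set x i r false s l).
Proof.
rewrite -[RHS](volume_reflect (x + x) (borel_level_set _ _ _ _ _ _)); congr volume.
apply/seteqP; split => z; rewrite /level_set/= (_ : x + x - z - x = - (z - x)).
all: rewrite ?enormN ?mxE ?expr0 ?expr1 ?mulN1r ?mul1r//.
all: by rewrite opprB addrAC addrK.
Qed.

Lemma sqrt_pow256 k n : (n <= 2 * 256 ^ k.+1)%N -> Num.sqrt n%:R <= 32 * 16 ^+ k :> R.
Proof.
move=> nk; rewrite -[leRHS]ger0_norm ?mulr_ge0 ?exprn_ge0// -sqrtr_sqr ler_wsqrtr//.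
rewrite exprMn pow16_sqr -natrX -natrM ler_nat (leq_trans nk)// expnS mulnA.
by rewrite leq_mul2r orbT.
Qed.

Lemma volume_cball_scale (x : 'rV[R]_d) k s : s <= 32 * 16 ^+ k ->
  (volume (cball x s) <= (v0 * 32 ^+ d * (2 ^+ k) ^+ (4 * d))%:E)%E.
Proof.
move=> sk; have r0 : 0 < 32 * 16 ^+ k :> R by rewrite mulr_gt0// exprn_gt0.
apply: (@le_trans _ _ (volume (cball x (32 * 16 ^+ k)))).
  apply: le_volume; [exact: borel_cball|exact: borel_cball|].
  by move=> z /= zs; exact: le_trans sk.
rewrite volume_cball// -/v0 lee_fin exprMn mulrA le_eqVlt; apply/orP; left.
apply/eqP; congr (_ * _); rewrite exprM; congr (_ ^+ _).
by rewrite -exprM mulnC exprM; congr (_ ^+ _); rewrite -natrX.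
Qed.

Lemma pow2_16 k : (2 ^+ k) ^+ 16 = ((256 ^ k) ^ 2)%:R :> R.
Proof.
rewrite !natrX (_ : 256%:R = 2 ^+ 8 :> R); last by rewrite -natrX.
by rewrite -!exprM; congr (_ ^+ _); lia.
Qed.

(** Counts the signs, coordinates, squared radii and levels at scale [k], with [m = 256 ^ k]; 2052 =
    2 * 513 * 2. *)
Lemma level_index_card m : (0 < m)%N ->
  (2 * d * (2 * (256 * m)).+1 * m.+1 <= 2052 * d * m ^ 2)%N.
Proof.
move=> m0; have h1 : ((2 * (256 * m)).+1 <= 513 * m)%N by lia.
have h2 : (m.+1 <= 2 * m)%N by lia.
by rewrite (leq_trans (leq_mul (leq_mul (leqnn _) h1) h2))// leq_eqVlt; apply/orP; left; lia.
Qed.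

Lemma balanced_ae (x : 'rV[R]_d) :
  {ae P, forall w, exists K, forall k, (K <= k)%N -> balanced v0 (Z w) x k}.
Proof.
(* The shift by one keeps the radius positive, as [volume_cball] needs; there are
   [2 * 256 ^ k.+1 = 512 * (2 ^ k) ^ 8] balls. *)
pose A1 k (j : 'I_(2 * 256 ^ k.+1)) := cball x (Num.sqrt j.+1%:R).
have A1P : {ae P, forall w, exists K, forall k, (K <= k)%N -> forall j : 'I_(2 * 256 ^ k.+1),
    `|@count _ _ R d Z (A1 k j) w - fine (volume (A1 k j))| <= (2 ^+ k) ^+ (4 * d - 5)}.
  apply: (@discrepancy_ae _ _ _ _ _ _ Z_poisson (fun k => 'I_(2 * 256 ^ k.+1)) A1
    512 (v0 * 32 ^+ d) 8 d3).
  - by move=> k j; exact: borel_cball.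
  - by move=> k j; exact: bounded_cball.
  - by move=> k j; apply: volume_cball_scale; apply: sqrt_pow256; exact: ltn_ord.
  - move=> k; rewrite card_ord natrM expnS natrM natrX mulrA -natrM.
    rewrite le_eqVlt; apply/orP; left; apply/eqP; congr (_ * _).
    by rewrite -exprM mulnC exprM; congr (_ ^+ _); rewrite -natrX.
pose A2 k (j : bool * 'I_d * 'I_(2 * 256 ^ k.+1).+1 * 'I_(256 ^ k).+1) :=
  level_set x j.1.1.2 (16 ^+ k) j.1.1.1 (Num.sqrt (j.1.2 : nat)%:R) j.2.
have A2P : {ae P, forall w, exists K, forall k, (K <= k)%N -> forall j,
    `|@count _ _ R d Z (A2 k j) w - fine (volume (A2 k j))| <= (2 ^+ k) ^+ (4 * d - 5)}.
  apply: (@discrepancy_ae _ _ _ _ _ _ Z_poisson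
    (fun k => (bool * 'I_d * 'I_(2 * 256 ^ k.+1).+1 * 'I_(256 ^ k).+1)%type) A2
    (2052 * d%:R) (v0 * 32 ^+ d) 16 d3).
  - by move=> k j; exact: borel_level_set.
  - move=> k j; have [M [Mr MP]] := @bounded_cball R d x (Num.sqrt (j.1.2 : nat)%:R).
    by exists M; split => // N MN z [_ zn _]; exact: MP.
  - move=> k j; apply: le_trans (volume_cball_scale x (sqrt_pow256 (ltn_ord j.1.2))).
    apply: le_volume; [exact: borel_level_set|exact: borel_cball|exact: level_set_sub].
  - move=> k; rewrite !card_prod card_bool !card_ord.
    have p0 : (0 < 256 ^ k)%N by rewrite expn_gt0.
    rewrite pow2_16 expnS -!natrM ler_nat; exact: level_index_card.
apply: filterS2 A1P A2P => w [K1 K1P] [K2 K2P]; exists (maxn K1 K2) => k.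
rewrite geq_max => /andP[K1k K2k]; split.
  case=> // n /andP[_ nk]; have := K1P k K1k (Ordinal nk).
  by rewrite /A1/= volume_cball// sqrtr_gt0.
move=> i n l nk lk.
pose j (b : bool) := (b, i, Ordinal (nk : (n < (2 * 256 ^ k.+1).+1)%N),
  Ordinal (lk : (l < (256 ^ k).+1)%N)).
(* The two level sets have equal volumes, so both counts are within one discrepancy of the same
   mean. *)
apply: ler_dist2 (K2P k K2k (j false)) _.
by have := K2P k K2k (j true); rewrite /A2/= volume_level_set.
Qed.

Lemma regular_ae : {ae P, forall w, regular v0 (Z w)}.
Proof.
have lf w : locally_finite (Z w).
  move=> x r; apply: (spp_locally_finite Z_poisson); exact: bounded_cball.
have : {ae P, forall w n, forall q : 'rV[rat]_d, unpickle n = Some q ->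
    ball_count v0 (Z w) (ratv R q) /\ ball_sums_cauchy (Z w) (ratv R q)}.
  apply/ae_foralln => n; case: (unpickle n : option 'rV[rat]_d) => [q|]; last first.
    by apply: filterE.
  apply: filterS (balanced_ae (ratv R q)) => w bal _ [<-].
  apply: balanced_regular => //; exact/ltW/unit_ball_volume_gt0.
apply: filterS => w rw.
have rq q : ball_count v0 (Z w) (ratv R q) /\ ball_sums_cauchy (Z w) (ratv R q).
  by apply: (rw (pickle q)); rewrite pickleK.
by split; [exact: lf|exact: unit_ball_volume_gt0| |]; move=> q; have [] := rq q.
Qed.

End poisson_regular.

(** * Translation invariance *)

Section cell_law.
Context {disp : measure_display} {T : measurableType disp} {R : realType}.
Context {P : probability T R} {d : nat} {Z : T -> set 'rV[R]_d}.
Hypothesis Z_poisson : standard_poisson_process P Z.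
Implicit Types (a x : 'rV[R]_d).

Local Notation N := (@count _ T R d Z).

Lemma borel_cell n a (j : @cell_index d n) : borel (cell a j).
Proof.
rewrite (_ : cell a j = \bigcap_(i in [set: 'I_d])
  ((fun z : borelType R d => (z : 'rV[R]_d) ord0 i) @^-1`
   [set t | 0 <= t - a ord0 i - corner j ord0 i < (@fineness d n)%:R^-1])); last first.
  by apply/seteqP; split => z /= jz i; [move=> _; exact: jz|exact: jz].
apply: (@fin_bigcap_measurable _ (borelType R d)) => // i _.
pose b := a ord0 i + corner j ord0 i.
rewrite -[X in measurable X]setTI; apply: coord_borel => //.
rewrite (_ : [set t | _] = `[b, b + (@fineness d n)%:R^-1[%classic); first exact: measurable_itv.
by apply/seteqP; split => t /=; rewrite in_itv/= /b => /andP[? ?]; apply/andP; split; lra.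
Qed.

Lemma bounded_cell n a (j : @cell_index d n) : bounded_set (cell a j).
Proof.
have [M [Mr MP]] := @bounded_cball R d a (d%:R * (2 * n.+1%:R)).
exists M; split => // r Mr' z jz; apply: MP => //=; exact: cell_bounded jz.
Qed.

Lemma volume_cell n a (j : @cell_index d n) : volume (cell a j) = volume (cell 0 j).
Proof.
rewrite -(volume_translate a (borel_cell a j)); congr volume.
by apply/seteqP; split => z /= jz i; have := jz i; rewrite !mxE addrK subr0.
Qed.

Lemma volume_cell_fin n a (j : @cell_index d n) : (volume (cell a j) < +oo)%E.
Proof.
have r0 : 0 < d%:R * (2 * n.+1%:R) + 1 :> R by rewrite ltr_wpDl// mulr_ge0.
apply: (le_lt_trans _ (volume_cball_fin a r0)).
apply: le_volume; [exact: borel_cell|exact: borel_cball|].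
by move=> z /cell_bounded zj; rewrite /cball/= (le_trans zj)// lerDl.
Qed.

(** Disjoint cells have independent counts, so both sides are products of Poisson probabilities,
    which depend on the cells only through their volumes. *)
Lemma cell_counts_law n a (f : {ffun @cell_index d n -> nat}) :
  P [set w | forall j, N (cell a j) w = (f j)%:R] =
  P [set w | forall j, N (cell 0 j) w = (f j)%:R].
Proof.
have nE b (j : @cell_index d n) w : npoints (Z w) (cell b j) = (N (cell b j) w)%:E.
  exact: (npointsE Z_poisson w (bounded_cell b j)).
pose m := #|{: @cell_index d n}|; pose e (i : 'I_m) : @cell_index d n := enum_val i.
have key b : P [set w | forall j, N (cell b j) w = (f j)%:R] =
    (\prod_(i < m) P [set w | N (cell b (e i)) w = (f (e i))%:R])%E.
  have tI : trivIset [set: 'I_m] (fun i => cell b (e i)).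
    move=> i i' _ _ [z [zi zi']]; apply: (@enum_val_inj _ {: @cell_index d n}).
    exact: cell_inj zi zi'.
  have mB (i : 'I_m) : measurable [set (f (e i))%:R%:E : \bar R].
    exact: emeasurable_set1.
  have := spp_independent Z_poisson (fun i => borel_cell b (e i)) tI.
  move=> /(_ _ mB) H.
  transitivity (P (\bigcap_(i in [set: 'I_m]) ((fun w => npoints (Z w) (cell b (e i)))
      @^-1` [set (f (e i))%:R%:E]))).
    congr (P _); apply/seteqP; split => w /=.
      by move=> wf i _; rewrite /= nE wf.
    move=> wf j; have := wf (enum_rank j) I.
    by rewrite /= /e enum_rankK nE; case.
  rewrite H; apply: eq_bigr => i _; congr (P _).
  by apply/seteqP; split => w /=; rewrite nE; [case|move=> ->].
rewrite !key; apply: eq_bigr => i _.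
rewrite !(count_poisson Z_poisson) ?volume_cell//.
all: try exact: borel_cell.
all: try exact: bounded_cell.
all: exact: volume_cell_fin.
Qed.

Lemma measurable_cell_counts n a (f : {ffun @cell_index d n -> nat}) :
  measurable [set w | forall j, N (cell a j) w = (f j)%:R].
Proof.
rewrite (_ : [set w | _] = \bigcap_(j in [set: @cell_index d n])
  [set w | N (cell a j) w = (f j)%:R]); last first.
  by apply/seteqP; split => w /= wf j; [move=> _; exact: wf|exact: wf].
apply: fin_bigcap_measurable => // j _.
by apply: (measurable_count_eq Z_poisson); [exact: borel_cell|exact: bounded_cell].
Qed.

(** The counts take countably many values, so for an arbitrary [Q] the event is a countable disjoint
    union of the events of [cell_counts_law]. *)
Lemma cell_count_event n (Q : set {ffun @cell_index d n -> R}) a :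
  P [set w | Q [ffun j => N (cell a j) w]] =
  P [set w | Q [ffun j => N (cell 0 j) w]].
Proof.
pose C : countType := {ffun @cell_index d n -> nat}.
(* With [pickle_inv] a family of counts has a single code, which makes the events disjoint. *)
pose E (b : 'rV[R]_d) (p : nat) := if @pickle_inv C p is Some f then
    if `[< Q [ffun j => (f j)%:R] >] then [set w | forall j, N (cell b j) w = (f j : nat)%:R]
    else set0
  else set0.
have mE b p : measurable (E b p).
  rewrite /E; case: (@pickle_inv C p) => // f; case: asboolP => // _.
  exact: measurable_cell_counts.
have tE b : trivIset [set: nat] (E b).
  move=> p p' _ _ [w []]; rewrite /E.
  case pf: (@pickle_inv C p) => [f|//]; case: asboolP => // _ /= wf.
  case pf': (@pickle_inv C p') => [f'|//]; case: asboolP => // _ /= wf'.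
  have ff' : f = f'.
    by apply/ffunP => j; apply/eqP; rewrite -(eqr_nat R) -wf -wf'.
  have := @pickle_invK C p; have := @pickle_invK C p'; rewrite pf pf' /= => <- <-.
  by rewrite ff'.
have key b : P [set w | Q [ffun j => N (cell b j) w]] = (\sum_(p <oo) P (E b p))%E.
  rewrite -measure_semi_bigcup//; last exact: bigcupT_measurable.
  congr (P _); apply/seteqP; split => w /=.
    move=> Qw; have /choice[f fP] := fun j : @cell_index d n => @countE _ _ R d Z (cell b j) w.
    exists (pickle [ffun j => f j]) => //; rewrite /E pickleK_inv asboolT/=.
      by move=> j; rewrite ffunE.
    rewrite (_ : [ffun _ => _] = [ffun j => N (cell b j) w])//.
    by apply/ffunP => j; rewrite !ffunE.
  move=> [p _]; rewrite /E; case: (@pickle_inv C p) => // f; case: asboolP => // Qf /= wf.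
  by rewrite (_ : [ffun _ => _] = [ffun j => (f j)%:R])//; apply/ffunP => j; rewrite !ffunE wf.
rewrite !key; apply: eq_eseriesr => p _; rewrite /E.
by case: (@pickle_inv C p) => // f; case: asboolP => // _; exact: cell_counts_law.
Qed.

Lemma cell_sum_law (J : Type) n a (x : J -> 'rV[R]_d) (i : J -> 'I_d) (q : J -> R) :
  P [set w | forall k, q k < cell_sum (Z w) a n (x k) (i k)] =
  P [set w | forall k, q k < cell_sum (Z w) 0 n (x k) (i k)].
Proof.
pose Q := [set f : {ffun @cell_index d n -> R} | forall k, q k <
  \sum_(j : @cell_index d n) smooth_kern n.+1%:R (i k) (corner j - x k) * f j].
have key b : [set w | forall k, q k < cell_sum (Z w) b n (x k) (i k)]
    = [set w | Q [ffun j => N (cell b j) w]].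
  have sumE w k : cell_sum (Z w) b n (x k) (i k) = \sum_(j : @cell_index d n)
      smooth_kern n.+1%:R (i k) (corner j - x k) * [ffun j => N (cell b j) w] j.
    by apply: eq_bigr => j _; rewrite ffunE.
  by apply/seteqP; split => w Hw k; [rewrite -sumE|rewrite sumE]; exact: Hw.
by rewrite !key; exact: cell_count_event.
Qed.

Lemma measurable_cell_sum a n x i :
  measurable_fun [set: T] (fun w => cell_sum (Z w) a n x i).
Proof.
apply: measurable_sum => j; apply: measurable_funM; first exact: measurable_cst.
by apply: (count_measurable Z_poisson); [exact: borel_cell|exact: bounded_cell].
Qed.

End cell_law.

(** * Passing laws to almost sure limits *)

Section limit_law.
Context {disp : measure_display} {T : measurableType disp} {R : realType}.
Context {P : probability T R}.

Lemma measurable_all_gt (J : finType) (f : J -> T -> R) (q : J -> R) :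
  (forall i, measurable_fun [set: T] (f i)) ->
  measurable [set w | forall i, q i < f i w].
Proof.
move=> mf; rewrite (_ : [set w | _] = \bigcap_(i in [set: J]) f i @^-1` `]q i, +oo[%classic).
  apply: fin_bigcap_measurable => // i _.
  by rewrite -[X in measurable X]setTI; apply: mf => //; exact: measurable_itv.
by apply/seteqP; split => w /= H i; [move=> _|]; have := H i; rewrite /= in_itv/= andbT// => /(_ I).
Qed.

Lemma measurable_all_ge (J : finType) (f : J -> T -> R) (q : J -> R) :
  (forall i, measurable_fun [set: T] (f i)) ->
  measurable [set w | forall i, q i <= f i w].
Proof.
move=> mf; rewrite (_ : [set w | _] = \bigcap_(i in [set: J]) f i @^-1` `[q i, +oo[%classic).
  apply: fin_bigcap_measurable => // i _.
  by rewrite -[X in measurable X]setTI; apply: mf => //; exact: measurable_itv.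
by apply/seteqP; split => w /= H i; [move=> _|]; have := H i; rewrite /= in_itv/= andbT// => /(_ I).
Qed.

Definition ae_cvg (J : Type) (U : nat -> J -> T -> R) (V : J -> T -> R) :=
  {ae P, forall w, forall i eps, 0 < eps -> exists N, forall n, (N <= n)%N ->
    `|U n i w - V i w| <= eps}.

Lemma measure_le_ae (A B : set T) : measurable A -> measurable B ->
  {ae P, forall w, A w -> B w} -> (P A <= P B)%E.
Proof.
move=> mA mB [N [mN N0 AB]]; apply: (@le_trans _ _ (P (B `|` N))).
  apply: le_measure; rewrite ?inE//; first exact: measurableU.
  move=> w Aw; have [Bw|nBw] := pselect (B w); first by left.
  by right; apply: AB => /= /(_ Aw).
by apply: (@le_trans _ _ (P B + P N)%E); [exact: measureU2|rewrite N0 adde0].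
Qed.

(** If [V > q] then eventually [U n > q], and if [U' n > q] infinitely often then [V' >= q]. The
    lower limit of the first events and the upper limit of the second are compared through equal
    probabilities; strictness is lost. *)
Lemma limit_law_le (J : finType) (U U' : nat -> J -> T -> R) (V V' : J -> T -> R)
    (q : J -> R) :
  (forall n i, measurable_fun [set: T] (U n i)) ->
  (forall n i, measurable_fun [set: T] (U' n i)) ->
  (forall i, measurable_fun [set: T] (V i)) ->
  (forall i, measurable_fun [set: T] (V' i)) ->
  ae_cvg U V -> ae_cvg U' V' ->
  (forall n, P [set w | forall i, q i < U n i w] = P [set w | forall i, q i < U' n i w]) ->
  (P [set w | forall i, (q i < V i w)%R] <= P [set w | forall i, (q i <= V' i w)%R])%E.
Proof.
move=> mU mU' mV mV' UV UV' law.
pose A n := [set w | forall i, q i < U n i w].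
pose A' n := [set w | forall i, q i < U' n i w].
have mA n : measurable (A n) by exact: measurable_all_gt.
have mA' n : measurable (A' n) by exact: measurable_all_gt.
pose B N := \bigcap_(n in [set n | (N <= n)%N]) A n.
pose C N := \bigcup_(n in [set n | (N <= n)%N]) A' n.
have mB N : measurable (B N) by apply: bigcap_measurable => //; exists N => /=.
have mC N : measurable (C N) by exact: bigcup_measurable.
have mbB : measurable (\bigcup_N B N) by exact: bigcupT_measurable.
have mcC : measurable (\bigcap_N C N) by exact: bigcapT_measurable.
apply: (@le_trans _ _ (P (\bigcup_N B N))).
  apply: measure_le_ae => //; first exact: measurable_all_gt.
  apply: filterS UV => w Uw Vw.
  have /choice[N NP] i : exists N, forall n, (N <= n)%N -> q i < U n i w.
    have [|N NP] := Uw i ((V i w - q i) / 2); first by have := Vw i; lra.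
    by exists N => n /NP; rewrite ler_norml => /andP[? ?]; have := Vw i; lra.
  exists (\max_i N i)%N => // n /= Nn i; apply: NP; rewrite (leq_trans _ Nn)//.
  exact: leq_bigmax.
apply: (@le_trans _ _ (P (\bigcap_N C N))); last first.
  apply: measure_le_ae => //; first exact: measurable_all_ge.
  apply: filterS UV' => w Uw Cw i; rewrite leNgt; apply/negP => Vq.
  have [|N NP] := Uw i ((q i - V' i w) / 2); first by lra.
  have [n /= Nn /(_ i)] := Cw N I; have := NP n Nn.
  by rewrite ler_norml => /andP[? ?]; lra.
have cB : P (B n) @[n --> \oo] --> P (\bigcup_N B N).
  apply: nondecreasing_cvg_mu => // N M NM; apply/subsetPset => w Bw n /= Mn.
  by apply: Bw => /=; exact: leq_trans Mn.
have cC : P (C n) @[n --> \oo] --> P (\bigcap_N C N).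
  apply: nonincreasing_cvg_mu => //.
    by rewrite (le_lt_trans (probability_le1 _ (mC _)))// ltry.
  move=> N M NM; apply/subsetPset => w [n /= Mn A'w]; exists n => //=; exact: leq_trans Mn.
rewrite -(cvg_lim _ cB)// -(cvg_lim _ cC)//; apply: lee_lim.
- by apply/cvg_ex; eexists; exact: cB.
- by apply/cvg_ex; eexists; exact: cC.
apply: nearW => N; apply: (@le_trans _ _ (P (A N))).
  by apply: le_measure; rewrite ?inE// => w /(_ N); apply => /=.
rewrite /A law; apply: le_measure; rewrite ?inE; [exact: mA'|exact: mC|].
by move=> w ?; exists N => /=.
Qed.

(** Strictness is regained by applying [limit_law_le] at the levels [q + 1/(p+1)] and letting [p]
    grow. *)
Lemma limit_law_lt (J : finType) (U U' : nat -> J -> T -> R) (V V' : J -> T -> R)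
    (q : J -> R) :
  (forall n i, measurable_fun [set: T] (U n i)) ->
  (forall n i, measurable_fun [set: T] (U' n i)) ->
  (forall i, measurable_fun [set: T] (V i)) ->
  (forall i, measurable_fun [set: T] (V' i)) ->
  ae_cvg U V -> ae_cvg U' V' ->
  (forall n q, P [set w | forall i, q i < U n i w] = P [set w | forall i, q i < U' n i w]) ->
  (P [set w | forall i, (q i < V i w)%R] <= P [set w | forall i, (q i < V' i w)%R])%E.
Proof.
move=> mU mU' mV mV' UV UV' law.
pose E p := [set w | forall i, q i + p.+1%:R^-1 < V i w].
have mE p : measurable (E p) by exact: measurable_all_gt.
have EE : [set w | forall i, q i < V i w] = \bigcup_p E p.
  apply/seteqP; split => w /=.
    move=> Vw; have /choice[N NP] i : exists N, forall n, (N <= n)%N -> q i + n.+1%:R^-1 < V i w.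
      have [N NP] := natr_unbounded ((V i w - q i)^-1 + 1); exists N => n Nn.
      rewrite addrC -ltrBrDr invf_plt ?posrE ?subr_gt0//.
      by have := NP _ (leq_trans Nn (leqnSn n)); lra.
    by exists (\max_i N i)%N => // i; apply: NP; exact: leq_bigmax.
  by move=> [p _] Ew i; have := Ew i; apply: lt_trans; rewrite ltrDl invr_gt0.
have cE : P (E p) @[p --> \oo] --> P (\bigcup_p E p).
  apply: nondecreasing_cvg_mu => //; first exact: bigcupT_measurable.
  move=> p p' pp'; apply/subsetPset => w Ew i; apply: le_lt_trans (Ew i).
  by rewrite lerD2l lef_pV2 ?posrE// ler_nat ltnS.
rewrite EE -(cvg_lim _ cE)//; apply: lime_le; first by apply/cvg_ex; eexists; exact: cE.
apply: nearW => p; apply: (le_trans (limit_law_le mU mU' mV mV' UV UV' (fun n => law n _))).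
apply: le_measure; rewrite ?inE; [exact: measurable_all_ge|exact: measurable_all_gt|].
by move=> w H i; apply: lt_le_trans (H i); rewrite ltrDl invr_gt0.
Qed.

End limit_law.

Section random_fields.
Context {R : realType} {d : nat}.

(** Allowing any finite [J] makes the family closed under intersection, a pi-system; the strict
    inequalities are those of [limit_law_lt]. *)
Definition rays : set (set ('rV[R]_d -> 'rV[R]_d)) :=
  [set D | exists (J : finType) (x : J -> 'rV[R]_d) (i : J -> 'I_d) (q : J -> R),
    D = [set f : 'rV[R]_d -> 'rV[R]_d | forall k, q k < f (x k) ord0 (i k)]].

Definition functionSpace : Type := g_sigma_algebraType rays.
HB.instance Definition _ := Measurable.on functionSpace.

Lemma setI_closed_rays : setI_closed rays.
Proof.
move=> _ _ [J [x [i [q ->]]]] [J' [x' [i' [q' ->]]]].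
exists (J + J')%type, (fun k => match k with inl k => x k | inr k => x' k end),
  (fun k => match k with inl k => i k | inr k => i' k end),
  (fun k => match k with inl k => q k | inr k => q' k end).
apply/seteqP; split => f /=; first by move=> [fq fq'] [].
by move=> fq; split => k; [exact: (fq (inl k))|exact: (fq (inr k))].
Qed.

Lemma measurable_eval x i :
  measurable_fun [set: functionSpace]
    (fun f : functionSpace => (f : 'rV[R]_d -> 'rV[R]_d) x ord0 i).
Proof.
apply: (measurability _ (RGenOInfty.measurableE R)).
move=> _ [_ [q ->] <-]; rewrite setTI; apply: sub_sigma_algebra.
exists unit, (fun=> x), (fun=> i), (fun=> q).
apply/seteqP; split => f /=; first by move=> + _; rewrite in_itv/= andbT.
by rewrite in_itv/= andbT; apply; exact: tt.
Qed.

Lemma cylindrical_measurable (E : set ('rV[R]_d -> 'rV[R]_d)) :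
  cylindrical E -> measurable (E : set functionSpace).
Proof.
move: E; apply: smallest_sub; first exact: sigma_algebra_measurable.
move=> _ [x [B [bB ->]]].
have := measurable_rV (fun i => measurable_eval x i) measurableT bB.
by rewrite setTI.
Qed.

Context {disp : measure_display} {T : measurableType disp}.

Lemma measurable_field (F : T -> 'rV[R]_d -> 'rV[R]_d) :
  (forall x i, measurable_fun [set: T] (fun w => F w x ord0 i)) ->
  measurable_fun [set: T] (F : T -> functionSpace).
Proof.
move=> mF; apply: (@measurability _ _ T functionSpace setT F rays) => //.
move=> _ [_ [J [x [i [q ->]]]] <-]; rewrite setTI.
exact: (@measurable_all_gt _ _ _ _ (fun k w => F w (x k) ord0 (i k))).
Qed.

Lemma field_law_unique (P : probability T R) (F F' : T -> 'rV[R]_d -> 'rV[R]_d) :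
  measurable_fun [set: T] (F : T -> functionSpace) ->
  measurable_fun [set: T] (F' : T -> functionSpace) ->
  (forall E, rays E -> P [set w | E (F w)] = P [set w | E (F' w)]) ->
  forall E, cylindrical E -> P [set w | E (F w)] = P [set w | E (F' w)].
Proof.
move=> mF mF' FF' E cE.
pose nu : {measure set functionSpace -> \bar R} := pushforward P (F : T -> functionSpace).
pose nu' : {measure set functionSpace -> \bar R} := pushforward P (F' : T -> functionSpace).
have := @g_sigma_algebra_measure_unique _ R functionSpace rays _ (fun=> setT) _ _
  (nu mF) (nu' mF') setI_closed_rays _ _ E (cylindrical_measurable cE).
apply.
- by move=> D rD; exact: sub_sigma_algebra.
(* The full space is the case of no constraint, indexed by the empty type. *)
- by move=> _; exists void, (fun=> 0), (fun v : void => match v with end), (fun=> 0);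
    apply/seteqP; split => // f _ [].
- by rewrite bigcup_const//; exists 0%N.
- by move=> D rD; exact: FF'.
- by move=> _; apply: (@le_lt_trans _ _ (P setT)) => //; rewrite probability_setT ltry.
Qed.

End random_fields.

Section random_force.
Context {disp : measure_display} {T : measurableType disp} {R : realType}.
Context {P : probability T R} {d : nat} {Z : T -> set 'rV[R]_d}.
Hypotheses (Z_poisson : standard_poisson_process P Z) (d3 : (3 <= d)%N).

Let d0 : (0 < d)%N. Proof. exact: leq_trans d3. Qed.

(** An upper limit of measurable functions is defined for every [w] and [x] and measurable in [w];
    [fine] sends an infinite value to 0. *)
Definition random_force (w : T) (x : 'rV[R]_d) : 'rV[R]_d :=
  \row_i fine (limn_esup (fun n => (cell_sum (Z w) 0 n x i)%:E)).

Lemma no_point_ae x : {ae P, forall w, ~ Z w x}.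
Proof.
have b1 : borel [set x].
  apply: closed_borel; apply: accessible_closed_set1.
  exact/hausdorff_accessible/norm_hausdorff.
have bd1 : bounded_set [set x].
  by exists `|x|; split => // M xM _ ->; exact: ltW.
have v1 := volume_set1 x d0.
exists (~` [set w | @count _ _ R d Z [set x] w = 0%:R]); split.
- by apply: measurableC; exact: (measurable_count_eq Z_poisson).
- rewrite probability_setC; last exact: (measurable_count_eq Z_poisson).
  rewrite (count_poisson Z_poisson)// ?v1//=.
  by rewrite expr0 fact0 divr1 mul1r oppr0 expR0 subee.
- move=> w /= /contrapT Zx; rewrite /count cardE => /eqP; rewrite pnatr_eq0.
  rewrite cardfs_eq0 => /eqP H.
  have : x \in fset_set (Z w `&` [set x]).
    rewrite in_fset_set ?inE//; exact: (spp_locally_finite Z_poisson).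
  by rewrite H inE.
Qed.

Lemma cell_sum_ae a x : {ae P, forall w, ~ Z w (x + a) /\
  forall i eps, 0 < eps -> exists N, forall n, (N <= n)%N ->
    `|cell_sum (Z w) a n x i - force (Z w) (x + a) ord0 i| <= eps}.
Proof.
apply: filterS2 (no_point_ae (x + a)) (regular_ae Z_poisson d3) => w Zw rw.
by split => // i eps e0; exact: (cell_sum_cvg i d0 rw Zw e0).
Qed.

Lemma random_force_version x :
  {ae P, forall w, (~` Z w) x /\ force (Z w) x = random_force w x}.
Proof.
apply: filterS (cell_sum_ae 0 x) => w; rewrite addr0 => -[Zw cw]; split => //.
apply/rowP => i; rewrite mxE.
have cv : (fun n => (cell_sum (Z w) 0 n x i)%:E) @ \oo --> (force (Z w) x ord0 i)%:E.
  apply: cvg_EFin; first by apply: nearW.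
  apply/cvgrPdist_le => eps e0; have [N NP] := cw i eps e0.
  by exists N => // n /= Nn; rewrite distrC; exact: NP.
by rewrite (cvg_limn_einf_sup cv).2.
Qed.

Lemma measurable_random_force x i :
  measurable_fun [set: T] (fun w => random_force w x ord0 i).
Proof.
under eq_fun do rewrite mxE.
apply: measurableT_comp; first exact: fine_measurable.
apply: measurable_fun_limn_esup => n; apply/measurable_EFinP.
exact: (measurable_cell_sum Z_poisson).
Qed.

Lemma random_force_random_function : random_function random_force.
Proof.
move=> E /cylindrical_measurable mE.
by have := measurable_field measurable_random_force measurableT mE; rewrite setTI.
Qed.

Lemma cell_sum_ae_cvg (J : finType) a (x : J -> 'rV[R]_d) (i : J -> 'I_d) :
  @ae_cvg _ _ _ P J (fun n k w => cell_sum (Z w) a n (x k) (i k))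
    (fun k w => random_force w (x k + a) ord0 (i k)).
Proof.
have H k : {ae P, forall w, forall eps, 0 < eps -> exists N, forall n, (N <= n)%N ->
    `|cell_sum (Z w) a n (x k) (i k) - random_force w (x k + a) ord0 (i k)| <= eps}.
  apply: filterS2 (cell_sum_ae a (x k)) (random_force_version (x k + a)).
  by move=> w [_ cw] [_ <-] eps e0; exact: cw.
by apply: filter_forall => k; exact: H.
Qed.

(** The grid shifted by [a] approximates the force at [x + a], the unshifted one the force at [x],
    and the cell sums have the same law. [limit_law_lt] in both directions gives equality on
    [rays]. *)
Lemma random_force_translation_invariant : translation_invariant P random_force.
Proof.
move=> a E cE.
have mF := measurable_field measurable_random_force.
have mFa : measurable_fun [set: T]
    ((fun w x => random_force w (x + a)) : T -> @functionSpace R d).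
  by apply: measurable_field => x i; exact: measurable_random_force.
refine (field_law_unique mFa mF _ cE).
move=> _ [J [x [i [q ->]]]]/=.
have mU b n k : measurable_fun [set: T] (fun w => cell_sum (Z w) b n (x k) (i k)).
  exact: (measurable_cell_sum Z_poisson).
have mV b k : measurable_fun [set: T] (fun w => random_force w (x k + b) ord0 (i k)).
  exact: measurable_random_force.
have le b c : (forall n q, P [set w | forall k, q k < cell_sum (Z w) b n (x k) (i k)] =
                           P [set w | forall k, q k < cell_sum (Z w) c n (x k) (i k)]) ->
    (P [set w | forall k, (q k < random_force w (x k + b) ord0 (i k))%R] <=
     P [set w | forall k, (q k < random_force w (x k + c) ord0 (i k))%R])%E.
  exact: (limit_law_lt q (mU b) (mU c) (mV b) (mV c)
    (cell_sum_ae_cvg b x i) (cell_sum_ae_cvg c x i)).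
have E0 : [set w | forall k, q k < random_force w (x k) ord0 (i k)] =
    [set w | forall k, q k < random_force w (x k + 0) ord0 (i k)].
  by apply/seteqP; split => w H k; have := H k; rewrite addr0.
have le_a0 := le a 0 (fun n q' => cell_sum_law Z_poisson n a x i q').
have le_0a := le 0 a (fun n q' => esym (cell_sum_law Z_poisson n a x i q')).
apply: etrans (esym (congr1 (fun A => P A) E0)).
exact: le_anti (introT andP (conj le_a0 le_0a)).
Qed.

End random_force.

Theorem proposition1 (R : realType) (d : nat) (disp : measure_display)
    (T : measurableType disp) (P : probability T R) (Z : T -> set 'rV[R]_d)
    (d_ge3 : (3 <= d)%N) (Z_poisson : standard_poisson_process P Z) :
  {ae P, forall w, forall x, (~` Z w) x ->
     exists l, sum_by_distance (Z w) x (attraction x) l} /\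
  (exists G : T -> 'rV[R]_d -> 'rV[R]_d,
     [/\ random_function G,
         version_of P (fun w => ~` Z w) (fun w => force (Z w)) G
       & translation_invariant P G]) /\
  {ae P, forall w, continuously_differentiable_on (~` Z w) (force (Z w))}.
Proof.
have d0 : (0 < d)%N by exact: leq_trans d_ge3.
have rZ := regular_ae Z_poisson d_ge3.
split; [|split].
- apply: filterS rZ => w rw x _; have [l wl] := kern_limit_ex x rw.
  by exists l; exact: kern_limit_sum d0 rw wl.
- exists (@random_force _ _ _ _ Z); split.
  + exact: random_force_random_function Z_poisson.
  + exact: random_force_version Z_poisson d_ge3.
  + exact: random_force_translation_invariant Z_poisson d_ge3.
- by apply: filterS rZ => w rw; exact: force_C1 d0 rw.
Qed.
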